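(* Let $(x_n)_{n\ge 0}$ be a (not necessarily self-adjoint) martingale in $\mathcal M$ with respect to the filtration $(\mathcal M_n)_{n\ge 0}$, with $x_0=0$, and let $d_n=x_n-x_{n-1}$ for $n\ge 1$. Define $$s_n^2=\max\left\{\Big\|\sum_{i=1}^n E_{i-1}(d_i^*d_i)\Big\|_\infty,\ \Big\|\sum_{i=1}^n E_{i-1}(d_id_i^* )\Big\|_\infty\right\},\qquad u_n=L(s_n^2)^{1/2}.$$ Suppose that $s_n^2\to\infty$ and that $\|d_n\|_\infty\le \frac{\alpha_n s_n}{u_n}$ for all $n\ge 1$, where $(\alpha_n)$ is a sequence of positive numbers with $\alpha_n\to 0$. Then $$\limsup_{n\to\infty}\frac{x_n}{s_nu_n}\ \underset{a.u.}{\le}\ \sqrt2 .$$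
   Context: $\mathcal M$ is a finite von Neumann algebra acting on a separable Hilbert space, with a faithful normal tracial state $\tau$; $\|\cdot\|_\infty$ is the operator norm. $(\mathcal M_n)_{n\ge 0}$ is an increasing sequence of von Neumann subalgebras of $\mathcal M$ with $\mathcal M_0=\mathbb C1$ and $\bigcup_n\mathcal M_n$ weak-* dense in $\mathcal M$; $E_n:\mathcal M\to\mathcal M_n$ is the normal $\tau$-preserving conditional expectation (so $E_m\circ E_n=E_{\min\{m,n\}}$ and $E_0=\tau(\cdot)1$). A martingale in $\mathcal M$ is a sequence $(x_n)$ with $x_n\in\mathcal M_n$ and $E_n(x_{n+1})=x_n$ for all $n$. $L(x)=\max\{1,\ln\ln x\}$ for $x>1$, and $L(x)=1$ for $0\le x\le 1$. Since $s_n\to\infty$, the quotient $x_n/(s_nu_n)$ is defined for all large $n$. For a sequence $(a_n)$ of $\tau$-measurable operators affiliated with $\mathcal M$ and $K\ge0$, the notation $\limsup_{n\to\infty}a_n\underset{a.u.}{\le}K$ means: for all $\epsilon,\delta>0$ there is a projection $p\in\mathcal M$ with $\tau(1-p)<\epsilon$ and $\limsup_{n\to\infty}\|a_np\|\le K+\delta$ (operator norm). *)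

(* Defs.v *)
From mathcomp Require Import all_boot all_order all_algebra complex.
From mathcomp Require Import all_classical all_reals all_analysis.

Set Implicit Arguments.
Unset Strict Implicit.
Unset Printing Implicit Defensive.

Import Order.TTheory GRing.Theory Num.Theory.
Import numFieldNormedType.Exports.

Local Open Scope classical_set_scope.
Local Open Scope complex_scope.
Local Open Scope ring_scope.

(** Operators on a complex Hilbert space [H] are plain functions [H -> H] with
    their pointwise vector space structure; the product is composition. The
    inner product is linear in its first argument. *)

Section Operators.
Context {R : realType} {H : completeNormedModType R[i]}.
Variable ip : {dot H for @Num.conj R[i]}.
Implicit Types (a b p : H -> H) (M N S A : set (H -> H)).

Definition hilbert_norm : Prop := forall v : H, `|v| ^+ 2 = ip v v.

Definition separable_space : Prop := exists2 A : set H, countable A & dense A.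

Definition bounded_op a : Prop := linear a /\ continuous a.

(* The norm of [H] takes its values in R[i], hence the real part. *)
Definition opnorm a : R :=
  sup [set complex.Re `|a v| | v in [set v : H | `|v| <= 1]].

Definition is_adjoint a b : Prop := forall u v, ip (a u) v = ip u (b v).

(* Total by convention: 0 if [a] has no adjoint, which does not happen for a
   bounded operator. *)
Definition adj a : H -> H := xget 0 [set b | is_adjoint a b].

(* In a complex Hilbert space this implies that [a] is self-adjoint:
   [0 <= z] in R[i] means that [z] is real and nonnegative. *)
Definition pos_op a : Prop := forall v, 0 <= ip (a v) v.

Definition le_op a b : Prop := pos_op (b - a).

Definition projection p : Prop := p \o p = p /\ is_adjoint p p.

Definition commutant S : set (H -> H) :=
  [set b | bounded_op b /\ forall a, S a -> a \o b = b \o a].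

Definition von_neumann_algebra M : Prop :=
  [/\ M `<=` bounded_op,
      forall a, M a -> exists2 b, M b & is_adjoint a b &
      commutant (commutant M) = M].

Definition square_summable (xi : nat -> H) : Prop :=
  cvgn (series (fun k => complex.Re `|xi k| ^+ 2)).

(* The weak-* continuous functionals of [M] (the elements of its predual) are
   the restrictions of these. *)
Definition ultraweak (phi : (H -> H) -> R[i]) : Prop :=
  exists xi eta : nat -> H,
    [/\ square_summable xi, square_summable eta &
        forall a, bounded_op a ->
          series (fun k => ip (a (xi k)) (eta k) : R[i]^o) @ \oo
            --> (phi a : R[i]^o)].

(* Every basic weak-* neighbourhood of every point of [M] meets [A]. *)
Definition weakstar_dense A M : Prop :=
  forall a, M a ->
  forall (k : nat) (phi : 'I_k -> (H -> H) -> R[i]) (eps : R),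
    (forall j, ultraweak (phi j)) -> 0 < eps ->
    exists2 b, A b & forall j, `|phi j b - phi j a| < eps%:C.

Definition directed A : Prop :=
  A !=set0 /\
  forall a b, A a -> A b -> exists c, [/\ A c, le_op a c & le_op b c].

Definition is_lub {T : Type} (le : T -> T -> Prop) (D B : set T) (s : T)
    : Prop :=
  [/\ D s, forall t, B t -> le t s &
      forall r, D r -> (forall t, B t -> le t r) -> le s r].

(* Normality: preservation of the suprema of bounded increasing nets of
   positive elements. *)
Definition normal_on M {T : Type} (le : T -> T -> Prop) (D : set T)
    (Phi : (H -> H) -> T) : Prop :=
  forall A s, A `<=` [set a | M a /\ pos_op a] -> directed A ->
    is_lub le_op M A s -> is_lub le D [set Phi a | a in A] (Phi s).

Record faithful_normal_tracial_state M (tau : (H -> H) -> R[i]) : Prop := {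
  state_linear : forall (c : R[i]) a b, M a -> M b ->
    tau (c *: a + b) = c * tau a + tau b ;
  state_pos : forall a, M a -> pos_op a -> 0 <= tau a ;
  state_unit : tau idfun = 1 ;
  state_tracial : forall a b, M a -> M b -> tau (a \o b) = tau (b \o a) ;
  state_faithful : forall a, M a -> pos_op a -> tau a = 0 -> a = 0 ;
  state_normal : normal_on M (fun z w : R[i] => z <= w) setT tau }.

Record normal_cond_exp M N (tau : (H -> H) -> R[i])
    (E : (H -> H) -> (H -> H)) : Prop := {
  cond_exp_mem : forall a, M a -> N (E a) ;
  cond_exp_linear : forall (c : R[i]) a b, M a -> M b ->
    E (c *: a + b) = c *: E a + E b ;
  cond_exp_id : forall a, N a -> E a = a ;
  cond_exp_pos : forall a, M a -> pos_op a -> pos_op (E a) ;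
  cond_exp_bimodule : forall a b c, N a -> M b -> N c ->
    E (a \o b \o c) = a \o E b \o c ;
  cond_exp_trace : forall a, M a -> tau (E a) = tau a ;
  cond_exp_normal : normal_on M le_op N E }.

Record filtration M (Mn : nat -> set (H -> H)) : Prop := {
  filtration_vna : forall n, von_neumann_algebra (Mn n) ;
  filtration_sub : forall n, Mn n `<=` M ;
  filtration_incr : forall n, Mn n `<=` Mn n.+1 ;
  filtration_scalars : Mn 0%N = [set c *: idfun | c in [set: R[i]]] ;
  filtration_dense : weakstar_dense (\bigcup_n Mn n) M }.

Definition martingale (Mn : nat -> set (H -> H))
    (E : nat -> (H -> H) -> (H -> H)) (x : nat -> H -> H) : Prop :=
  forall n, Mn n (x n) /\ E n (x n.+1) = x n.

(* Only used for [n >= 1]; junk value [mdiff x 0 = 0]. *)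
Definition mdiff (x : nat -> H -> H) (n : nat) : H -> H := x n - x n.-1.

Definition LL (t : R) : R := if 1 < t then Num.max 1 (ln (ln t)) else 1.

Definition s2 (E : nat -> (H -> H) -> (H -> H)) (x : nat -> H -> H) (n : nat)
    : R :=
  let d := mdiff x in
  Num.max (opnorm (\sum_(1 <= i < n.+1) E i.-1 (adj (d i) \o d i)))
          (opnorm (\sum_(1 <= i < n.+1) E i.-1 (d i \o adj (d i)))).

Definition s_ E x n : R := Num.sqrt (s2 E x n).

Definition u_ E x n : R := Num.sqrt (LL (s2 E x n)).

Definition limsup_au_le M (tau : (H -> H) -> R[i]) (a : nat -> H -> H) (K : R)
    : Prop :=
  forall eps delta : R, 0 < eps -> 0 < delta ->
    exists p, [/\ M p, projection p, tau (idfun - p) < eps%:C &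
      (limn_esup (fun n => (opnorm (a n \o p))%:E) <= (K + delta)%:E)%E].

End Operators.

(* Main.v *)
Require Import Defs.
From HB Require Import structures.
From mathcomp Require Import all_boot all_order all_algebra complex.
From mathcomp Require Import all_classical all_reals all_analysis.
From mathcomp Require Import ring lra.

(** A non-self-adjoint martingale [x] is dilated to the self-adjoint 2x2 matrix
    [[0, x], [x^*, 0]], whose conditional square function is the diagonal matrix
    of the two brackets. The Golden-Thompson inequality, together with
    [e^d <= 1 + d + c d^2] for small [d] and the convexity of [w |-> tau (e^w)],
    yields step by step [tau (exp (lam y_N)) <= exp (c lam^2 s_N^2)] with [c] as
    close to 1/2 as desired; the constant [sqrt 2] comes from there. No operator
    exponential is needed: [exp w] is replaced by [(1 + w / m)^m] with [m] a power
    of 2, the errors are [O(1 / m)], and letting [m] tend to infinity leaves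
    bounds on the moments [tau (|x_N|^2j)].

    On a block [beta^(k-1) < s_n^2 <= beta^k], with last index [N], one has
    [|x_n|^2 <= E_n (|x_N|^2) <= t_k + E_n (t_k^(1-j) |x_N|^2j)], and Cuculescu's
    projections control the last term. Run over all blocks at once they give one
    decreasing sequence of projections, whose limit is the projection sought: the
    traces of the discarded parts are summable in [k] when [j] is about
    [ln ln beta^k]. *)

Set Implicit Arguments.
Unset Strict Implicit.
Unset Printing Implicit Defensive.

Import Order.TTheory GRing.Theory Num.Theory.
Import numFieldNormedType.Exports.

Local Open Scope classical_set_scope.
Local Open Scope complex_scope.
Local Open Scope ring_scope.

(** The obstacle is that nothing commutes: neither a difference [d] with the past, nor the
    compensators [h] of the squares with each other, so the bracket cannot be factored out of the
    exponential. It is kept in the exponent instead. In [S + d_0 + ... + d_(n-1) - h_0 - ... -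
    h_(n-1)] each step trades a compensator for a difference: Golden-Thompson splits off [d], the
    conditional expectation replaces its exponential by [1 + h], and convexity puts [h] back into
    the exponent, where it cancels [- h]. What is left at the end, [S] minus the bracket, is
    positive and is dropped by monotonicity of the trace of the exponential.

    The constant arises from [j] near [L = ln ln T] and [lam ^+ 2 * T] near [2 * j]: by Stirling,
    [(2 * j)! * expR j / (lam ^+ 2 * thr) ^+ j] with [thr = 2 * T * L] is about [expR (- j)], that
    is about [1 / k] at [T = beta ^ k]. This is the borderline of summability, and any larger
    constant in the threshold crosses it. *)

Lemma discriminant_le (R : realFieldType) (p q s : R) : 0 <= p ->
  (forall r, 0 <= r ^+ 2 * p + 2 * r * q + s) -> q ^+ 2 <= p * s.
Proof.
rewrite le_eqVlt => /predU1P[<-|p0] h.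
  case: (eqVneq q 0) => [->|q0]; first by rewrite expr0n mul0r.
  have := h (- (s + 1) / (2 * q)).
  have -> : (- (s + 1) / (2 * q)) ^+ 2 * 0 + 2 * (- (s + 1) / (2 * q)) * q + s = -1.
    by field.
  by rewrite ler0N1.
have := h (- q / p).
have -> : (- q / p) ^+ 2 * p + 2 * (- q / p) * q + s = (p * s - q ^+ 2) / p.
  by field; rewrite gt_eqF.
by rewrite pmulr_lge0 ?invr_gt0// subr_ge0.
Qed.

(** * Rings with a tracial state *)

Section TracialRing.
Variables (R : realType) (A : pzRingType).

(** Interface instantiated twice: by the algebra, with the real part of its state as [t], and by the
    2x2 matrices over it. *)
Record tracial (sc : {rmorphism R -> A}) (st : A -> A) (t : A -> R) : Prop := {
  tr_sc : forall r a, sc r * a = a * sc r ;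
  tr_stD : {morph st : a b / a + b} ;
  tr_stM : forall a b, st (a * b) = st b * st a ;
  tr_stK : involutive st ;
  tr_st_sc : forall r, st (sc r) = sc r ;
  tr_D : {morph t : a b / a + b} ;
  tr_Z : forall r a, t (sc r * a) = r * t a ;
  tr_C : forall a b, t (a * b) = t (b * a) ;
  tr_st : forall a, t (st a) = t a ;
  tr_ge0 : forall a, 0 <= t (st a * a) ;
  tr_1 : t 1 = 1 }.

Variables (sc : {rmorphism R -> A}) (st : A -> A) (t : A -> R).
Hypothesis T : tracial sc st t.

Let tD := tr_D T.
Let tC := tr_C T.
Let stM := tr_stM T.

Lemma trace0 : t 0 = 0.
Proof. by apply: (addrI (t 0)); rewrite -tD !addr0. Qed.

Lemma traceN a : t (- a) = - t a.
Proof. by apply/eqP; rewrite -addr_eq0 -tD addNr trace0. Qed.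

Lemma traceB a b : t (a - b) = t a - t b.
Proof. by rewrite tD traceN. Qed.

Lemma trace_sum I (r : seq I) (P : pred I) F :
  t (\sum_(i <- r | P i) F i) = \sum_(i <- r | P i) t (F i).
Proof. exact: (big_morph t tD trace0). Qed.

Lemma star0 : st 0 = 0.
Proof. by apply: (addrI (st 0)); rewrite -(tr_stD T) !addr0. Qed.

Lemma starN a : st (- a) = - st a.
Proof. by apply/eqP; rewrite -addr_eq0 -(tr_stD T) addNr star0. Qed.

Lemma starB a b : st (a - b) = st a - st b.
Proof. by rewrite (tr_stD T) starN. Qed.

Lemma star1 : st 1 = 1.
Proof. by rewrite -(rmorph1 sc) (tr_st_sc T). Qed.

Lemma starX a n : st (a ^+ n) = st a ^+ n.
Proof.
by elim: n => [|n IH]; rewrite ?expr0 ?star1// exprS stM IH -exprSr.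
Qed.

Lemma star_sum I (r : seq I) (P : pred I) F :
  st (\sum_(i <- r | P i) F i) = \sum_(i <- r | P i) st (F i).
Proof. exact: (big_morph st (tr_stD T) star0). Qed.

Lemma traceZ r a : t (sc r * a) = r * t a. Proof. exact: (tr_Z T). Qed.

Lemma trace_sc r : t (sc r) = r.
Proof. by rewrite -[sc r]mulr1 traceZ (tr_1 T) mulr1. Qed.

Lemma comm_sc r a : GRing.comm (sc r) a. Proof. exact: (tr_sc T). Qed.

Definition gns_sq a := t (st a * a).
Definition gns_norm a := Num.sqrt (gns_sq a).

Lemma gns_sq_ge0 a : 0 <= gns_sq a. Proof. exact: (tr_ge0 T). Qed.
Lemma gns_norm_ge0 a : 0 <= gns_norm a. Proof. exact: sqrtr_ge0. Qed.
Lemma gns_normE a : gns_norm a ^+ 2 = gns_sq a. Proof. by rewrite sqr_sqrtr ?gns_sq_ge0. Qed.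

Lemma trace_starC a b : t (st a * b) = t (st b * a).
Proof. by rewrite -(tr_st T) stM (tr_stK T). Qed.

Lemma gns_sqD a b : gns_sq (a + b) = gns_sq a + 2 * t (st a * b) + gns_sq b.
Proof.
rewrite /gns_sq (tr_stD T) mulrDl !mulrDr !tD [t (st b * a)]trace_starC; ring.
Qed.

Lemma gns_sqZ r a : gns_sq (sc r * a) = r ^+ 2 * gns_sq a.
Proof.
by rewrite /gns_sq stM (tr_st_sc T) mulrA -(mulrA (st a)) -rmorphM -comm_sc -mulrA traceZ expr2.
Qed.

Lemma gns_sqN a : gns_sq (- a) = gns_sq a.
Proof. by rewrite /gns_sq starN mulrNN. Qed.

Lemma cauchy_schwarz_sq a b : t (st a * b) ^+ 2 <= gns_sq a * gns_sq b.
Proof.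
apply: discriminant_le => [|r]; first exact: gns_sq_ge0.
have := gns_sq_ge0 (sc r * a + b).
by rewrite gns_sqD gns_sqZ stM (tr_st_sc T) -comm_sc -mulrA traceZ mulrA.
Qed.

Lemma cauchy_schwarz a b : `|t (st a * b)| <= gns_norm a * gns_norm b.
Proof.
rewrite -(@ler_pXn2r _ 2) ?nnegrE ?mulr_ge0 ?gns_norm_ge0//.
by rewrite exprMn !gns_normE real_normK ?num_real// cauchy_schwarz_sq.
Qed.

Lemma gns_normD a b : gns_norm (a + b) <= gns_norm a + gns_norm b.
Proof.
rewrite -(@ler_pXn2r _ 2) ?nnegrE ?addr_ge0 ?gns_norm_ge0//.
rewrite gns_normE gns_sqD sqrrD !gns_normE lerD2r lerD2l -[leRHS]mulr_natl ler_pM2l//.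
exact: le_trans (ler_norm _) (cauchy_schwarz _ _).
Qed.

Lemma gns_normZ r a : gns_norm (sc r * a) = `|r| * gns_norm a.
Proof. by rewrite /gns_norm gns_sqZ sqrtrM ?sqr_ge0// sqrtr_sqr. Qed.

Lemma gns_normN a : gns_norm (- a) = gns_norm a.
Proof. by rewrite /gns_norm gns_sqN. Qed.

(** A bound for left multiplication by [X] on the L^2 space of the trace. It replaces the operator
    norm because it also makes sense for the 2x2 matrices, which are not given as operators on
    [H]. *)
Definition bnd (X : A) (K : R) := 0 <= K /\ forall Y, gns_norm (X * Y) <= K * gns_norm Y.

Lemma bnd_sc r : bnd (sc r) `|r|.
Proof. by split=> // Y; rewrite gns_normZ. Qed.

Lemma bnd1 : bnd 1 1.
Proof. by split=> // Y; rewrite !mul1r. Qed.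

Lemma bndD X Z K L : bnd X K -> bnd Z L -> bnd (X + Z) (K + L).
Proof.
move=> [K0 hK] [L0 hL]; split; first exact: addr_ge0.
move=> Y; rewrite !mulrDl; apply: (le_trans (gns_normD _ _)); exact: lerD.
Qed.

Lemma bndN X K : bnd X K -> bnd (- X) K.
Proof. by move=> [K0 hK]; split=> // Y; rewrite mulNr gns_normN. Qed.

Lemma bndM X Z K L : bnd X K -> bnd Z L -> bnd (X * Z) (K * L).
Proof.
move=> [K0 hK] [L0 hL]; split; first exact: mulr_ge0.
move=> Y; rewrite -!mulrA; apply: le_trans (hK _) _.
by rewrite ler_wpM2l.
Qed.

Lemma bndX X K n : bnd X K -> bnd (X ^+ n) (K ^+ n).
Proof.
move=> h; elim: n => [|n IH]; rewrite ?expr0 ?exprS; first exact: bnd1.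
exact: bndM.
Qed.

Lemma bndW X K L : bnd X K -> K <= L -> bnd X L.
Proof.
move=> [K0 hK] KL; split; first exact: le_trans KL.
move=> Y; apply: (le_trans (hK _)); rewrite ler_wpM2r// gns_norm_ge0//.
Qed.

Lemma bnd_t X K : bnd X K -> `|t X| <= K.
Proof.
move=> [K0 /(_ 1)]; rewrite mulr1 => h.
have n1 : gns_norm 1 = 1 by rewrite /gns_norm /gns_sq mulr1 star1 (tr_1 T) sqrtr1.
have := cauchy_schwarz 1 X; rewrite star1 mul1r n1 mul1r => h'.
by apply: le_trans h' (le_trans h _); rewrite n1 mulr1.
Qed.

Lemma bnd_form X K Y : bnd X K -> `|t (st Y * X * Y)| <= K * gns_sq Y.
Proof.
move=> [K0 /(_ Y) h]; rewrite -mulrA.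
apply: le_trans (cauchy_schwarz _ _) _.
by rewrite -gns_normE expr2 mulrCA ler_wpM2l ?gns_norm_ge0.
Qed.

Lemma bnd_subX X Y K e n : bnd X K -> bnd Y K -> bnd (X - Y) e ->
  bnd (X ^+ n.+1 - Y ^+ n.+1) (n.+1%:R * K ^+ n * e).
Proof.
move=> hX hY he; elim: n => [|n IH]; first by rewrite !expr1 expr0 !mul1r.
have -> : X ^+ n.+2 - Y ^+ n.+2 = X * (X ^+ n.+1 - Y ^+ n.+1) + (X - Y) * Y ^+ n.+1.
  by rewrite mulrBr mulrBl -!exprS addrA subrK.
have -> : n.+2%:R * K ^+ n.+1 * e = K * (n.+1%:R * K ^+ n * e) + e * K ^+ n.+1.
  by rewrite -addn1 natrD exprS; ring.
by apply: bndD; apply: bndM => //; exact: bndX.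
Qed.

(** Positivity of left multiplication on the L^2 space of the trace. The exponential estimates use
    it with [Y] half of an even power of [euler m w]. *)
Definition posop P := forall Y, 0 <= t (st Y * P * Y).

(* Golden-Thompson in discrete, dyadic form: both halves feed each other. *)
Lemma trace_pow2 k :
  (forall X, `|t (X ^+ (2 ^ k.+1))| <= t ((st X * X) ^+ (2 ^ k))) /\
  (forall a b, st a = a -> st b = b ->
     t ((a * b) ^+ (2 ^ k)) <= t (a ^+ (2 ^ k) * b ^+ (2 ^ k))).
Proof.
have ts X : `|t (X ^+ 2)| <= t (st X * X).
  have h1 := gns_sq_ge0 (st X - X); have h2 := gns_sq_ge0 (st X + X).
  move: h1 h2; rewrite !gns_sqD gns_sqN /gns_sq !(tr_stK T) mulrN traceN (tC X (st X)).
  by rewrite -expr2 ler_norml => h1 h2; apply/andP; split; lra.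
have cyc a b n : t ((a * b) ^+ n.+1) = t ((b * a) ^+ n.+1).
  suff -> : (a * b) ^+ n.+1 = a * (b * a) ^+ n * b by rewrite tC mulrA exprS.
  elim: n => [|n IH]; first by rewrite expr1 expr0 mulr1.
  by rewrite exprSr IH exprSr !mulrA.
have pow_gt0 n : (2 ^ n)%N = (2 ^ n).-1.+1 by rewrite prednK// expn_gt0.
elim: k => [|k [IHX IHab]].
  by split=> [X|a b _ _]; rewrite !expr1 ?ts.
split=> [X|a b ha hb]; last first.
  apply: le_trans (le_trans (ler_norm _) (IHX _)) _.
  rewrite stM ha hb -(mulrA b) pow_gt0 cyc -pow_gt0.
  rewrite !(mulrA a) -(mulrA (a * a)) -!expr2.
  have := IHab (a ^+ 2) (b ^+ 2).
  by rewrite !starX ha hb -!exprM -!expnS; apply.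
(* The first claim at rank [k] for [X ^+ 2] gives a word that is cyclically a power of [a * b], with
   [a = |X|^2] and [b = |X^*|^2]; the second claim at rank [k] then separates the two factors. *)
have -> : X ^+ (2 ^ k.+2) = (X ^+ 2) ^+ (2 ^ k.+1) by rewrite -exprM -expnS.
apply: le_trans (IHX _) _.
set a := st X * X; set b := X * st X.
have sa : st a = a by rewrite stM (tr_stK T).
have sb : st b = b by rewrite stM (tr_stK T).
have -> : st (X ^+ 2) * X ^+ 2 = st X * (a * X) by rewrite starX !expr2 /a !mulrA.
rewrite pow_gt0 cyc -pow_gt0 -mulrA.
apply: le_trans (IHab _ _ sa sb) _.
have eab : t (b ^+ (2 ^ k.+1)) = t (a ^+ (2 ^ k.+1)) by rewrite pow_gt0 cyc.
(* Powers of [a] and [b] have equal traces, so the arithmetic-geometric inequality returns to powers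
   of [a] alone. *)
have := gns_sq_ge0 (a ^+ (2 ^ k) - b ^+ (2 ^ k)).
rewrite gns_sqD gns_sqN /gns_sq mulrN traceN !starX sa sb -!exprD addnn -mul2n -expnS eab; lra.
Qed.

(* Each use of Cauchy-Schwarz halves the exponent. *)
Lemma trace_young k a b : st a = a -> st b = b ->
  (2 ^ k)%:R * t (a ^+ (2 ^ k).-1 * b) <=
    (2 ^ k).-1%:R * t (a ^+ (2 ^ k)) + t (b ^+ (2 ^ k)).
Proof.
elim: k a b => [|k IH] a b ha hb; first by rewrite !mul1r mul0r add0r expr1.
have pow_gt0 n : (2 ^ n)%N = (2 ^ n).-1.+1 by rewrite prednK// expn_gt0.
set n := (2 ^ k)%N; have n0 : (0 < n)%N by rewrite expn_gt0.
have {IH} := IH (a ^+ 2) (b ^+ 2); rewrite !starX ha hb => /(_ erefl erefl).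
rewrite -!exprM -expnS -/n => h.
have e1 : (2 ^ k.+1).-1 = (n + n.-1)%N.
  by rewrite expnS -/n mul2n -addnn -[in LHS](prednK n0) addnS /= addSn addnC -addnS prednK.
have e2 : gns_sq (a ^+ n) = t (a ^+ (2 ^ k.+1)).
  by rewrite /gns_sq starX ha -exprD addnn -mul2n /n -expnS.
have e3 : gns_sq (a ^+ n.-1 * b) = t (a ^+ (2 * n.-1) * b ^+ 2).
  by rewrite /gns_sq stM starX ha hb mul2n -addnn exprD expr2 -!mulrA tC !mulrA.
have e4 : t (st (a ^+ n) * (a ^+ n.-1 * b)) = t (a ^+ (2 ^ k.+1).-1 * b).
  by rewrite starX ha mulrA -exprD e1.
have := gns_sq_ge0 (a ^+ n - a ^+ n.-1 * b).
rewrite gns_sqD gns_sqN mulrN traceN e2 e3 e4.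
have -> : (2 ^ k.+1)%:R = 2 * n%:R :> R by rewrite expnS natrM.
have -> : (2 ^ k.+1).-1%:R = 2 * n%:R - 1 :> R.
  by rewrite -subn1 natrB ?expn_gt0// expnS natrM.
have np : n.-1%:R = n%:R - 1 :> R by rewrite -subn1 natrB.
rewrite np in h.
have : (0 : R) < n%:R by rewrite ltr0n.
nra.
Qed.

(* [euler m w ^+ m] plays the role of [exp w]. *)
Definition euler m w := 1 + sc m%:R^-1 * w.

Lemma st_euler m w : st w = w -> st (euler m w) = euler m w.
Proof. by move=> hw; rewrite /euler (tr_stD T) stM hw star1 (tr_st_sc T) comm_sc. Qed.

Lemma bnd_euler m w K : bnd w K -> bnd (euler m w) (1 + K / m%:R).
Proof.
move=> h; apply: bndD; first exact: bnd1.
rewrite mulrC; apply: bndM => //.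
by have := bnd_sc m%:R^-1; rewrite ger0_norm// invr_ge0.
Qed.

Lemma euler_le_expR (m n : nat) (K : R) : 0 <= K -> (n <= m)%N ->
  (1 + K / m%:R) ^+ n <= expR K.
Proof.
case: m => [|m] K0 nm.
  by move: nm; rewrite leqn0 => /eqP ->; rewrite expr0 (le_trans _ (expR_ge1Dx K))// lerDl.
apply: (@le_trans _ _ (expR (K / m.+1%:R) ^+ n)).
  by rewrite lerXn2r ?nnegrE ?expR_ge0 ?addr_ge0 ?divr_ge0// expR_ge1Dx.
rewrite -expRM_natl ler_expR mulrCA ler_piMr// -[_ / _]mulrC.
by rewrite mulrC ler_pdivrMr ?ltr0n// mul1r ler_nat.
Qed.

(** [(1 + w / m) * (1 + d / m)] exceeds [1 + (w + d) / m] by [w * d / m ^ 2], and the power [m]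
    turns this into an error of order [1 / m]. For the product itself, [trace_pow2] separates the
    factors. *)
Lemma golden_thompson k w d K D : let m := (2 ^ k)%N in
  st w = w -> st d = d -> bnd w K -> bnd d D ->
  t (euler m (w + d) ^+ m) <=
    t (euler m w ^+ m * euler m d ^+ m) + expR (K + D) * (K * D) / m%:R.
Proof.
move=> m sw sd bw bd.
have m0 : (0 : R) < m%:R by rewrite ltr0n expn_gt0.
have [K0 D0] : 0 <= K /\ 0 <= D by case: bw bd => ? _ [].
have [_ /(_ _ _ (st_euler m sw) (st_euler m sd))] := trace_pow2 k.
rewrite -/m => le2; apply: le_trans (lerD le2 (lexx _)).
set X := euler m (w + d); set Y := euler m w * euler m d.
have XY : X - Y = - (sc m%:R^-1 ^+ 2 * (w * d)).
  rewrite /X /Y /euler; set q := sc _.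
  have -> : q ^+ 2 * (w * d) = q * w * (q * d).
    by rewrite expr2 -!mulrA [q * (w * d)](tr_sc T) [q * d](tr_sc T) -!mulrA.
  by rewrite mulrDr [(1 + _) * _]mulrDr mulr1 mulrDl mul1r !addrA opprD addrA subrr sub0r.
have bX : bnd X ((1 + K / m%:R) * (1 + D / m%:R)).
  apply: bndW (bnd_euler _ (bndD bw bd)) _.
  rewrite -subr_ge0 [leRHS](_ : _ = K / m%:R * (D / m%:R)); last by ring.
  by rewrite mulr_ge0 ?divr_ge0.
have bY : bnd Y ((1 + K / m%:R) * (1 + D / m%:R)) by apply: bndM; exact: bnd_euler.
have bXY : bnd (X - Y) (m%:R^-1 ^+ 2 * (K * D)).
  rewrite XY; apply/bndN/bndM/bndM => //; apply: bndX.
  by have := bnd_sc m%:R^-1; rewrite ger0_norm// invr_ge0.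
have [p mp] : exists p, m = p.+1 by exists m.-1; rewrite prednK// expn_gt0.
have := bnd_t (bnd_subX p bX bY bXY); rewrite -mp traceB => /(le_trans (ler_norm _)).
rewrite lerBlDl => /le_trans; apply; rewrite lerD2l.
have -> : m%:R * ((1 + K / m%:R) * (1 + D / m%:R)) ^+ p * (m%:R^-1 ^+ 2 * (K * D))
   = ((1 + K / m%:R) * (1 + D / m%:R)) ^+ p * (K * D) / m%:R.
  by field; rewrite gt_eqF.
rewrite ler_wpM2r ?invr_ge0// ler_wpM2r ?mulr_ge0// exprMn expRD.
by apply: ler_pM; rewrite ?exprn_ge0 ?addr_ge0 ?divr_ge0// euler_le_expR// mp.
Qed.

(** The left side is at most [1 / (j + 1)!]; the weaker power of 2 makes the exponential tail a
    geometric series. *)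
Lemma binomial_le_pow2 (m j : nat) : (0 < m)%N ->
  'C(m, j.+1)%:R * m%:R^-1 ^+ j.+1 <= (2^-1 : R) ^+ j.
Proof.
move=> m0.
have m0' : (0 : R) < m%:R ^+ j.+1 by rewrite exprn_gt0// ltr0n.
rewrite !exprVn ler_pdivrMr// mulrC ler_pdivlMr ?exprn_gt0//.
rewrite -!natrX -natrM ler_nat.
apply: (@leq_trans ('C(m, j.+1) * j.+1`!)).
  rewrite leq_mul2l; apply/orP; right.
  elim: j {m0'} => [//|j IH]; rewrite expnS factS leq_mul//.
rewrite bin_ffact; elim: j.+1 {m0'} => [|i IH]; first by rewrite ffactn0.
by rewrite ffactnSr expnSr leq_mul// leq_subr.
Qed.

(** As a quadratic form [d ^+ i.+2] is at most [D ^+ i * d ^+ 2], being [d ^+ i] between two factors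
    [d]. With the coefficients [2^-1 ^+ i.+1] the tail sums to at most [2^-1 / (1 - D / 2)], which
    is [(2 - D)^-1]. *)
Lemma euler_taylor m d D : (0 < m)%N -> st d = d -> bnd d D -> D <= 1 ->
  posop (1 + d + sc (2 - D)^-1 * d ^+ 2 - euler m d ^+ m).
Proof.
move=> m0 sd bd D1 Y; have D0 : 0 <= D by case: bd.
pose f i := t (st Y * d ^+ i * Y).
have fZ r X : t (st Y * (sc r * X) * Y) = r * t (st Y * X * Y).
  by rewrite [st Y * _]mulrA -(comm_sc r) -!mulrA traceZ.
have f_le i : f i.+2 <= D ^+ i * f 2.
  have -> : f 2 = gns_sq (d * Y) by rewrite /f /gns_sq stM sd expr2 !mulrA.
  have -> : f i.+2 = t (st (d * Y) * d ^+ i * (d * Y)).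
    by rewrite /f stM sd exprS exprSr !mulrA.
  exact: le_trans (ler_norm _) (bnd_form _ (bndX _ bd)).
have f2 : 0 <= f 2 by rewrite /f expr2 mulrA -{1}sd -stM -mulrA; exact: gns_sq_ge0.
have -> : t (st Y * (1 + d + sc (2 - D)^-1 * d ^+ 2 - euler m d ^+ m) * Y) =
    f 0 + f 1 + (2 - D)^-1 * f 2 - \sum_(i < m.+1) 'C(m, i)%:R * m%:R^-1 ^+ i * f i.
  rewrite !mulrDr !mulrDl !tD fZ mulrN mulNr traceN; congr (_ - _).
  rewrite /euler addrC exprD1n mulr_sumr mulr_suml trace_sum.
  apply: eq_bigr => i _; rewrite -mulr_natl -(rmorph_nat sc) exprMn_comm; last exact: comm_sc.
  by rewrite -rmorphXn !fZ mulrA.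
case: m m0 => // m _.
rewrite !big_ord_recl/= bin0 bin1 !expr0 !mul1r expr1 mulfV ?pnatr_eq0// mul1r.
suff : \sum_(i < m) 'C(m.+1, i.+2)%:R * m.+1%:R^-1 ^+ i.+2 * f i.+2 <= (2 - D)^-1 * f 2.
  by rewrite subr_ge0 addrA lerD2l.
apply: (@le_trans _ _ (\sum_(i < m) (2^-1 * f 2) * (D / 2) ^+ i)).
  apply: ler_sum => i _.
  apply: (@le_trans _ _ ('C(m.+1, i.+2)%:R * m.+1%:R^-1 ^+ i.+2 * (D ^+ i * f 2))).
    by rewrite ler_wpM2l// mulr_ge0// exprn_ge0// invr_ge0.
  rewrite exprMn_comm; last exact: mulrC.
  rewrite [leRHS](_ : _ = 2^-1 ^+ i.+1 * (D ^+ i * f 2)); last by rewrite exprS; ring.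
  by rewrite ler_wpM2r ?binomial_le_pow2// mulr_ge0// exprn_ge0.
rewrite -mulr_sumr mulrAC ler_wpM2r//.
have E := subrX1 (D / 2) m.
have D2 : 0 <= (D / 2) ^+ m by rewrite exprn_ge0// divr_ge0.
rewrite -[leRHS]mulr1 ler_pdivlMl; last lra.
nra.
Qed.

(** The gradient inequality for the convex function [w |-> tau (e^w)]: apply [trace_young] to
    [euler m w] and [euler m (w + h)], whose difference is [h / m]. The derivative of an [m]-th
    power explains the exponent [m.-1]. *)
Lemma euler_young k w h : let m := (2 ^ k)%N in st w = w -> st h = h ->
  t (euler m w ^+ m) + t (euler m w ^+ m.-1 * h) <= t (euler m (w + h) ^+ m).
Proof.
move=> m sw sh; have m_gt0 : (0 < m)%N by rewrite expn_gt0.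
have m0 : (0 : R) < m%:R by rewrite ltr0n.
have := @trace_young k _ _ (st_euler m sw) (st_euler m (_ : st (w + h) = w + h)).
rewrite -/m (tr_stD T) sw sh => /(_ erefl).
have -> : euler m (w + h) = euler m w + sc m%:R^-1 * h by rewrite /euler mulrDr addrA.
rewrite mulrDr -exprSr prednK// tD mulrA -comm_sc -mulrA traceZ mulrDr mulVKf ?gt_eqF//.
rewrite -[in m.-1%:R]subn1 natrB// mulrBl mul1r; lra.
Qed.

(** Reconciles the exponent [m.-1] of the convexity inequality with the exponent [m] of the other
    steps, again at a cost of order [1 / m]. *)
Lemma euler_pred m w h K L : (0 < m)%N -> bnd w K -> bnd h L ->
  t (euler m w ^+ m * h) - t (euler m w ^+ m.-1 * h) <= expR K * (K * L) / m%:R.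
Proof.
move=> m_gt0 bw bh; have K0 : 0 <= K by case: bw.
have L0 : 0 <= L by case: bh.
have -> : euler m w ^+ m = euler m w ^+ m.-1 * euler m w by rewrite -exprSr prednK.
rewrite -traceB -mulrBl -[X in _ * _ - X]mulr1 -mulrBr.
rewrite {2}/euler addrAC subrr add0r.
apply: le_trans (ler_norm _) _; apply: (le_trans (bnd_t _)).
  apply: bndM bh; apply: bndM; first exact: (bndX m.-1 (bnd_euler m bw)).
  apply: bndM (bw); first exact: bnd_sc.
rewrite ger0_norm ?invr_ge0//.
rewrite [leLHS](_ : _ = (1 + K / m%:R) ^+ m.-1 * (K * L) / m%:R); last by ring.
rewrite !ler_wpM2r ?invr_ge0 ?mulr_ge0// euler_le_expR// leq_pred//.
Qed.

(** One exchange: [d] in the exponent gives way to the compensator [h] of [d ^+ 2 / (2 - D)].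
    Orthogonality and compensation are required only against powers of [euler m w], because [w] will
    belong to the past of [d]. *)
Lemma euler_step k w d h K D L : let m := (2 ^ k.+1)%N in
  st w = w -> st d = d -> st h = h -> bnd w K -> bnd d D -> D <= 1 -> bnd h L ->
  (forall n, t (euler m w ^+ n * d) = 0) ->
  (forall n, t (euler m w ^+ n * h) = (2 - D)^-1 * t (euler m w ^+ n * d ^+ 2)) ->
  t (euler m (w + d) ^+ m) <=
    t (euler m (w + h) ^+ m) + expR (K + D) * (K * D + K * L) / m%:R.
Proof.
move=> m sw sd sh bw bd D1 bh td th.
have m_gt0 : (0 < m)%N by rewrite expn_gt0.
have m0 : (0 : R) < m%:R by rewrite ltr0n.
have K0 : 0 <= K by case: bw.
have D0 : 0 <= D by case: bd.
have L0 : 0 <= L by case: bh.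
have sX n : st (euler m w ^+ n) = euler m w ^+ n by rewrite starX st_euler.
apply: (le_trans (golden_thompson k.+1 sw sd bw bd)); rewrite -/m.
have le1 : t (euler m w ^+ m * euler m d ^+ m) <=
    t (euler m w ^+ m) + t (euler m w ^+ m * h).
  (* As [m] is even, [euler m w ^+ m] is the square of a self-adjoint element, against which
     positivity can be tested. *)
  have := euler_taylor m_gt0 sd bd D1 (euler m w ^+ (2 ^ k)).
  rewrite sX tC mulrA -exprD addnn -mul2n -expnS -/m.
  rewrite mulrBr traceB !mulrDr mulr1 !tD td addr0 subr_ge0 => /le_trans; apply.
  by rewrite th mulrA -(comm_sc _ (_ ^+ m)) -mulrA traceZ.
have le2 : t (euler m w ^+ m) + t (euler m w ^+ m.-1 * h) <= t (euler m (w + h) ^+ m).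
  exact: euler_young.
have le3 := euler_pred m_gt0 bw bh.
have -> : expR (K + D) * (K * D + K * L) / m%:R =
  expR (K + D) * (K * D) / m%:R + expR (K + D) * (K * L) / m%:R by ring.
have : expR K * (K * L) / m%:R <= expR (K + D) * (K * L) / m%:R.
  by rewrite !ler_wpM2r ?invr_ge0 ?mulr_ge0// ler_expR lerDl.
lra.
Qed.

(** Convexity again: the derivative of [tau (e^w)] in a positive direction is nonnegative, although
    [w |-> e^w] itself is not operator monotone. *)
Lemma euler_monotone k w h K L : let m := (2 ^ k.+1)%N in
  st w = w -> st h = h -> bnd w K -> bnd h L -> posop h ->
  t (euler m w ^+ m) <= t (euler m (w + h) ^+ m) + expR K * (K * L) / m%:R.
Proof.
move=> m sw sh bw bh ph.
have m_gt0 : (0 < m)%N by rewrite expn_gt0.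
have K0 : 0 <= K by case: bw.
have L0 : 0 <= L by case: bh.
have := euler_young k.+1 sw sh; rewrite -/m => le2.
have le3 := euler_pred m_gt0 bw bh.
have := ph (euler m w ^+ (2 ^ k)); rewrite starX st_euler// tC mulrA -exprD addnn -mul2n -expnS -/m.
lra.
Qed.

Hypothesis bounded : forall a, exists K, bnd a K.

(** [P n] stands for membership in the [n]-th algebra; conditional expectations enter only through
    traces against it. [C] may depend on everything except [k], which will go to infinity with [N]
    fixed. *)
Lemma euler_martingale N (P : nat -> A -> Prop) (d h : nat -> A) (D S : R) :
  (forall n r, P n (sc r)) ->
  (forall n a b, P n a -> P n b -> P n (a + b)) ->
  (forall n a b, P n a -> P n b -> P n (a * b)) ->
  (forall n a, P n a -> P n.+1 a) ->
  (forall n, P n.+1 (d n)) -> (forall n, P n (h n)) ->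
  (forall n, st (d n) = d n) -> (forall n, st (h n) = h n) ->
  (forall n a, P n a -> t (a * d n) = 0) ->
  (forall n a, P n a -> t (a * h n) = (2 - D)^-1 * t (a * d n ^+ 2)) ->
  (forall n, (n < N)%N -> bnd (d n) D) -> D <= 1 -> 0 <= S ->
  posop (sc S - \sum_(i < N) h i) ->
  exists C, forall k,
    t (euler (2 ^ k.+1) (\sum_(i < N) d i) ^+ (2 ^ k.+1)) <= expR S + C / (2 ^ k.+1)%:R.
Proof.
move=> Psc PD PM PS Pd Ph sd sh td th bd D1 S0 pS.
(* The compensated exponent: it equals [S] at time 0, and from [n] to [n.+1] it gains [d n] and
   loses [h n]. The common part [z n - h n] belongs to the past. *)
pose z n := sc S + \sum_(i < n) d i - \sum_(i < n) h i.
have Pz n : P n (z n).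
  have Psum n1 (F : nat -> A) : (forall i, (i < n1)%N -> P n1 (F i)) -> P n1 (\sum_(i < n1) F i).
    move=> hF; elim/big_ind : _ => [||i _]; [|exact: PD|exact: hF].
    by rewrite -(rmorph0 sc).
  have Pmono i j a : (i <= j)%N -> P i a -> P j a.
    elim: j => [|j IH]; first by rewrite leqn0 => /eqP ->.
    by rewrite leq_eqVlt => /predU1P[->|/IH h1 /h1/PS].
  apply: (PD); first by apply: (PD) => //; apply: Psum => i ?; exact: Pmono (Pd i).
  rewrite -mulN1r -(rmorphN1 sc); apply: (PM) => //.
  by apply: Psum => i /ltnW ?; exact: Pmono (Ph i).
have sz n : st (z n) = z n.
  rewrite /z starB (tr_stD T) (tr_st_sc T) !star_sum.
  by congr (_ + _ - _); apply: eq_bigr.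
have PX n a m i : P n a -> P n (euler m a ^+ i).
  move=> Pa; elim: i => [|i IH]; first by rewrite expr0 -(rmorph1 sc).
  rewrite exprS; apply: (PM) => //; apply: (PD); first by rewrite -(rmorph1 sc).
  exact: PM.
have step n : (n <= N)%N -> exists C, forall k,
    t (euler (2 ^ k.+1) (z n) ^+ (2 ^ k.+1)) <= expR S + C / (2 ^ k.+1)%:R.
  elim: n => [_|n IH nN].
    exists 0 => k; set m := (2 ^ k.+1)%N; rewrite mul0r addr0 /z !big_ord0 addr0 subr0 /euler.
    rewrite -(rmorph1 sc) -rmorphM -rmorphD -rmorphXn trace_sc mulrC.
    exact: euler_le_expR.
  have [C hC] := IH (ltnW nN).
  have [K bK] := bounded (z n - h n); have [L bL] := bounded (h n).
  exists (C + expR (K + D) * (K * D + K * L)) => k; set m := (2 ^ k.+1)%N.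
  have Pw : P n (z n - h n).
    apply: (PD) => //; rewrite -mulN1r -(rmorphN1 sc); exact: PM.
  have := @euler_step k _ _ _ _ _ _ (_ : st (z n - h n) = z n - h n) (sd n) (sh n)
    bK (bd n nN) D1 bL.
  rewrite -/m subrK starB sz sh => /(_ erefl) H.
  have := H (fun i => td n _ (PX n _ m i Pw)) (fun i => th n _ (PX n _ m i Pw)).
  have -> : z n - h n + d n = z n.+1.
    by rewrite /z !big_ord_recr /= opprD !addrA [LHS]addrAC; congr (_ - _); exact: addrAC.
  by move=> /le_trans; apply; rewrite mulrDl addrA lerD2r; exact: hC.
have [C hC] := step N (leqnn N).
(* The leftover [Q] is positive by [pS] and is dropped by [euler_monotone]. *)
set y := \sum_(i < N) d i; set Q := sc S - \sum_(i < N) h i in pS.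
have zE : z N = y + Q by rewrite /z /Q -/y [sc S + y]addrC addrA.
have sy : st y = y by rewrite /y star_sum; apply: eq_bigr.
have sQ : st Q = Q.
  by rewrite /Q starB (tr_st_sc T) star_sum; congr (_ - _); apply: eq_bigr.
have [K bK] := bounded y; have [L bL] := bounded Q.
exists (C + expR K * (K * L)) => k; set m := (2 ^ k.+1)%N.
apply: le_trans (@euler_monotone k _ _ _ _ sy sQ bK bL pS) _.
by rewrite -/m -zE mulrDl addrA lerD2r; exact: hC.
Qed.

(** Says quantitatively that ['C(m, n) / m ^ n] tends to [1 / n!]; the explicit rate [1 / m] is what
    [ler_inv_pow2] can absorb. *)
Lemma ffact_ge (m n : nat) : (0 < m)%N ->
  1 - n%:R ^+ 2 / m%:R <= (m ^_ n)%:R * m%:R^-1 ^+ n :> R.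
Proof.
move=> m_gt0; have m0 : (0 : R) < m%:R by rewrite ltr0n.
set q := m%:R^-1; have q0 : 0 < q by rewrite invr_gt0.
have f_ge0 i : 0 <= (m ^_ i)%:R * q ^+ i by rewrite mulr_ge0// exprn_ge0// ltW.
have f_le1 i : (m ^_ i)%:R * q ^+ i <= 1.
  rewrite /q exprVn ler_pdivrMr ?exprn_gt0// mul1r -natrX ler_nat.
  elim: i => [|i IH]; first by rewrite ffactn0.
  by rewrite ffactnSr expnSr leq_mul// leq_subr.
elim: n => [|n IH]; first by rewrite ffactn0 expr0 expr0n/= mul0r subr0 mulr1.
rewrite ffactnSr natrM [q ^+ _]exprSr mulrACA.
have le1 : 1 - n%:R * q <= (m - n)%:R * q.
  rewrite -[X in X - _](mulfV (lt0r_neq0 m0)) -/q -mulrBl ler_wpM2r ?(ltW q0)//.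
  case: (leqP n m) => nm; first by rewrite natrB.
  by rewrite (_ : (m - n)%N = 0%N) ?subr_le0 ?ler_nat 1?ltnW//; apply/eqP; rewrite subn_eq0 ltnW.
apply: le_trans (ler_wpM2l (f_ge0 n) le1).
have := f_le1 n; have := f_ge0 n; set f := _ * q ^+ n in IH *.
have n0 : (0 : R) <= n%:R by [].
rewrite -addn1 natrD => g1 g2.
have : n%:R * q * f <= n%:R * q * 1 by rewrite ler_wpM2l// mulr_ge0// ltW.
have : 0 <= n%:R * q by rewrite mulr_ge0// ltW.
move: IH; rewrite -/q; nra.
Qed.

Lemma ler_inv_pow2 (a b C : R) (k0 : nat) :
  (forall k, (k0 <= k)%N -> a <= b + C / (2 ^ k.+1)%:R) -> a <= b.
Proof.
move=> h; rewrite leNgt; apply/negP => ba.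
have e0 : 0 < a - b by rewrite subr_gt0.
pose n := maxn k0 (Num.truncn (`|C| / (a - b))).+1.
have := h n (leq_maxl _ _); apply/negP; rewrite -ltNge -ltrBrDl.
apply: (le_lt_trans (ler_norm _)); rewrite normrM normfV (ger0_norm (ler0n _ _)).
rewrite ltr_pdivrMr ?ltr0n ?expn_gt0// mulrC -ltr_pdivrMr//.
have : (Num.truncn (`|C| / (a - b))).+1%:R <= (2 ^ n.+1)%:R :> R.
  rewrite ler_nat; apply: (leq_trans (leq_maxr k0 _)); apply: ltnW.
  exact: (ltn_trans (ltnSn _) (ltn_expl _ _)).
apply: lt_le_trans; exact: truncnS_gt.
Qed.

Lemma trace_even_ge0 y j : st y = y -> 0 <= t (y ^+ (2 * j)).
Proof.
move=> sy; have := gns_sq_ge0 (y ^+ j).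
by rewrite /gns_sq starX sy -exprD addnn -mul2n.
Qed.

(** Adding the expansions at [y] and [- y] cancels the odd powers and leaves even ones with
    nonnegative traces, so any one of them, counted twice, is at most [2 * E]. *)
Lemma euler_even k (y : A) (j : nat) (E : R) : let m := (2 ^ k.+1)%N in
  st y = y -> t (euler m y ^+ m) <= E -> t (euler m (- y) ^+ m) <= E ->
  'C(m, 2 * j)%:R * m%:R^-1 ^+ (2 * j) * t (y ^+ (2 * j)) <= E.
Proof.
move=> m sy; set q : R := m%:R^-1.
have q0 : 0 <= q by rewrite invr_ge0.
have expand x : t (euler m x ^+ m) = \sum_(i < m.+1) 'C(m, i)%:R * q ^+ i * t (x ^+ i).
  rewrite /euler addrC exprD1n trace_sum; apply: eq_bigr => i _.
  rewrite -mulr_natl -(rmorph_nat sc) exprMn_comm; last exact: comm_sc.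
  by rewrite -rmorphXn !traceZ mulrA.
rewrite !expand => e1 e2.
pose F i := 'C(m, i)%:R * q ^+ i * (t (y ^+ i) + t ((- y) ^+ i)).
have nonneg i : 0 <= F i.
  rewrite /F mulr_ge0 ?mulr_ge0 ?exprn_ge0// exprNn.
  case: (boolP (odd i)) => oi; rewrite -signr_odd ?oi ?(negbTE oi).
    by rewrite expr1 mulN1r traceN subrr.
  rewrite expr0 mul1r addr_ge0//.
    by rewrite -(odd_double_half i) (negbTE oi) add0n -mul2n trace_even_ge0.
  by rewrite -(odd_double_half i) (negbTE oi) add0n -mul2n trace_even_ge0.
have := lerD e1 e2; rewrite -big_split/=.
rewrite (eq_bigr (fun i : 'I_m.+1 => F i)) => [|i _]; last by rewrite /F mulrDr.
case: (leqP (2 * j) m) => jm; last first.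
  rewrite bin_small// !mul0r.
  have : 0 <= \sum_(i < m.+1) F i by exact: sumr_ge0.
  lra.
rewrite (bigD1 (Ordinal (jm : 2 * j < m.+1)%N))//=.
have exprN2 : (- y) ^+ (2 * j) = y ^+ (2 * j) by rewrite !exprM sqrrN.
have : 0 <= \sum_(i < m.+1 | i != Ordinal (jm : 2 * j < m.+1)%N) F i by exact: sumr_ge0.
rewrite /F exprN2 mulrDr; lra.
Qed.

(* [2 - D] instead of the Gaussian [2] absorbs the higher order terms of [exp d]. *)
Lemma martingale_moment N (P : nat -> A -> Prop) (d h : nat -> A) (D S : R) (j : nat) :
  (forall n r, P n (sc r)) ->
  (forall n a b, P n a -> P n b -> P n (a + b)) ->
  (forall n a b, P n a -> P n b -> P n (a * b)) ->
  (forall n a, P n a -> P n.+1 a) ->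
  (forall n, P n.+1 (d n)) -> (forall n, P n (h n)) ->
  (forall n, st (d n) = d n) -> (forall n, st (h n) = h n) ->
  (forall n a, P n a -> t (a * d n) = 0) ->
  (forall n a, P n a -> t (a * h n) = (2 - D)^-1 * t (a * d n ^+ 2)) ->
  (forall n, (n < N)%N -> bnd (d n) D) -> D <= 1 -> 0 <= S ->
  posop (sc S - \sum_(i < N) h i) ->
  t ((\sum_(i < N) d i) ^+ (2 * j)) <= (2 * j)`!%:R * expR S.
Proof.
move=> Psc PD PM PS Pd Ph sd sh td th bd D1 S0 pS.
set y := \sum_(i < N) d i.
have sy : st y = y by rewrite /y star_sum; apply: eq_bigr.
have [C1 h1] := euler_martingale Psc PD PM PS Pd Ph sd sh td th bd D1 S0 pS.
have Pd' n : P n.+1 (- d n).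
  by rewrite -mulN1r -(rmorphN1 sc); exact: PM.
have sd' n : st (- d n) = - d n by rewrite starN sd.
have td' n a : P n a -> t (a * - d n) = 0 by move=> Pa; rewrite mulrN traceN td// oppr0.
have th' n a : P n a -> t (a * h n) = (2 - D)^-1 * t (a * (- d n) ^+ 2).
  by move=> Pa; rewrite sqrrN th.
have bd' n : (n < N)%N -> bnd (- d n) D by move=> nN; apply/bndN/bd.
(* [- d] has the same compensator as [d], which gives the bound at [- y] that [euler_even] asks
   for. *)
have [C2 h2] := euler_martingale Psc PD PM PS Pd' Ph sd' sh td' th' bd' D1 S0 pS.
pose C := Num.max C1 C2; pose n := (2 * j)%N.
have C1C : C1 <= C by rewrite /C le_max lexx.
have C2C : C2 <= C by rewrite /C le_max lexx orbT.
apply: (@ler_inv_pow2 _ _ ((2 * j)`!%:R * C + t (y ^+ n) * n%:R ^+ 2) 0) => k _.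
set m := (2 ^ k.+1)%N; have m_gt0 : (0 < m)%N by rewrite expn_gt0.
have m0 : (0 : R) < m%:R by rewrite ltr0n.
have E : 'C(m, n)%:R * m%:R^-1 ^+ n * t (y ^+ n) <= expR S + C / m%:R.
  apply: euler_even => //.
    by apply: le_trans (h1 k) _; rewrite lerD2l ler_wpM2r// invr_ge0.
  have -> : - y = \sum_(i < N) - d i by rewrite sumrN.
  by apply: le_trans (h2 k) _; rewrite lerD2l ler_wpM2r// invr_ge0.
have yn : 0 <= t (y ^+ n) by exact: trace_even_ge0.
have := ffact_ge n m_gt0; rewrite -bin_ffact natrM => F.
have F1 := ler_wpM2r yn F.
have F2 := ler_wpM2l (ler0n _ n`!) E.
rewrite -/n.
have : (1 - n%:R ^+ 2 / m%:R) * t (y ^+ n) <= n`!%:R * (expR S + C / m%:R).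
  apply: le_trans F1 (le_trans _ F2); rewrite le_eqVlt; apply/orP; left; apply/eqP; ring.
rewrite mulrDl [n`!%:R * _]mulrDr; lra.
Qed.

End TracialRing.

(** * Self-adjoint dilation *)

Section Dilation.
Variables (R : realType) (A : pzRingType).
Variables (sc : {rmorphism R -> A}) (st : A -> A) (t : A -> R).
Hypothesis T : tracial sc st t.

Definition blk (a b c e : A) : 'M[A]_2 :=
  \matrix_(i, j) if i == 0 then if j == 0 then a else b else if j == 0 then c else e.

Lemma blk_ext (X Y : 'M[A]_2) : X 0 0 = Y 0 0 -> X 0 1 = Y 0 1 ->
  X 1 0 = Y 1 0 -> X 1 1 = Y 1 1 -> X = Y.
Proof.
move=> h1 h2 h3 h4; apply/matrixP => i j.
have ord2 (k : 'I_2) : k = 0 \/ k = 1.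
  by case: k => [[|[|//]] hk]; [left|right]; apply/val_inj.
by case: (ord2 i) => [->|->]; case: (ord2 j) => [->|->].
Qed.

Lemma blkP (X : 'M[A]_2) : exists a b c e, X = blk a b c e.
Proof.
by exists (X 0 0), (X 0 1), (X 1 0), (X 1 1); apply: blk_ext; rewrite !mxE.
Qed.

Lemma blkM a b c e a' b' c' e' : blk a b c e * blk a' b' c' e' =
  blk (a * a' + b * c') (a * b' + b * e') (c * a' + e * c') (c * b' + e * e').
Proof.
by rewrite -mulmxE; apply: blk_ext; rewrite !mxE !big_ord_recl big_ord0 addr0 !mxE.
Qed.

Lemma blkD a b c e a' b' c' e' : blk a b c e + blk a' b' c' e' =
  blk (a + a') (b + b') (c + c') (e + e').
Proof. by apply: blk_ext; rewrite !mxE. Qed.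

Definition blk_sc : {rmorphism R -> 'M[A]_2} := (@scalar_mx A 2) \o sc.

Lemma blk_scE r : blk_sc r = blk (sc r) 0 0 (sc r).
Proof. by apply: blk_ext; rewrite !mxE. Qed.

Lemma blk1 : 1 = blk 1 0 0 1.
Proof. by rewrite (_ : 1 = 1%:M)//; apply: blk_ext; rewrite !mxE. Qed.

Definition blk_st (X : 'M[A]_2) := blk (st (X 0 0)) (st (X 1 0)) (st (X 0 1)) (st (X 1 1)).

Lemma blk_stE a b c e : blk_st (blk a b c e) = blk (st a) (st c) (st b) (st e).
Proof. by rewrite /blk_st !mxE. Qed.

Definition blk_t (X : 'M[A]_2) := (t (X 0 0) + t (X 1 1)) / 2.

Lemma blk_tE a b c e : blk_t (blk a b c e) = (t a + t e) / 2.
Proof. by rewrite /blk_t !mxE. Qed.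

Let tD := tr_D T.
Let tC := tr_C T.

Lemma blk_tracial : tracial blk_sc blk_st blk_t.
Proof.
have e0 := star0 T; have := tr_stD T; have := tr_stM T => sM sD.
split=> [r X|X Y|X Y|X|r|X Y|r X|X Y|X|X|].
- have [a [b [c [e ->]]]] := blkP X; rewrite blk_scE !blkM.
  by rewrite !mul0r !mulr0 !addr0 !add0r !(tr_sc T r).
- have [a [b [c [e ->]]]] := blkP X; have [a' [b' [c' [e' ->]]]] := blkP Y.
  by rewrite blkD !blk_stE blkD !sD.
- have [a [b [c [e ->]]]] := blkP X; have [a' [b' [c' [e' ->]]]] := blkP Y.
  by rewrite blkM !blk_stE blkM !sD !sM; congr blk; rewrite addrC.
- by have [a [b [c [e ->]]]] := blkP X; rewrite !blk_stE !(tr_stK T).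
- by rewrite blk_scE blk_stE !(tr_st_sc T) e0.
- have [a [b [c [e ->]]]] := blkP X; have [a' [b' [c' [e' ->]]]] := blkP Y.
  by rewrite blkD !blk_tE !tD; ring.
- have [a [b [c [e ->]]]] := blkP X; rewrite blk_scE blkM !blk_tE !mul0r addr0 add0r.
  by rewrite !(tr_Z T); ring.
- have [a [b [c [e ->]]]] := blkP X; have [a' [b' [c' [e' ->]]]] := blkP Y.
  by rewrite !blkM !blk_tE !tD (tC a) (tC b) (tC c) (tC e); ring.
- by have [a [b [c [e ->]]]] := blkP X; rewrite blk_stE !blk_tE !(tr_st T).
- have [a [b [c [e ->]]]] := blkP X; rewrite blk_stE blkM blk_tE !tD.
  by rewrite divr_ge0// !addr_ge0// (tr_ge0 T).
- by rewrite blk1 blk_tE (tr_1 T); lra.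
Qed.

Let TB := blk_tracial.

Lemma blk_bnd_diag p q K : bnd st t p K -> bnd st t q K ->
  bnd blk_st blk_t (blk p 0 0 q) K.
Proof.
move=> [K0 hp] [_ hq]; split=> // X; have [a [b [c [e ->]]]] := blkP X.
have hp' Y : gns_sq st t (p * Y) <= K ^+ 2 * gns_sq st t Y.
  by rewrite -!(gns_normE T) -exprMn lerXn2r ?nnegrE ?mulr_ge0 ?(gns_norm_ge0)// hp.
have hq' Y : gns_sq st t (q * Y) <= K ^+ 2 * gns_sq st t Y.
  by rewrite -!(gns_normE T) -exprMn lerXn2r ?nnegrE ?mulr_ge0 ?(gns_norm_ge0)// hq.
rewrite -(@ler_pXn2r _ 2) ?nnegrE ?mulr_ge0 ?(gns_norm_ge0)// exprMn !(gns_normE TB).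
rewrite blkM !mul0r !addr0 !add0r /gns_sq !blk_stE !blkM !blk_tE !tD.
have := hp' a; have := hp' b; have := hq' c; have := hq' e.
rewrite /gns_sq => h1 h2 h3 h4; set k := K ^+ 2 in h1 h2 h3 h4 *.
lra.
Qed.

Lemma blk_bnd_anti p q K : bnd st t p K -> bnd st t q K ->
  bnd blk_st blk_t (blk 0 p q 0) K.
Proof.
move=> hp hq; have -> : blk 0 p q 0 = blk p 0 0 q * blk 0 1 1 0.
  by rewrite blkM !mul0r !mulr0 !mulr1 !addr0 !add0r.
rewrite -[K]mulr1; apply: bndM; first exact: blk_bnd_diag.
split=> // X; have [a [b [c [e ->]]]] := blkP X.
rewrite mul1r blkM !mul0r !mul1r !addr0 !add0r /gns_norm.
suff -> : gns_sq blk_st blk_t (blk c e a b) = gns_sq blk_st blk_t (blk a b c e) by [].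
by rewrite /gns_sq !blk_stE !blkM !blk_tE !tD; ring.
Qed.

Lemma blk_bounded : (forall a, exists K, bnd st t a K) ->
  forall X, exists K, bnd blk_st blk_t X K.
Proof.
move=> bd X; have [a [b [c [e ->]]]] := blkP X.
have [[K1 h1] [K2 h2] [K3 h3] [K4 h4]] := And4 (bd a) (bd b) (bd c) (bd e).
exists (Num.max K1 K4 + Num.max K2 K3).
have -> : blk a b c e = blk a 0 0 e + blk 0 b c 0 by rewrite blkD !addr0 !add0r.
by apply: (bndD TB); [apply: blk_bnd_diag|apply: blk_bnd_anti];
  [apply: (bndW h1)|apply: (bndW h4)|apply: (bndW h2)|apply: (bndW h3)];
  rewrite le_max lexx ?orbT.
Qed.

Lemma blk_posop p q : posop st t p -> posop st t q -> posop blk_st blk_t (blk p 0 0 q).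
Proof.
move=> hp hq X; have [a [b [c [e ->]]]] := blkP X.
rewrite blk_stE !blkM !mulr0 !addr0 !add0r blk_tE !tD.
by rewrite divr_ge0// !addr_ge0.
Qed.

Definition dil x := blk 0 x (st x) 0.

Lemma dilM x y : dil x * dil y = blk (x * st y) 0 0 (st x * y).
Proof. by rewrite blkM !mul0r !mulr0 !addr0 !add0r. Qed.

Lemma dilX x j : dil x ^+ (2 * j) = blk ((x * st x) ^+ j) 0 0 ((st x * x) ^+ j).
Proof.
rewrite exprM expr2 dilM; elim: j => [|j IH]; first by rewrite !expr0 blk1.
by rewrite !exprS IH blkM !mul0r !mulr0 !addr0 !add0r.
Qed.

(** The two diagonal blocks are powers of [x * st x] and [st x * x], which have equal traces by
    cyclicity. *)
Lemma dil_trace x j : blk_t (dil x ^+ (2 * j)) = t ((st x * x) ^+ j).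
Proof.
rewrite dilX blk_tE.
have -> : t ((x * st x) ^+ j) = t ((st x * x) ^+ j).
  case: j => [|j]; first by rewrite !expr0.
  suff -> : (x * st x) ^+ j.+1 = x * (st x * x) ^+ j * st x.
    by rewrite tC mulrA exprS.
  elim: j => [|j IH]; first by rewrite expr1 expr0 mulr1.
  by rewrite exprSr IH exprSr !mulrA.
lra.
Qed.

Lemma dil_sum n (d : nat -> A) : dil (\sum_(i < n) d i) = \sum_(i < n) dil (d i).
Proof.
elim: n => [|n IH].
  by rewrite !big_ord0 /dil (star0 T); apply: blk_ext; rewrite !mxE.
by rewrite !big_ord_recr/= -IH /dil blkD !addr0 (tr_stD T).
Qed.

Lemma blk_diag_sum n (p q : nat -> A) :
  \sum_(i < n) blk (p i) 0 0 (q i) = blk (\sum_(i < n) p i) 0 0 (\sum_(i < n) q i).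
Proof.
elim: n => [|n IH].
  by rewrite !big_ord0; apply: blk_ext; rewrite !mxE.
by rewrite !big_ord_recr/= IH blkD !addr0.
Qed.

Hypothesis bounded : forall a, exists K, bnd st t a K.

(** [dil d ^+ 2] is diagonal with blocks [d * st d] and [st d * d], hence two compensators that one
    [S] has to dominate. This is where the maximum of two norms in [s2] comes from. *)
Lemma martingale_abs_moment N (P : nat -> A -> Prop) (d hl hr : nat -> A) (D S : R) (j : nat) :
  (forall n r, P n (sc r)) ->
  (forall n a b, P n a -> P n b -> P n (a + b)) ->
  (forall n a b, P n a -> P n b -> P n (a * b)) ->
  (forall n a, P n a -> P n (st a)) ->
  (forall n a, P n a -> P n.+1 a) ->
  (forall n, P n.+1 (d n)) -> (forall n, P n (hl n)) -> (forall n, P n (hr n)) ->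
  (forall n, st (hl n) = hl n) -> (forall n, st (hr n) = hr n) ->
  (forall n a, P n a -> t (a * d n) = 0) ->
  (forall n a, P n a -> t (a * hl n) = (2 - D)^-1 * t (a * (d n * st (d n)))) ->
  (forall n a, P n a -> t (a * hr n) = (2 - D)^-1 * t (a * (st (d n) * d n))) ->
  (forall n, (n < N)%N -> bnd st t (d n) D) ->
  (forall n, (n < N)%N -> bnd st t (st (d n)) D) ->
  D <= 1 -> 0 <= S ->
  posop st t (sc S - \sum_(i < N) hl i) -> posop st t (sc S - \sum_(i < N) hr i) ->
  t ((st (\sum_(i < N) d i) * \sum_(i < N) d i) ^+ j) <= (2 * j)`!%:R * expR S.
Proof.
move=> Psc PD PM Pst PS Pd Pl Pr sl sr td tl tr bd bd' D1 S0 pl pr.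
rewrite -dil_trace dil_sum.
pose PB n (X : 'M[A]_2) := [/\ P n (X 0 0), P n (X 0 1), P n (X 1 0) & P n (X 1 1)].
have PBE n a b c e : PB n (blk a b c e) <-> [/\ P n a, P n b, P n c & P n e].
  by rewrite /PB !mxE.
have P0 n : P n 0 by rewrite -(rmorph0 sc).
pose h n := blk (hl n) 0 0 (hr n).
apply: (@martingale_moment _ _ _ _ _ TB (blk_bounded bounded) N PB (fun n => dil (d n))
  h D S j) => //.
- by move=> n r; rewrite blk_scE; apply/PBE.
- move=> n X Y; have [a [b [c [e ->]]]] := blkP X; have [a' [b' [c' [e' ->]]]] := blkP Y.
  move=> /PBE[p1 p2 p3 p4] /PBE[q1 q2 q3 q4]; rewrite blkD.
  by apply/PBE; split; exact: PD.
- move=> n X Y; have [a [b [c [e ->]]]] := blkP X; have [a' [b' [c' [e' ->]]]] := blkP Y.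
  move=> /PBE[p1 p2 p3 p4] /PBE[q1 q2 q3 q4]; rewrite blkM.
  by apply/PBE; split; apply: (PD); exact: PM.
- by move=> n X [? ? ? ?]; split; exact: PS.
- by move=> n; apply/PBE; split=> //; exact: Pst.
- by move=> n; apply/PBE; split.
- by move=> n; rewrite blk_stE (star0 T) (tr_stK T).
- by move=> n; rewrite blk_stE (star0 T) sl sr.
- move=> n X; have [a [b [c [e ->]]]] := blkP X; move=> /PBE[p1 p2 p3 p4].
  rewrite blkM blk_tE !mulr0 add0r addr0 td//.
  by rewrite -(tr_st T) (tr_stM T) (tr_stK T) tC td ?addr0 ?mul0r//; exact: Pst.
- move=> n X; have [a [b [c [e ->]]]] := blkP X; move=> /PBE[p1 p2 p3 p4].
  rewrite expr2 dilM !blkM !blk_tE !mulr0 !add0r !addr0 tl// tr//; ring.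
- by move=> n nN; apply: blk_bnd_anti; [exact: bd|exact: bd'].
- rewrite blk_scE blk_diag_sum.
  have -> a b : blk (sc S) 0 0 (sc S) - blk a 0 0 b = blk (sc S - a) 0 0 (sc S - b).
    by apply: blk_ext; rewrite !mxE ?subr0.
  exact: blk_posop.
Qed.

End Dilation.

(** * Operators on a Hilbert space *)

Section Hilbert.
Context (R : realType) (H : completeNormedModType R[i]).
Variable ip : {dot H for @Num.conj R[i]}.
Hypothesis hilb : hilbert_norm ip.
Implicit Types (u v w : H) (a b c : H -> H) (r : R).

Lemma Re_conj (z : R[i]) : complex.Re (Num.conj z) = complex.Re z.
Proof. by case: z. Qed.

Lemma ReD (y z : R[i]) : complex.Re (y + z) = complex.Re y + complex.Re z.
Proof. by case: y; case: z. Qed.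

Lemma ReN (z : R[i]) : complex.Re (- z) = - complex.Re z.
Proof. by case: z. Qed.

Lemma ReZ (r : R) (z : R[i]) : complex.Re (r%:C * z) = r * complex.Re z.
Proof. by case: z => x y /=; rewrite mul0r subr0. Qed.

(** The real inner product keeps the inequalities inside an ordered field; [ip_rip] recovers [ip]
    from it. *)
Definition rip u v : R := complex.Re (ip u v).
Definition rnorm v : R := complex.Re `|v|.

Lemma rnormE v : `|v| = (rnorm v)%:C.
Proof. by rewrite /rnorm RRe_real// normr_real. Qed.

Lemma rnorm_ge0 v : 0 <= rnorm v.
Proof. by rewrite -ler0c -rnormE. Qed.

Lemma rnorm_sq v : rnorm v ^+ 2 = rip v v.
Proof. by rewrite /rip -hilb rnormE -rmorphXn. Qed.

Lemma ipC u v : ip u v = Num.conj (ip v u).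
Proof. by rewrite (hermC ip) expr0 mul1r. Qed.

Lemma ripC u v : rip u v = rip v u.
Proof. by rewrite /rip ipC Re_conj. Qed.

Lemma ripDl u v w : rip (u + v) w = rip u w + rip v w.
Proof. by rewrite /rip linearDl ReD. Qed.

Lemma ripDr u v w : rip w (u + v) = rip w u + rip w v.
Proof. by rewrite /rip linearDr ReD. Qed.

Lemma rip0l v : rip 0 v = 0.
Proof. by rewrite /rip linear0l. Qed.

Lemma rip0r v : rip v 0 = 0.
Proof. by rewrite /rip linear0r. Qed.

Lemma ripNl u v : rip (- u) v = - rip u v.
Proof. by rewrite /rip linearNl ReN. Qed.

Lemma ripNr u v : rip u (- v) = - rip u v.
Proof. by rewrite /rip linearNr ReN. Qed.

Lemma ripZl r u v : rip (r%:C *: u) v = r * rip u v.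
Proof. by rewrite /rip linearZl_LR ReZ. Qed.

Lemma ripZr r u v : rip u (r%:C *: v) = r * rip u v.
Proof. by rewrite ripC ripZl ripC. Qed.

Lemma rip_ge0 v : 0 <= rip v v.
Proof. by rewrite -rnorm_sq sqr_ge0. Qed.

Lemma rip_eq0 v : rip v v = 0 -> v = 0.
Proof.
rewrite -rnorm_sq => /eqP; rewrite sqrf_eq0 => /eqP h.
by apply/eqP; rewrite -normr_eq0 rnormE h.
Qed.

Lemma rip_le u v : `|rip u v| <= rnorm u * rnorm v.
Proof.
rewrite -(@ler_pXn2r _ 2) ?nnegrE ?mulr_ge0 ?rnorm_ge0//.
rewrite exprMn !rnorm_sq real_normK ?num_real//.
apply: discriminant_le => [|r]; first exact: rip_ge0.
have := rip_ge0 (r%:C *: u + v).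
rewrite ripDl !ripDr !ripZl !ripZr [rip v u]ripC; nra.
Qed.

Lemma rnormD u v : rnorm (u + v) <= rnorm u + rnorm v.
Proof. by rewrite -lecR rmorphD/= -!rnormE ler_normD. Qed.

Lemma rnormN v : rnorm (- v) = rnorm v.
Proof. by rewrite /rnorm normrN. Qed.

Lemma rnormZ r v : rnorm (r%:C *: v) = `|r| * rnorm v.
Proof.
apply: complexI; rewrite -rnormE normrZ rnormE rmorphM/=; congr (_ * _).
by rewrite normc_def/= expr0n addr0 sqrtr_sqr.
Qed.

Lemma rnorm0 : rnorm 0 = 0.
Proof. by rewrite /rnorm normr0. Qed.

Lemma rnorm_eq0 v : rnorm v = 0 -> v = 0.
Proof. by move=> h; apply/eqP; rewrite -normr_eq0 rnormE h. Qed.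

Lemma rnorm_le u v : (rnorm u <= rnorm v) = (rip u u <= rip v v).
Proof. by rewrite -!rnorm_sq ler_pXn2r ?nnegrE ?rnorm_ge0. Qed.

Lemma rnorm_leM r u v : 0 <= r -> (rnorm u <= r * rnorm v) = (rip u u <= r ^+ 2 * rip v v).
Proof. by move=> r0; rewrite -!rnorm_sq -exprMn ler_pXn2r ?nnegrE ?mulr_ge0 ?rnorm_ge0. Qed.

(* [ip] sees the imaginary part through multiplication by [i]. *)
Lemma ip_rip u v : ip u v = (rip u v) +i* (rip u ('i%C *: v)).
Proof.
rewrite /rip linearZr_LR/=; case: (ip u v) => x y /=.
by apply/eqP; rewrite eq_complex/=; apply/andP; split; apply/eqP; ring.
Qed.

Lemma rip_inj u v : (forall w, rip u w = rip v w) -> u = v.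
Proof.
move=> h; apply/eqP; rewrite -subr_eq0; apply/eqP/rip_eq0.
by rewrite ripDl ripNl h subrr.
Qed.

Lemma lin0 a : linear a -> a 0 = 0.
Proof. by move=> la; have := la (-1) 0 0; rewrite scaler0 addr0 scaleN1r addNr. Qed.

Lemma linD a u v : linear a -> a (u + v) = a u + a v.
Proof. by move=> la; have := la 1 u v; rewrite !scale1r. Qed.

Lemma linZ a z v : linear a -> a (z *: v) = z *: a v.
Proof. by move=> la; have := la z v 0; rewrite (lin0 la) !addr0. Qed.

Lemma linN a v : linear a -> a (- v) = - a v.
Proof. by move=> la; rewrite -scaleN1r linZ// scaleN1r. Qed.

Lemma linB a u v : linear a -> a (u - v) = a u - a v.
Proof. by move=> la; rewrite linD// linN. Qed.

Lemma is_adjointP a b : linear b ->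
  (forall u v, rip (a u) v = rip u (b v)) -> is_adjoint ip a b.
Proof.
move=> lb h u v; rewrite !ip_rip !h.
have := lb 'i%C v 0; rewrite !addr0.
rewrite (lin0 lb).
by rewrite addr0 => ->.
Qed.

Lemma adjoint_rip a b u v : is_adjoint ip a b -> rip (a u) v = rip u (b v).
Proof. by move=> h; rewrite /rip h. Qed.

Lemma adjointC a b : is_adjoint ip a b -> is_adjoint ip b a.
Proof. by move=> h u v; rewrite ipC -h [RHS]ipC. Qed.

Lemma adjoint_uniq a b c : is_adjoint ip a b -> is_adjoint ip a c -> b = c.
Proof.
move=> hb hc; apply/funext => v; apply: rip_inj => w.
by rewrite ripC -(adjoint_rip _ _ hb) (adjoint_rip _ _ hc) ripC.
Qed.

Lemma adjE a b : is_adjoint ip a b -> adj ip a = b.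
Proof.
move=> h; rewrite /adj; case: xgetP => [c _ hc|/(_ b)//].
exact: adjoint_uniq hc h.
Qed.

Lemma pos_opP a : is_adjoint ip a a ->
  pos_op ip a <-> forall v, 0 <= rip (a v) v.
Proof.
move=> sa; split=> [h v|h v]; first by have := h v; rewrite lecE => /andP[_].
rewrite lecE/=; apply/andP; split; last exact: h.
have : ip (a v) v = Num.conj (ip (a v) v) by rewrite {1}sa ipC.
case: (ip (a v) v) => x y [] /esym/eqP.
by rewrite -subr_eq0 -opprD oppr_eq0 -mulr2n mulrn_eq0.
Qed.

Definition op_bounded_by a (K : R) := 0 <= K /\ forall v, rnorm (a v) <= K * rnorm v.

Lemma bounded_opP a : bounded_op a <-> linear a /\ exists K, op_bounded_by a K.
Proof.
split=> [[la ca]|[la [K [K0 hK]]]]; split=> //.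
  pose f := GRing.isLinear.Build _ _ _ _ a la.
  pose F : {linear H -> H} := HB.pack a f.
  have /linear_boundedP : bounded_near F (nbhs 0) by apply: continuous_linear_bounded; exact: ca.
  move=> [M [Mr hM]].
  have [M' M'0 MM'] : exists2 M' : R, 0 <= M' & (M < M'%:C)%R.
    move: Mr hM => /complex_realP[m ->] _; exists (Num.max 0 (m + 1)).
      by rewrite le_max lexx.
    by rewrite ltcR lt_max ltrDl ltr01 orbT.
  exists M'; split=> // v; have := hM _ MM' v.
  by rewrite !rnormE -rmorphM/= lecR.
pose f := GRing.isLinear.Build _ _ _ _ a la.
pose F : {linear H -> H} := HB.pack a f.
apply: (@bounded_linear_continuous _ _ _ F).
apply/linear_boundedP; exists K%:C; split; first by apply/complex_realP; exists K.
move=> M KM v; rewrite !rnormE.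
apply: (@le_trans _ _ (K%:C * (rnorm v)%:C)); first by rewrite -rmorphM/= lecR hK.
by rewrite ler_wpM2r ?ler0c ?rnorm_ge0// ltW.
Qed.

Lemma op_bounded_byM a b K L : op_bounded_by a K -> op_bounded_by b L -> op_bounded_by (a \o b) (K * L).
Proof.
move=> [K0 hK] [L0 hL]; split; first exact: mulr_ge0.
by move=> v /=; apply: (le_trans (hK _)); rewrite -mulrA ler_wpM2l.
Qed.

Lemma opnorm_le a K : 0 <= K -> (forall v, rnorm (a v) <= K * rnorm v) -> opnorm a <= K.
Proof.
move=> K0 h; apply: ge_sup.
  by exists (rnorm (a 0)), 0 => //=; rewrite normr0 ler01.
move=> _ [v /= v1 <-]; apply: (le_trans (h v)).
by rewrite ler_piMr// -lecR -rnormE.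
Qed.

Lemma opnorm_bnd a : bounded_op a -> op_bounded_by a (opnorm a).
Proof.
move=> /bounded_opP [la [K [K0 hK]]].
have ub : has_ubound [set complex.Re `|a v| | v in [set v : H | `|v| <= 1]].
  exists K => _ [v /= v1 <-]; apply: (le_trans (hK v)).
  by rewrite ler_piMr// -lecR -rnormE.
have a0 := lin0 la.
have op0 : 0 <= opnorm a.
  by apply: (ub_le_sup ub); exists 0; rewrite /= ?normr0 ?a0 ?normr0.
split=> // v; case: (eqVneq (rnorm v) 0) => [/rnorm_eq0 ->|v0].
  by rewrite a0 rnorm0 mulr0.
have v0' : 0 < rnorm v by rewrite lt_def v0 rnorm_ge0.
rewrite -ler_pdivrMr// mulrC -[(rnorm v)^-1]gtr0_norm ?invr_gt0// -rnormZ.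
have -> : (rnorm v)^-1%:C *: a v = a ((rnorm v)^-1%:C *: v).
  by have := la (rnorm v)^-1%:C v 0; rewrite a0 !addr0.
apply: (ub_le_sup ub); exists ((rnorm v)^-1%:C *: v) => //=.
rewrite rnormE rnormZ gtr0_norm ?invr_gt0// mulVf// .
Qed.

End Hilbert.

(** * The tracial ring of a von Neumann algebra *)

Section VonNeumann.
Context (R : realType) (H : completeNormedModType R[i]).
Variable ip : {dot H for @Num.conj R[i]}.
Hypothesis hilb : hilbert_norm ip.
Implicit Types (u v w : H) (a b c : H -> H) (r : R) (S : set (H -> H)).

Lemma bounded_id : bounded_op (idfun : H -> H).
Proof.
apply/bounded_opP; split=> //; exists 1.
by split=> // v; rewrite mul1r.
Qed.

Lemma bounded_comp a b : bounded_op a -> bounded_op b -> bounded_op (a \o b).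
Proof.
move=> /bounded_opP[la [K hK]] /bounded_opP[lb [L hL]]; apply/bounded_opP.
split; first by move=> k u v /=; rewrite lb la.
by exists (K * L); exact: op_bounded_byM.
Qed.

Lemma bounded_lin (z : R[i]) a b :
  bounded_op a -> bounded_op b -> bounded_op (z *: a + b).
Proof.
move=> /bounded_opP[la [K [K0 hK]]] /bounded_opP[lb [L [L0 hL]]]; apply/bounded_opP.
split.
  move=> k u v; rewrite !fctE la lb !scalerDr !scalerA.
  by rewrite [z * k]mulrC addrACA.
have [m m0 mE] : exists2 m : R, 0 <= m & `|z| = m%:C.
  exists (complex.Re `|z|); last by rewrite RRe_real// normr_real.
  by rewrite -ler0c RRe_real ?normr_real.
exists (m * K + L); split; first by rewrite addr_ge0// mulr_ge0.
move=> v; rewrite mulrDl; apply: (le_trans (rnormD _ _)); apply: lerD => //.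
rewrite -lecR -rnormE normrZ mE rnormE -rmorphM/= lecR -mulrA.
by rewrite ler_wpM2l.
Qed.

Definition lin_closed (S : set (H -> H)) :=
  forall (z : R[i]) a b, S a -> S b -> S (z *: a + b).

Lemma commutant_id S : commutant S idfun.
Proof. by split; [exact: bounded_id|move=> a _; apply/funext]. Qed.

Lemma commutant_comp S a b : commutant S a -> commutant S b -> commutant S (a \o b).
Proof.
move=> [ba ha] [bb hb]; split; first exact: bounded_comp.
move=> c Sc; apply/funext => v /=.
have := congr1 (fun f => f (b v)) (ha _ Sc) => /= ->; congr (a _).
exact: (congr1 (fun f => f v) (hb _ Sc)).
Qed.

Lemma commutant_lin S : S `<=` bounded_op -> lin_closed (commutant S).
Proof.
move=> Sb z a b [ba ha] [bb hb]; split; first exact: bounded_lin.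
move=> c Sc; have [lc _] := Sb _ Sc; apply/funext => v.
rewrite /= !fctE lc; congr (_ *: _ + _).
  exact: (congr1 (fun f => f v) (ha _ Sc)).
exact: (congr1 (fun f => f v) (hb _ Sc)).
Qed.

Section OneAlgebra.
Variable M : set (H -> H).
Hypothesis hM : von_neumann_algebra ip M.

Lemma vna_bounded a : M a -> bounded_op a.
Proof. by case: hM => h _ _; exact: h. Qed.

Lemma vnaE : M = commutant (commutant M).
Proof. by case: hM => _ _ ->. Qed.

Lemma vna_id : M idfun.
Proof. by rewrite vnaE; exact: commutant_id. Qed.

Lemma vna_comp a b : M a -> M b -> M (a \o b).
Proof. by rewrite {1 2 3}vnaE; exact: commutant_comp. Qed.

Lemma vna_lin : lin_closed M.
Proof. by rewrite vnaE; apply: commutant_lin => a []. Qed.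

Lemma vna0 : M 0.
Proof.
have := vna_lin (-1) vna_id vna_id.
by rewrite scaleN1r addNr.
Qed.

Lemma vnaD a b : M a -> M b -> M (a + b).
Proof. by move=> Ma Mb; rewrite -[a]scale1r; exact: vna_lin. Qed.

Lemma vnaZ z a : M a -> M (z *: a).
Proof. by move=> Ma; rewrite -[_ *: _]addr0; apply: vna_lin => //; exact: vna0. Qed.

Lemma vnaN a : M a -> M (- a).
Proof. by move=> Ma; rewrite -scaleN1r; exact: vnaZ. Qed.

Lemma vnaB a b : M a -> M b -> M (a - b).
Proof. by move=> Ma Mb; apply: vnaD => //; exact: vnaN. Qed.

Lemma vna_sum I (s : seq I) (P : pred I) F :
  (forall i, P i -> M (F i)) -> M (\sum_(i <- s | P i) F i).
Proof. by move=> h; elim/big_ind : _ => //; [exact: vna0|exact: vnaD]. Qed.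

Lemma vna_iter a n : M a -> M (iter n a).
Proof.
move=> Ma; elim: n => [|n IH]; first exact: vna_id.
exact: (vna_comp Ma IH).
Qed.

Lemma vna_linear a : M a -> linear a.
Proof. by move=> /vna_bounded[]. Qed.

Lemma vna_adjP a : M a -> M (adj ip a) /\ is_adjoint ip a (adj ip a).
Proof. by case: hM => _ h _ /h[b Mb hb]; rewrite (adjE hilb hb). Qed.

(** Operators of the commutant are continuous, so they commute with a strong limit, and the double
    commutant gives membership. This keeps spectral projections and limits of projections in the
    algebra. *)
Lemma vna_slim (a : nat -> H -> H) b : (forall n, M (a n)) -> bounded_op b ->
  (forall v, a n v @[n --> \oo] --> b v) -> M b.
Proof.
move=> Ma bb ab; rewrite vnaE; split=> // c [bc hc].
apply/funext => v /=.
have h1 : c (a n v) @[n --> \oo] --> c (b v).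
  have [_ cc] := bc; exact: (continuous_cvg _ (cc _) (ab v)).
have h2 : c (a n v) @[n --> \oo] --> b (c v).
  have -> : (fun n => c (a n v)) = fun n => a n (c v).
    by apply/funext => n; exact: (esym (congr1 (fun f => f v) (hc _ (Ma n)))).
  exact: ab.
exact: (cvg_unique _ h1 h2).
Qed.

(** Indexed by the proof that [M] is an algebra, so that the ring structure can be attached to the
    type. *)
Definition vna_ring (_ : von_neumann_algebra ip M) := {a : H -> H | a \in M}.

Lemma vna_ringP (x : vna_ring hM) : M (sval x).
Proof. by case: x => a /= /set_mem. Qed.

Definition vna_elt a (Ma : M a) : vna_ring hM := exist _ a (mem_set Ma).

Lemma vr_ext (x y : vna_ring hM) : (forall v, sval x v = sval y v) -> x = y.
Proof. by move=> h; apply/val_inj/funext. Qed.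

End OneAlgebra.
End VonNeumann.

Section Ring.
Context (R : realType) (H : completeNormedModType R[i]).
Variable ip : {dot H for @Num.conj R[i]}.
Variable M : set (H -> H).
Variable hM : von_neumann_algebra ip M.
Let B := vna_ring hM.
Implicit Types x y z : B.

Let vP x : M (sval x) := @vna_ringP _ _ _ _ hM x.

HB.instance Definition _ := Choice.on B.

Definition vr_add x y : B := vna_elt hM (vnaD hM (vP x) (vP y)).
Definition vr_opp x : B := vna_elt hM (vnaN hM (vP x)).
Definition vr_zero : B := vna_elt hM (vna0 hM).
Definition vr_mul x y : B := vna_elt hM (vna_comp hM (vP x) (vP y)).
Definition vr_one : B := vna_elt hM (vna_id hM).

Fact vr_addA : associative vr_add.
Proof. by move=> x y z; apply: vr_ext => v; rewrite /= !fctE addrA. Qed.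
Fact vr_addC : commutative vr_add.
Proof. by move=> x y; apply: vr_ext => v; rewrite /= !fctE addrC. Qed.
Fact vr_add0 : left_id vr_zero vr_add.
Proof. by move=> x; apply: vr_ext => v; rewrite /= !fctE add0r. Qed.
Fact vr_addN : left_inverse vr_zero vr_opp vr_add.
Proof. by move=> x; apply: vr_ext => v; rewrite /= !fctE addNr. Qed.
HB.instance Definition _ := GRing.isZmodule.Build B vr_addA vr_addC vr_add0 vr_addN.

Fact vr_mulA : associative vr_mul.
Proof. by move=> x y z; apply: vr_ext. Qed.
Fact vr_mul1 : left_id vr_one vr_mul.
Proof. by move=> x; apply: vr_ext. Qed.
Fact vr_mulr1 : right_id vr_one vr_mul.
Proof. by move=> x; apply: vr_ext. Qed.
Fact vr_mulDl : left_distributive vr_mul vr_add.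
Proof. by move=> x y z; apply: vr_ext. Qed.
Fact vr_mulDr : right_distributive vr_mul vr_add.
Proof.
move=> x y z; apply: vr_ext => v /=; rewrite !fctE.
have := vna_linear hM (vP x) 1 (sval y v) (sval z v).
by rewrite !scale1r.
Qed.
HB.instance Definition _ := GRing.Zmodule_isPzRing.Build B
  vr_mulA vr_mul1 vr_mulr1 vr_mulDl vr_mulDr.

End Ring.

(** * Adjoints, the state, and the tracial ring that they form *)

Section State.
Context (R : realType) (H : completeNormedModType R[i]).
Variable ip : {dot H for @Num.conj R[i]}.
Hypothesis hilb : hilbert_norm ip.
Variable M : set (H -> H).
Hypothesis hM : von_neumann_algebra ip M.
Variable tau : (H -> H) -> R[i].
Hypothesis ht : faithful_normal_tracial_state ip M tau.
Implicit Types (u v w : H) (a b c : H -> H) (r : R).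

Local Notation rp := (rip ip).
Local Notation ad := (adj ip).

Definition re_trace a : R := complex.Re (tau a).

Let Mlin := vna_linear hM.

Lemma adj_mem a : M a -> M (ad a).
Proof. by case/(vna_adjP hilb hM). Qed.

Lemma adj_is a : M a -> is_adjoint ip a (ad a).
Proof. by case/(vna_adjP hilb hM). Qed.

Lemma rip_adj a u v : M a -> rp (a u) v = rp u ((ad a) v).
Proof. by move=> Ma; exact: adjoint_rip (adj_is Ma). Qed.

Lemma rip_adjr a u v : M a -> rp u (a v) = rp ((ad a) u) v.
Proof. by move=> Ma; rewrite (ripC ip) rip_adj// (ripC ip). Qed.

Lemma adj_eq a b : M b -> (forall u v, rp (a u) v = rp u (b v)) -> (ad a) = b.
Proof. by move=> Mb h; apply: (adjE hilb); apply: is_adjointP => //; exact: Mlin. Qed.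

Lemma adjK a : M a -> (ad (ad a)) = a.
Proof.
by move=> Ma; apply: (adjE hilb); apply: adjointC; exact: adj_is.
Qed.

Lemma adjD a b : M a -> M b -> (ad (a + b)) = ad a + ad b.
Proof.
move=> Ma Mb; apply: adj_eq; first by apply: (vnaD hM); exact: adj_mem.
by move=> u v; rewrite !fctE ripDl ripDr !rip_adj.
Qed.

Lemma adjN a : M a -> (ad (- a)) = - ad a.
Proof.
move=> Ma; apply: adj_eq; first by apply: (vnaN hM); exact: adj_mem.
by move=> u v; rewrite !fctE ripNl ripNr !rip_adj.
Qed.

Lemma adj_comp a b : M a -> M b -> (ad (a \o b)) = ad b \o ad a.
Proof.
move=> Ma Mb; apply: adj_eq; first by apply: (vna_comp hM); exact: adj_mem.
by move=> u v /=; rewrite !rip_adj.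
Qed.

Lemma adjZr r a : M a -> (ad (r%:C *: a)) = r%:C *: ad a.
Proof.
move=> Ma; apply: adj_eq; first by apply: (vnaZ hM); exact: adj_mem.
by move=> u v; rewrite !fctE ripZl ripZr !rip_adj.
Qed.

Lemma adj_id : ad (idfun : H -> H) = idfun.
Proof. by apply: adj_eq; first exact: (vna_id hM). Qed.

Lemma sa_adjoint a : M a -> (ad a) = a -> is_adjoint ip a a.
Proof. by move=> Ma e; have := adj_is Ma; rewrite e. Qed.

Lemma pos_op_sa a : M a -> (ad a) = a -> (forall v, 0 <= rp (a v) v) -> pos_op ip a.
Proof. by move=> Ma sa h; apply/pos_opP => //; exact: sa_adjoint. Qed.

Lemma pos_op_adjM a : M a -> pos_op ip ((ad a) \o a).
Proof.
move=> Ma; have Ma' := adj_mem Ma; apply: pos_op_sa.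
- exact: (vna_comp hM).
- by rewrite adj_comp// adjK.
- by move=> v /=; rewrite -rip_adjr// rip_ge0.
Qed.

(** Polarization at [u + v] and [u + i v]: a form without imaginary part on the diagonal is
    Hermitian. *)
Lemma pos_op_adj a : M a -> pos_op ip a -> (ad a) = a.
Proof.
move=> Ma pa; have Im0 v : complex.Im (ip (a v) v) = 0.
  by have := pa v; rewrite lecE => /andP[/eqP].
have la := Mlin Ma.
have aD u v : a (u + v) = a u + a v by have := la 1 u v; rewrite !scale1r.
have aZ z v : a (z *: v) = z *: a v by have := la z v 0; rewrite (lin0 la) !addr0.
have ImD (y z : R[i]) : complex.Im (y + z) = complex.Im y + complex.Im z.
  by case: y; case: z.
have key u v : complex.Im (ip (a u) v) + complex.Im (ip (a v) u) = 0.
  have := Im0 (u + v); rewrite aD linearDl !linearDr !ImD !Im0; lra.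
apply: adj_eq => // u v.
have := key u ('i%C *: v); rewrite aZ linearZr_LR linearZl_LR/=.
rewrite (ripC ip u) /rip.
by case: (ip (a u) v) => x1 y1; case: (ip (a v) u) => x2 y2 /=; lra.
Qed.

Lemma re_traceD a b : M a -> M b -> re_trace (a + b) = re_trace a + re_trace b.
Proof.
by move=> Ma Mb; rewrite /re_trace -[a]scale1r (state_linear ht)// mul1r scale1r ReD.
Qed.

Lemma tau0 : tau 0 = 0.
Proof.
have := state_linear ht (-1) (vna_id hM) (vna_id hM).
by rewrite scaleN1r addNr => ->; rewrite mulN1r addNr.
Qed.

Lemma tauZ z a : M a -> tau (z *: a) = z * tau a.
Proof.
by move=> Ma; rewrite -[_ *: _]addr0 (state_linear ht) ?tau0 ?addr0//; exact: (vna0 hM).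
Qed.

Lemma tauD a b : M a -> M b -> tau (a + b) = tau a + tau b.
Proof. by move=> Ma Mb; rewrite -{1}[a]scale1r (state_linear ht)// mul1r. Qed.

Lemma re_traceZ r a : M a -> re_trace (r%:C *: a) = r * re_trace a.
Proof. by move=> Ma; rewrite /re_trace tauZ// ReZ. Qed.

Lemma re_traceN a : M a -> re_trace (- a) = - re_trace a.
Proof. by move=> Ma; rewrite -scaleN1r /re_trace tauZ// mulN1r ReN. Qed.

Lemma re_traceB a b : M a -> M b -> re_trace (a - b) = re_trace a - re_trace b.
Proof. by move=> Ma Mb; rewrite re_traceD ?re_traceN//; exact: (vnaN hM). Qed.

Lemma re_trace1 : re_trace idfun = 1.
Proof. by rewrite /re_trace (state_unit ht). Qed.

Lemma re_trace_ge0 a : M a -> pos_op ip a -> 0 <= re_trace a.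
Proof. by move=> Ma pa; have := state_pos ht Ma pa; rewrite lecE => /andP[_]. Qed.

Lemma tau_pos_real a : M a -> pos_op ip a -> tau a = (re_trace a)%:C.
Proof. by move=> Ma pa; rewrite /re_trace RRe_real// ger0_real// (state_pos ht). Qed.

Lemma re_traceC a b : M a -> M b -> re_trace (a \o b) = re_trace (b \o a).
Proof. by move=> Ma Mb; rewrite /re_trace (state_tracial ht). Qed.

(** In [(1 + a)^2 = 1 + 2 a + a^2] both squares are positive and have real traces. *)
Lemma tau_sa_real a : M a -> (ad a) = a -> complex.Im (tau a) = 0.
Proof.
move=> Ma sa; have Mi := vna_id hM; pose b := idfun + a.
have Mb : M b by exact: (vnaD hM).
have sb : ad b = b by rewrite adjD// sa adj_id.
have := tau_pos_real _ (pos_op_adjM Mb); rewrite sb => /(_ (vna_comp hM Mb Mb)).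
have := tau_pos_real _ (pos_op_adjM Ma); rewrite sa => /(_ (vna_comp hM Ma Ma)) ta.
have -> : b \o b = (idfun + a) + (a + (a \o a)).
  apply/funext => v; rewrite /b /= !fctE /=.
  by have := Mlin Ma 1 v (a v); rewrite !scale1r => ->.
have Maa := vna_comp hM Ma Ma.
have Mi1 := vnaD hM Mi Ma; have Mi2 := vnaD hM Ma Maa; rewrite !tauD//.
rewrite (state_unit ht) ta; case: (tau a) => x y /= /eqP.
by rewrite eq_complex/= => /andP[_ /eqP]; lra.
Qed.

(** ['i%C *: (a - ad a)] is self-adjoint; that its trace is real says that [a] and [ad a] have
    traces with the same real part. *)
Lemma re_trace_adj a : M a -> re_trace (ad a) = re_trace a.
Proof.
move=> Ma; have Ma' := adj_mem Ma; pose b := 'i%C *: (a - ad a).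
have Mab : M (a - ad a) by exact: (vnaB hM).
have Mb : M b by exact: (vnaZ hM).
have sb : ad b = b.
  apply: adj_eq => // u v; rewrite /b !fctE /rip linearZl_LR linearZr_LR/=.
  rewrite linearBl [ip u (a v - _)]linearBr/= (adj_is Ma) (adjointC (adj_is Ma)).
  by case: (ip u _) => x y; case: (ip u _) => x' y' /=; lra.
have := tau_sa_real Mb sb; rewrite /b tauZ// tauD//; last exact: (vnaN hM).
rewrite -scaleN1r tauZ// /re_trace.
by case: (tau a) => x y; case: (tau _) => x' y' /=; lra.
Qed.

Local Notation B := (vna_ring hM).
Let vP (x : B) : M (sval x) := @vna_ringP _ _ _ _ hM x.

Definition vr_st (x : B) : B := vna_elt hM (adj_mem (vP x)).
Definition vr_t (x : B) : R := re_trace (sval x).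
Definition vr_scf r : B := vna_elt hM (vnaZ hM r%:C (vna_id hM)).

Fact vr_sc_additive : zmod_morphism vr_scf.
Proof.
by move=> r s; apply: vr_ext => v; rewrite /= !fctE/= rmorphB scalerBl.
Qed.
HB.instance Definition _ := GRing.isZmodMorphism.Build R B vr_scf vr_sc_additive.

Fact vr_sc_multiplicative : monoid_morphism vr_scf.
Proof.
split; first by apply: vr_ext => v; rewrite /= !fctE/= rmorph1 scale1r.
by move=> r s; apply: vr_ext => v; rewrite /= !fctE/= rmorphM scalerA.
Qed.
HB.instance Definition _ := GRing.isMonoidMorphism.Build R B vr_scf vr_sc_multiplicative.
Definition vr_sc : {rmorphism R -> B} := vr_scf.

Lemma vr_tracial : tracial vr_sc vr_st vr_t.
Proof.
split=> [r x|x y|x y|x|r|x y|r x|x y|x|x|].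
- apply: vr_ext => v; rewrite /= !fctE /=.
  by have := Mlin (vP x) r%:C v 0; rewrite (lin0 (Mlin (vP x))) !addr0.
- by apply/val_inj; rewrite /= adjD.
- by apply/val_inj; rewrite /= adj_comp.
- by apply/val_inj; rewrite /= adjK.
- by apply/val_inj; rewrite /= adjZr ?adj_id//; exact: (vna_id hM).
- exact: re_traceD.
- rewrite /vr_t -re_traceZ//; congr re_trace.
- exact: re_traceC.
- exact: re_trace_adj.
- by apply: re_trace_ge0; [exact: vP|exact: pos_op_adjM].
- exact: re_trace1.
Qed.

Lemma vr_posop (x : B) : ad (sval x) = sval x -> (forall v, 0 <= rp (sval x v) v) ->
  posop vr_st vr_t x.
Proof.
move=> sx px y; apply: re_trace_ge0; first exact: vP.
have My := vP y; have Mx := vP x; have Myx := vna_comp hM (adj_mem My) Mx.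
apply: pos_op_sa; first exact: vP.
  by rewrite /= (adj_comp Myx My) (adj_comp (adj_mem My) Mx) (adjK My) sx.
by move=> v /=; rewrite -rip_adjr.
Qed.

Lemma vr_bnd (x : B) K : op_bounded_by (sval x) K -> bnd vr_st vr_t x K.
Proof.
move=> [K0 hK]; split=> // y; have Mx := vP x.
rewrite -(@ler_pXn2r _ 2) ?nnegrE ?mulr_ge0 ?(gns_norm_ge0)// exprMn !(gns_normE vr_tracial).
have pz : posop vr_st vr_t (vr_sc (K ^+ 2) - vr_st x * x).
  apply: vr_posop.
    have Mx' := adj_mem Mx; have Mi := vna_id hM; have Mxx := vna_comp hM Mx' Mx.
    rewrite /= (adjD (vnaZ hM _ Mi) (vnaN hM Mxx)) (adjN Mxx) (adjZr _ Mi) adj_id.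
    by rewrite (adj_comp Mx' Mx) (adjK Mx).
  move=> v; rewrite /= !fctE/= ripDl ripNl ripZl -rip_adjr// subr_ge0 -!(rnorm_sq hilb).
  by rewrite -exprMn lerXn2r ?nnegrE ?mulr_ge0 ?rnorm_ge0.
have := pz y; rewrite mulrBr mulrBl (traceB vr_tracial) subr_ge0.
rewrite -(tr_sc vr_tracial) -[_ * vr_st y * y]mulrA (traceZ vr_tracial).
by rewrite /gns_sq (tr_stM vr_tracial) !mulrA.
Qed.

Lemma vr_bounded (x : B) : exists K, bnd vr_st vr_t x K.
Proof.
have /bounded_opP[_ [K hK]] := vna_bounded hM (vP x).
by exists K; exact: vr_bnd.
Qed.

End State.

(** * Moments of the martingale in terms of its brackets *)

Section Martingale.
Context (R : realType) (H : completeNormedModType R[i]).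
Variable ip : {dot H for @Num.conj R[i]}.
Hypothesis hilb : hilbert_norm ip.
Variable M : set (H -> H).
Hypothesis hM : von_neumann_algebra ip M.
Variable tau : (H -> H) -> R[i].
Hypothesis ht : faithful_normal_tracial_state ip M tau.
Implicit Types (u v w : H) (a b c : H -> H) (r : R).

Local Notation rp := (rip ip).
Local Notation ad := (adj ip).
Local Notation rtr := (re_trace tau).
Local Notation B := (vna_ring hM).
Local Notation stv := (@vr_st _ _ _ hilb _ hM).
Local Notation tv := (@vr_t _ _ _ _ hM tau).
Let vP (x : B) : M (sval x) := @vna_ringP _ _ _ _ hM x.

Lemma sval_sum n (F : nat -> B) : sval (\sum_(i < n) F i) = \sum_(i < n) sval (F i).
Proof. by elim: n => [|n IH]; rewrite ?big_ord0// !big_ord_recr/= -IH. Qed.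

Lemma svalX (a : B) n : sval (a ^+ n) = iter n (sval a).
Proof. by elim: n => [|n IH]; rewrite ?expr0// exprS/= IH. Qed.

Lemma op_bounded_by_adj a K : M a -> op_bounded_by a K -> op_bounded_by (ad a) K.
Proof.
move=> Ma [K0 hK]; split=> // v; set w := ad a v.
have := le_trans (ler_norm _) (rip_le hilb (a w) v).
rewrite (rip_adj hilb hM _ _ Ma) -/w -(rnorm_sq hilb) => h.
case: (eqVneq (rnorm w) 0) => [->|w0]; first by rewrite mulr_ge0 ?rnorm_ge0.
have w0' : 0 < rnorm w by rewrite lt_def w0 rnorm_ge0.
rewrite -(ler_pM2l w0') -expr2; apply: le_trans h _.
by rewrite mulrCA mulrA ler_wpM2r ?rnorm_ge0// hK.
Qed.

Lemma rip_sum n (F : nat -> H -> H) v w :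
  rp ((\sum_(i < n) F i) v) w = \sum_(i < n) rp (F i v) w.
Proof.
elim: n => [|n IH]; last by rewrite !big_ord_recr/= fctE ripDl IH.
by rewrite !big_ord0 /rip -[_ v]/(0 : H) linear0l.
Qed.

Lemma rip_opnorm a v : M a -> rp (a v) v <= opnorm a * rp v v.
Proof.
move=> /(vna_bounded hM)/opnorm_bnd[a0 ha].
apply: le_trans (ler_norm _) _; apply: (le_trans (rip_le hilb _ _)).
by rewrite -(rnorm_sq hilb) expr2 mulrA ler_wpM2r ?rnorm_ge0.
Qed.

Variables (Mn : nat -> set (H -> H)) (E : nat -> (H -> H) -> (H -> H)).
Variable x : nat -> H -> H.
Hypothesis hF : filtration ip M Mn.
Hypothesis hE : forall n, normal_cond_exp ip M (Mn n) tau (E n).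
Hypothesis hx : martingale Mn E x.
Hypothesis x0 : x 0%N = 0.

Let hMn n : von_neumann_algebra ip (Mn n) := filtration_vna hF n.
Let MnM n a : Mn n a -> M a := @filtration_sub _ _ _ _ _ hF n a.
(** Shifted index: [d i] is the difference at time [i.+1], so that it pairs with [E i]. *)
Let d i := mdiff x i.+1.

Lemma mart_mem n : Mn n (x n). Proof. by case: (hx n). Qed.

Lemma mdiff_mem i : Mn i.+1 (d i).
Proof.
apply: (vnaB (hMn _)); first exact: mart_mem.
by apply: (filtration_incr hF); exact: mart_mem.
Qed.

Lemma cond_exp_l i a b : Mn i a -> M b -> E i (a \o b) = a \o E i b.
Proof.
move=> Ma Mb; have := cond_exp_bimodule (hE i) Ma Mb (vna_id (hMn i)).
by [].
Qed.

Lemma re_trace_cond_exp i a b : Mn i a -> M b -> rtr (a \o E i b) = rtr (a \o b).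
Proof.
move=> Ma Mb; rewrite -cond_exp_l// /re_trace (cond_exp_trace (hE i))//.
by apply: (vna_comp hM) => //; exact: MnM Ma.
Qed.

Lemma re_trace_mdiff i a : Mn i a -> rtr (a \o d i) = 0.
Proof.
move=> Ma; have Mx := MnM (mart_mem i.+1); have Mx' := MnM (mart_mem i).
have Ma' := MnM Ma.
have -> : a \o d i = (a \o x i.+1) - (a \o x i).
  apply/funext => v; rewrite /= /d /mdiff !fctE/=.
  have := vna_linear hM Ma' (-1) (x i v) (x i.+1 v).
  by rewrite !scaleN1r [- x i v + _]addrC [- a _ + _]addrC.
rewrite (re_traceB hM ht (vna_comp hM Ma' Mx) (vna_comp hM Ma' Mx')).
by rewrite -(re_trace_cond_exp Ma Mx) (proj2 (hx i)) subrr.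
Qed.

Lemma cond_sq_pos i a : M a ->
  [/\ Mn i (E i (ad a \o a)), pos_op ip (E i (ad a \o a)) &
      ad (E i (ad a \o a)) = E i (ad a \o a)].
Proof.
move=> Ma; have Maa := vna_comp hM (adj_mem hilb hM Ma) Ma.
have m1 := cond_exp_mem (hE i) Maa.
have m2 := cond_exp_pos (hE i) Maa (pos_op_adjM hilb hM Ma).
by split=> //; apply: (pos_op_adj hilb hM) => //; exact: MnM m1.
Qed.

Lemma adj_mdiffM i : ad (ad (d i)) \o ad (d i) = d i \o ad (d i).
Proof. by rewrite (adjK hilb hM)//; exact: MnM (mdiff_mem i). Qed.

Let vr n := \sum_(i < n) E i (ad (d i) \o d i).
Let vl n := \sum_(i < n) E i (d i \o ad (d i)).

Lemma s2E n : s2 ip E x n = Num.max (opnorm (vr n)) (opnorm (vl n)).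
Proof. by rewrite /s2 !big_add1/= !big_mkord. Qed.

Lemma mart_sum n : x n = \sum_(i < n) d i.
Proof.
elim: n => [|n IH]; first by rewrite big_ord0.
by rewrite big_ord_recr/= -IH /d /mdiff addrC subrK.
Qed.

Lemma bracket_pos i : [/\ M (E i (ad (d i) \o d i)), pos_op ip (E i (ad (d i) \o d i)) &
  M (E i (d i \o ad (d i))) /\ pos_op ip (E i (d i \o ad (d i)))].
Proof.
have Md := MnM (mdiff_mem i).
have [m1 p1 _] := cond_sq_pos i Md.
have [m2 p2 _] := cond_sq_pos i (adj_mem hilb hM Md).
by rewrite adj_mdiffM in m2 p2; split; [exact: MnM m1|exact: p1|split; [exact: MnM m2|exact: p2]].
Qed.

(** The abstract moment bound applied to [lam * x], the compensators being the conditional squares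
    times [(2 - D)^-1 * lam ^+ 2]. The scale [lam] stays free, to be optimized on each block. *)
Lemma mart_moment N j (lam D : R) : 0 <= lam -> D <= 1 ->
  (forall i, (i < N)%N -> lam * opnorm (mdiff x i.+1) <= D) ->
  lam ^+ (2 * j) * rtr (iter j (ad (x N) \o x N)) <=
    (2 * j)`!%:R * expR ((2 - D)^-1 * lam ^+ 2 * s2 ip E x N).
Proof.
move=> l0 D1 hd.
have Md i : M (d i) := MnM (mdiff_mem i).
have c0 : 0 <= (2 - D)^-1 * lam ^+ 2 by rewrite mulr_ge0 ?sqr_ge0// invr_ge0; lra.
have Msq i : M (ad (d i) \o d i) by apply: (vna_comp hM) => //; exact: (adj_mem hilb hM).
have Msq' i : M (d i \o ad (d i)) by apply: (vna_comp hM) => //; exact: (adj_mem hilb hM).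
have Mr i : M (E i (ad (d i) \o d i)) by have [] := bracket_pos i.
have Ml i : M (E i (d i \o ad (d i))) by have [_ _ []] := bracket_pos i.
have sr i : ad (E i (ad (d i) \o d i)) = E i (ad (d i) \o d i).
  by have [m p _] := bracket_pos i; exact: (pos_op_adj hilb hM m p).
have sl i : ad (E i (d i \o ad (d i))) = E i (d i \o ad (d i)).
  by have [_ _ [m p]] := bracket_pos i; exact: (pos_op_adj hilb hM m p).
pose cc := (2 - D)^-1 * lam ^+ 2.
pose P n (a : B) := Mn n (sval a).
pose dB i : B := vna_elt hM (vnaZ hM lam%:C (Md i)).
pose hr i : B := vna_elt hM (vnaZ hM cc%:C (Mr i)).
pose hl i : B := vna_elt hM (vnaZ hM cc%:C (Ml i)).
have T := vr_tracial hilb hM ht.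
pose S := cc * s2 ip E x N.
have PBsum n (F : nat -> vna_ring hM) : (forall i, P n (F i)) -> P n (\sum_(i < n) F i).
  by move=> hP; rewrite /P sval_sum; apply: (vna_sum (hMn n)) => i _; exact: hP.
have sq_scale (y : vna_ring hM) : lam ^+ 2 * tv y = tv (vr_sc hM (lam ^+ 2) * y).
  by rewrite (traceZ T).
have dBE i : dB i = vr_sc hM lam * vna_elt hM (Md i).
  by apply: vr_ext => v; rewrite /= !fctE.
have stdB i : stv (dB i) = vr_sc hM lam * stv (vna_elt hM (Md i)).
  by rewrite dBE (tr_stM T) (tr_st_sc T) (tr_sc T).
have bdB i : (i < N)%N -> op_bounded_by (sval (dB i)) D.
  move=> iN; have [k0 ho] := opnorm_bnd (vna_bounded hM (Md i)).
  split=> [|v]; first by apply: le_trans (hd i iN); rewrite mulr_ge0.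
  rewrite /= !fctE rnormZ ger0_norm//; apply: (@le_trans _ _ (lam * (opnorm (d i) * rnorm v))).
    by rewrite ler_wpM2l.
  by rewrite mulrA ler_wpM2r ?rnorm_ge0// hd.
(* Each bracket is at most its norm, hence at most [s2]; this provides the scalar [S] above both
   sums of compensators. *)
have posopS (F : nat -> (H -> H)) (hB : nat -> vna_ring hM) : (forall i, M (F i)) ->
    (forall i, ad (F i) = F i) -> (forall i, sval (hB i) = cc%:C *: F i) ->
    opnorm (\sum_(i < N) F i) <= s2 ip E x N ->
    posop (stv) (tv) (vr_sc hM S - \sum_(i < N) hB i).
  move=> MF sF hBE le_s2; have MS : M (\sum_(i < N) F i) by apply: (vna_sum hM).
  apply: (vr_posop hilb ht).
    have sh i : stv (hB i) = hB i.
      by apply/val_inj; rewrite /= hBE (adjZr hilb hM)// sF.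
    apply: (congr1 sval (_ : stv (vr_sc hM S - \sum_(i < N) hB i) = _)).
    by rewrite (starB T) (tr_st_sc T) (star_sum T); congr (_ - _); apply: eq_bigr.
  move=> v; rewrite /= !fctE/= ripDl ripNl ripZl sval_sum.
  rewrite (rip_sum N (fun i => sval (hB i)) v v) subr_ge0.
  rewrite (eq_bigr (fun i : 'I_N => cc * rp (F i v) v)); last first.
    by move=> i _; rewrite hBE fctE ripZl.
  rewrite -mulr_sumr -(rip_sum N F v v) /S -[cc * _ * _]mulrA ler_wpM2l//.
  apply: le_trans (rip_opnorm v MS) _.
  by rewrite ler_wpM2r// (rip_ge0 hilb).
have main := @martingale_abs_moment _ _ _ _ _ T (vr_bounded hilb ht) N P dB hl hr D S j.
have xE : \sum_(i < N) dB i = vr_sc hM lam * vna_elt hM (MnM (mart_mem N)).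
  rewrite (eq_bigr (fun i : 'I_N => vr_sc hM lam * vna_elt hM (Md i))) -?mulr_sumr.
    congr (_ * _); apply: vr_ext => v; rewrite (sval_sum N (fun i => vna_elt hM (Md i)))/=.
    by rewrite [in RHS]mart_sum.
  by move=> i _; exact: dBE.
set X : vna_ring hM := vna_elt hM (MnM (mart_mem N)) in xE.
have powE : (stv (vr_sc hM lam * X) * (vr_sc hM lam * X)) ^+ j =
    vr_sc hM (lam ^+ (2 * j)) * (stv X * X) ^+ j.
  rewrite (tr_stM T) (tr_st_sc T) -mulrA (mulrA (vr_sc hM lam)) -rmorphM.
  rewrite mulrA -(tr_sc T) -mulrA exprMn_comm; last exact: (comm_sc T).
  by rewrite -rmorphXn -expr2 -exprM.
have svX : tv ((stv X * X) ^+ j) = rtr (iter j (ad (x N) \o x N)) by rewrite /vr_t svalX.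
rewrite xE powE (traceZ T) svX in main.
have scT r (a w : vna_ring hM) : tv (a * (vr_sc hM r * w)) = r * tv (a * w).
  by rewrite [a * (vr_sc _ _ * _)]mulrA -(tr_sc T) -mulrA (traceZ T).
have scM (a y z : vna_ring hM) :
    tv (a * (vr_sc hM lam * y * (vr_sc hM lam * z))) = lam ^+ 2 * tv (a * (y * z)).
  have -> : vr_sc hM lam * y * (vr_sc hM lam * z) = vr_sc hM (lam ^+ 2) * (y * z).
    by rewrite expr2 rmorphM -!mulrA (mulrA y) -(tr_sc T) -!mulrA.
  exact: scT.
apply: main.
- by move=> n r; apply: (vnaZ (hMn n)); exact: (vna_id (hMn n)).
- by move=> n a b; exact: (vnaD (hMn n)).
- by move=> n a b; exact: (vna_comp (hMn n)).
- by move=> n a Pa; exact: (adj_mem hilb (hMn n)).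
- by move=> n a; exact: (filtration_incr hF).
- by move=> n; apply: (vnaZ (hMn n.+1)); exact: mdiff_mem.
- move=> n; apply: (vnaZ (hMn n)); apply: (cond_exp_mem (hE n)); exact: Msq'.
- move=> n; apply: (vnaZ (hMn n)); apply: (cond_exp_mem (hE n)); exact: Msq.
- by move=> n; apply/val_inj; rewrite /= (adjZr hilb hM _ (Ml n)) sl.
- by move=> n; apply/val_inj; rewrite /= (adjZr hilb hM _ (Mr n)) sr.
- by move=> n a Pa; rewrite dBE scT [tv _](re_trace_mdiff Pa) mulr0.
- move=> n a Pa.
  have -> : hl n = vr_sc hM cc * vna_elt hM (Ml n) by apply: vr_ext => v; rewrite /= !fctE.
  rewrite scT [tv _](re_trace_cond_exp Pa (Msq' n)).
  by rewrite stdB dBE scM [RHS]mulrA.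
- move=> n a Pa.
  have -> : hr n = vr_sc hM cc * vna_elt hM (Mr n) by apply: vr_ext => v; rewrite /= !fctE.
  rewrite scT [tv _](re_trace_cond_exp Pa (Msq n)).
  by rewrite stdB dBE scM [RHS]mulrA.
- by move=> n nN; apply: (vr_bnd hilb ht); exact: bdB.
- by move=> n nN; apply: (vr_bnd hilb ht); apply: op_bounded_by_adj; [exact: vP|exact: bdB].
- exact: D1.
- rewrite /S mulr_ge0// s2E; rewrite le_max; apply/orP; left.
  have MS : M (vr N) by apply: (vna_sum hM).
  by have [] := opnorm_bnd (vna_bounded hM MS).
- by apply: (posopS _ _ Ml sl) => //; rewrite s2E le_max lexx orbT.
- by apply: (posopS _ _ Mr sr) => //; rewrite s2E le_max lexx.
Qed.

End Martingale.

(** * Strong limits and spectral projections *)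

Section StrongLimits.
Context (R : realType) (H : completeNormedModType R[i]).
Variable ip : {dot H for @Num.conj R[i]}.
Hypothesis hilb : hilbert_norm ip.
Implicit Types (u v w : H) (a b c : H -> H) (r : R).
Local Notation rp := (rip ip).

Lemma cvg_rnormP (u : nat -> H) (l : H) :
  u n @[n --> \oo] --> l <-> forall e : R, 0 < e -> \forall n \near \oo, rnorm (l - u n) < e.
Proof.
split=> [/cvgrPdist_lt h e e0|h].
  have := h e%:C; rewrite ltcR => /(_ e0); apply: filterS => n.
  by rewrite rnormE ltcR.
apply/cvgrPdist_lt => e e0.
have er : e = (complex.Re e)%:C by rewrite RRe_real// gtr0_real.
rewrite er ltcR in e0; have := h _ e0; apply: filterS => n.
by rewrite rnormE er ltcR.
Qed.

(** A bounded increasing real sequence controls the increments of [u], which is therefore Cauchy.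
    Serves for the iterates of the sign and for decreasing projections. *)
Lemma nondecreasing_gap_cvg (u : nat -> H) (m : nat -> R) (K : R) :
  (forall n, m n <= K) ->
  (forall k l, (k <= l)%N -> rnorm (u l - u k) ^+ 2 <= m l - m k) -> cvgn u.
Proof.
move=> mK um.
have mm : {homo m : k l / (k <= l)%N >-> k <= l}.
  by move=> k l kl; rewrite -subr_ge0; apply: le_trans (um k l kl); exact: sqr_ge0.
have cm : cvgn m.
  by apply: nondecreasing_is_cvgn => //; exists K => _ [n _ <-].
have ml n : m n <= limn m by exact: nondecreasing_cvgn_le.
apply/cauchy_cvgP/cauchy_exP => e e0.
have er : e = (complex.Re e)%:C by rewrite RRe_real// gtr0_real.
set r := complex.Re e in er; have r0 : 0 < r by move: e0; rewrite er ltcR.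
have /cvgrPdist_lt/(_ (r ^+ 2)) : m @ \oo --> limn m by exact: cm.
rewrite exprn_gt0// => /(_ isT)[N _ hN].
exists (u N), N => // n /= Nn.
rewrite -ball_normE /ball_/= rnormE er ltcR -(@ltr_pXn2r _ 2) ?nnegrE ?rnorm_ge0 ?(ltW r0)//.
rewrite -rnormN opprB; apply: (le_lt_trans (um N n Nn)).
apply: le_lt_trans (hN N (leqnn N)); apply: le_trans (ler_norm _).
by rewrite lerB.
Qed.

Lemma cvg_rip (u : nat -> H) l w : u n @[n --> \oo] --> l ->
  rp (u n) w @[n --> \oo] --> rp l w.
Proof.
move=> /cvg_rnormP h; apply/cvgrPdist_lt => e e0.
have e0' : 0 < e / (rnorm w + 1) by rewrite divr_gt0// ltr_wpDl ?rnorm_ge0.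
have := h _ e0'; apply: filterS => n hn1.
rewrite -ripNl -ripDl; apply: (le_lt_trans (rip_le hilb _ _)).
apply: (@le_lt_trans _ _ (rnorm (l - u n) * (rnorm w + 1))).
  by rewrite ler_wpM2l ?rnorm_ge0// lerDl.
by rewrite -ltr_pdivlMr// ltr_wpDl ?rnorm_ge0.
Qed.

Lemma rnorm_lim_le (u : nat -> H) l r : u n @[n --> \oo] --> l ->
  (forall n, rnorm (u n) <= r) -> rnorm l <= r.
Proof.
move=> /cvg_rnormP h ur; rewrite leNgt; apply/negP => rl.
have := h (rnorm l - r); rewrite subr_gt0 => /(_ rl)[N _ /(_ N (leqnn N))].
apply/negP; rewrite -leNgt lerBlDr.
have := rnormD (l - u N) (u N); rewrite subrK => /le_trans; apply.
by rewrite lerD2l.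
Qed.

Lemma lim_linear (a : nat -> H -> H) b : (forall n, linear (a n)) ->
  (forall v, a n v @[n --> \oo] --> b v) -> linear b.
Proof.
move=> la ab k u v.
have h1 := ab (k *: u + v).
have h2 : (k *: a n u + a n v) @[n --> \oo] --> k *: b u + b v.
  by apply: cvgD; [exact: cvgZr (ab u)|exact: ab].
have e : (fun n => a n (k *: u + v)) = fun n => k *: a n u + a n v.
  by apply/funext => n; rewrite la.
by rewrite e in h1; exact: (cvg_unique _ h1 h2).
Qed.

Lemma lim_bounded (a : nat -> H -> H) b K : (forall n, linear (a n)) ->
  (forall n v, rnorm (a n v) <= K * rnorm v) -> 0 <= K ->
  (forall v, a n v @[n --> \oo] --> b v) -> bounded_op b /\ op_bounded_by b K.
Proof.
move=> la aK K0 ab.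
have hb : op_bounded_by b K by split=> // v; apply: rnorm_lim_le (ab v) _ => n; exact: aK.
by split=> //; apply/bounded_opP; split; [exact: lim_linear ab|exists K].
Qed.

Lemma lim_adjoint (a : nat -> H -> H) b :
  (forall n u v, rp (a n u) v = rp u (a n v)) ->
  (forall v, a n v @[n --> \oo] --> b v) -> forall u v, rp (b u) v = rp u (b v).
Proof.
move=> sa ab u v.
have h1 := @cvg_rip _ _ v (ab u); have h2 := @cvg_rip _ _ u (ab v).
have e : (fun n => rp (a n u) v) = fun n => rp (a n v) u.
  by apply/funext => n; rewrite sa (ripC ip).
by rewrite e in h1; rewrite [RHS](ripC ip); exact: (cvg_unique _ h1 h2).
Qed.

Lemma cvg_comp_contraction (a : nat -> H -> H) a' (x : nat -> H) (y : H) :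
  (forall n, linear (a n)) -> (forall n w, rnorm (a n w) <= rnorm w) ->
  (forall w, a n w @[n --> \oo] --> a' w) -> x n @[n --> \oo] --> y ->
  a n (x n) @[n --> \oo] --> a' y.
Proof.
move=> la ca haa /cvg_rnormP hb; apply/cvg_rnormP => e e0.
have e2 : 0 < e / 2 by rewrite divr_gt0.
have /cvg_rnormP/(_ _ e2) h1 := haa y; have h2 := hb _ e2.
near=> n.
have -> : a' y - a n (x n) = (a' y - a n y) + a n (y - x n).
  rewrite [y - _]addrC; have := la n (-1) (x n) y; rewrite !scaleN1r => ->.
  by rewrite [- _ + _]addrC addrA subrK.
apply: (le_lt_trans (rnormD _ _)); rewrite [e]splitr; apply: ltrD.
  by near: n.
by apply: (le_lt_trans (ca _ _)); near: n.
Unshelve. all: by end_near. Qed.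

End StrongLimits.

Section Spectral.
Context (R : realType) (H : completeNormedModType R[i]).
Variable ip : {dot H for @Num.conj R[i]}.
Hypothesis hilb : hilbert_norm ip.
Implicit Types (u v w : H) (p q : {poly R}).
Local Notation rp := (rip ip).
Variables (N : set (H -> H)) (h : H -> H).
Hypothesis hN : von_neumann_algebra ip N.
Hypothesis Nh : N h.
Hypothesis sh : forall u v, rp (h u) v = rp u (h v).
Hypothesis h1 : forall v, rnorm (h v) <= rnorm v.

Let lh : linear h := vna_linear hN Nh.

Definition op_eval p v : H := \sum_(i < size p) (p`_i)%:C *: iter i h v.

Lemma op_evalW p v n : (size p <= n)%N -> op_eval p v = \sum_(i < n) (p`_i)%:C *: iter i h v.
Proof.
move=> pn; rewrite /op_eval (big_ord_widen n (fun i => (p`_i)%:C *: iter i h v))//.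
rewrite big_mkcond; apply: eq_bigr => i _; case: ltnP => // pi.
by rewrite nth_default// rmorph0 scale0r.
Qed.

Lemma op_evalD p q v : op_eval (p + q) v = op_eval p v + op_eval q v.
Proof.
pose n := maxn (size p) (size q).
rewrite (@op_evalW _ _ n) ?size_polyD// (@op_evalW p _ n) ?leq_maxl// (@op_evalW q _ n) ?leq_maxr//.
by rewrite -big_split; apply: eq_bigr => i _; rewrite coefD rmorphD scalerDl.
Qed.

Lemma op_evalZ r p v : op_eval (r *: p) v = r%:C *: op_eval p v.
Proof.
rewrite (@op_evalW _ _ (size p)) ?size_scale_leq// /op_eval scaler_sumr.
by apply: eq_bigr => i _; rewrite coefZ rmorphM scalerA.
Qed.

Lemma op_eval0 v : op_eval 0 v = 0.
Proof. by rewrite /op_eval size_poly0 big_ord0. Qed.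

Lemma op_evalC r v : op_eval r%:P v = r%:C *: v.
Proof. by rewrite (@op_evalW _ _ 1) ?size_polyC_leq1// big_ord1 coefC. Qed.

Lemma h_sum n (F : nat -> H) : h (\sum_(i < n) F i) = \sum_(i < n) h (F i).
Proof.
by elim: n => [|n IH]; rewrite ?big_ord0 ?(lin0 lh)// !big_ord_recr/= (linD _ _ lh) IH.
Qed.

Lemma op_evalMX p v : op_eval (p * 'X) v = h (op_eval p v).
Proof.
rewrite (@op_evalW _ _ (size p).+1); last first.
  by rewrite (leq_trans (size_polyMleq _ _))// size_polyX addn2.
rewrite big_ord_recl coefMX/= rmorph0 scale0r add0r /op_eval.
rewrite (h_sum _ (fun i => (p`_i)%:C *: iter i h v)).
by apply: eq_bigr => i _; rewrite coefMX/= (linZ _ _ lh).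
Qed.

Lemma op_evalM p q v : op_eval (p * q) v = op_eval p (op_eval q v).
Proof.
elim/poly_ind: p => [|p c IH]; first by rewrite mul0r !op_eval0.
rewrite mulrDl !op_evalD mulrAC !op_evalMX IH mul_polyC op_evalZ; congr (_ + _).
by rewrite op_evalC.
Qed.

Lemma op_evalX v : op_eval 'X v = h v.
Proof. by rewrite -['X]mul1r op_evalMX op_evalC rmorph1 scale1r. Qed.

Lemma op_evalN p v : op_eval (- p) v = - op_eval p v.
Proof. by rewrite -scaleN1r op_evalZ rmorphN1 scaleN1r. Qed.

Lemma op_eval_mem p : N (op_eval p).
Proof.
elim/poly_ind: p => [|p c IH].
  by have -> : op_eval 0 = 0 by [apply/funext => v; rewrite op_eval0]; exact: (vna0 hN).
have -> : op_eval (p * 'X + c%:P) = (h \o op_eval p) + c%:C *: idfun.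
  by apply/funext => v; rewrite op_evalD op_evalMX op_evalC.
by apply: (vnaD hN); [exact: (vna_comp hN)|apply: (vnaZ hN); exact: (vna_id hN)].
Qed.

Lemma op_eval_sa p u v : rp (op_eval p u) v = rp u (op_eval p v).
Proof.
elim/poly_ind: p u v => [|p c IH] u v.
  by rewrite !op_eval0 rip0l rip0r.
rewrite !op_evalD !op_evalMX !op_evalC ripDl ripDr ripZl ripZr; congr (_ + _).
by rewrite sh IH -!op_evalMX -[h v]op_evalX -op_evalM mulrC.
Qed.

Definition co_square : {poly R} := 1 - 'X ^+ 2.

(* Closed under products, whereas the positivity of a product of commuting
   positive operators would need square roots. *)
Definition cone p := exists q : {poly R}, (forall i, 0 <= q`_i) /\ p = q \Po co_square.

Lemma coneD p q : cone p -> cone q -> cone (p + q).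
Proof.
move=> [p' [hp ->]] [q' [hq ->]]; exists (p' + q'); split; last by rewrite comp_polyD.
by move=> i; rewrite coefD addr_ge0.
Qed.

Lemma coneM p q : cone p -> cone q -> cone (p * q).
Proof.
move=> [p' [hp ->]] [q' [hq ->]]; exists (p' * q'); split; last by rewrite comp_polyM.
by move=> i; rewrite coefM sumr_ge0// => j _; rewrite mulr_ge0.
Qed.

Lemma coneC r : 0 <= r -> cone r%:P.
Proof.
move=> r0; exists r%:P; split; last by rewrite comp_polyC.
by move=> [|i]; rewrite coefC.
Qed.

Lemma cone_co_square : cone co_square.
Proof.
exists 'X; split; last by rewrite comp_polyX.
by move=> i; rewrite coefX.
Qed.

Lemma co_square_ge0 v : 0 <= rp (op_eval co_square v) v.
Proof.
rewrite /co_square op_evalD op_evalN -[1]/(1%:P) op_evalC rmorph1 scale1r expr2 op_evalMX op_evalX ripDl ripNl sh.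
by rewrite subr_ge0 -rnorm_le.
Qed.

(** An even power is the square of a self-adjoint operator; an odd one has a single [co_square]
    between two equal factors. *)
Lemma co_squareX_ge0 i v : 0 <= rp (op_eval (co_square ^+ i) v) v.
Proof.
rewrite -(odd_double_half i) -addnn; set l := i./2.
case: (odd i); last by rewrite add0n exprD op_evalM op_eval_sa rip_ge0.
by rewrite addnCA exprD op_evalM op_eval_sa exprD expr1 op_evalM; exact: co_square_ge0.
Qed.

Lemma cone_ge0 p v : cone p -> 0 <= rp (op_eval p v) v.
Proof.
move=> [q [hq ->]]; rewrite comp_polyE.
elim/big_ind : _ => [|p1 p2 h1' h2'|i _].
- by rewrite op_eval0 rip0l.
- by rewrite op_evalD ripDl addr_ge0.
- by rewrite op_evalZ ripZl mulr_ge0// co_squareX_ge0.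
Qed.

(* Newton-Schulz iteration for the sign of [h]. *)
Fixpoint sign_poly k : {poly R} := if k is k'.+1 then sign_poly k' * (1 + 2^-1%:P * (1 - sign_poly k' ^+ 2)) else 'X.

Lemma sign_poly_cone k : cone (1 - sign_poly k ^+ 2).
Proof.
elim: k => [|k IH]; first exact: cone_co_square.
rewrite [sign_poly _]/=; set s := sign_poly k in IH *; set t := 2^-1%:P.
have t2 : 1 - 2 * t = 0 :> {poly R}.
  by rewrite /t -polyC_natr -polyCM mulfV// subrr.
(* With [u = 1 - s ^+ 2] the new defect is [u ^+ 2 * (3 + u) / 4]. To [ring], [t] is a variable,
   hence the correction multiplied by [1 - 2 * t], which vanishes as [t] is one half. *)
have -> : 1 - (s * (1 + t * (1 - s ^+ 2))) ^+ 2 =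
    (1 - s ^+ 2) * (1 - s ^+ 2) * (t * t * (3 + (1 - s ^+ 2))) +
    (1 - 2 * t) * ((1 - s ^+ 2) + 2 * t * (1 - s ^+ 2) ^+ 2) by ring.
rewrite t2 mul0r addr0; apply: coneM; first exact: coneM.
have ct : cone t by apply: coneC; rewrite invr_ge0.
apply: coneM; first exact: coneM.
by apply: coneD => //; rewrite -polyC_natr; exact: coneC.
Qed.

(** Every iteration multiplies by 1 plus an element of the cone. Therefore [sign_poly k * sign_poly
    l - sign_poly k ^+ 2] is [c] between two equal factors, hence positive, and the iterates
    increase. *)
Lemma sign_poly_gap k l : (k <= l)%N -> exists2 c, cone c & sign_poly l = sign_poly k + sign_poly k * c.
Proof.
elim: l => [|l IH]; first by rewrite leqn0 => /eqP ->; exists 0; [exact: coneC|ring].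
rewrite leq_eqVlt => /predU1P[->|]; first by exists 0; [exact: coneC|ring].
rewrite ltnS => /IH[c cc e].
exists (c + 2^-1%:P * (1 - sign_poly l ^+ 2) + c * (2^-1%:P * (1 - sign_poly l ^+ 2))).
  have ch : cone (2^-1%:P * (1 - sign_poly l ^+ 2)).
    by apply: coneM; [apply: coneC; rewrite invr_ge0|exact: sign_poly_cone].
  by apply: coneD; [exact: coneD|exact: coneM].
rewrite [sign_poly l.+1]/= {1}e; ring.
Qed.

Lemma sign_poly_le1 k v : rnorm (op_eval (sign_poly k) v) <= rnorm v.
Proof.
rewrite (rnorm_le hilb) -op_eval_sa -op_evalM -expr2.
have := cone_ge0 v (sign_poly_cone k); rewrite op_evalD op_evalN -[1]/(1%:P) op_evalC rmorph1 scale1r.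
by rewrite ripDl ripNl subr_ge0.
Qed.

Lemma sign_poly_mono k l v : (k <= l)%N ->
  rp (op_eval (sign_poly k) v) (op_eval (sign_poly k) v) <= rp (op_eval (sign_poly k) v) (op_eval (sign_poly l) v).
Proof.
move=> /sign_poly_gap[c cc ->]; rewrite op_evalD ripDr lerDl mulrC op_evalM -op_eval_sa; exact: cone_ge0.
Qed.

Lemma sign_poly_incr k l v : (k <= l)%N -> rnorm (op_eval (sign_poly k) v) <= rnorm (op_eval (sign_poly l) v).
Proof.
move=> kl; set a := op_eval _ v; set b := op_eval (sign_poly l) v.
have h2 := sign_poly_mono v kl; rewrite -/a -/b -(rnorm_sq hilb) in h2.
have h3 := le_trans h2 (le_trans (ler_norm _) (rip_le hilb _ _)).
case: (eqVneq (rnorm a) 0) => [->|a0]; first exact: rnorm_ge0.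
have a0' : 0 < rnorm a by rewrite lt_def a0 rnorm_ge0.
by rewrite -(ler_pM2l a0') -expr2.
Qed.

Lemma sign_poly_cvg v : cvgn (fun k => op_eval (sign_poly k) v).
Proof.
apply: (@nondecreasing_gap_cvg _ _ _ (fun k => rnorm (op_eval (sign_poly k) v) ^+ 2) (rnorm v ^+ 2)).
  by move=> n; rewrite lerXn2r ?nnegrE ?rnorm_ge0// sign_poly_le1.
move=> k l kl; rewrite !(rnorm_sq hilb) ripDl !ripDr !ripNl !ripNr.
have := sign_poly_mono v kl; rewrite (ripC ip (op_eval (sign_poly l) v) (op_eval (sign_poly k) v)); lra.
Qed.

Definition op_sign v : H := limn (fun k => op_eval (sign_poly k) v).

Lemma op_sign_cvg v : op_eval (sign_poly k) v @[k --> \oo] --> op_sign v.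
Proof. exact: sign_poly_cvg. Qed.

Lemma op_sign_bnd : bounded_op op_sign /\ op_bounded_by op_sign 1.
Proof.
apply: (lim_bounded _ _ ler01 op_sign_cvg).
  by move=> k; exact: (vna_linear hN (op_eval_mem _)).
by move=> k v; rewrite mul1r; exact: sign_poly_le1.
Qed.

Lemma op_sign_mem : N op_sign.
Proof.
apply: (vna_slim hN _ (proj1 op_sign_bnd) op_sign_cvg) => k; exact: op_eval_mem.
Qed.

Lemma op_sign_sa u v : rp (op_sign u) v = rp u (op_sign v).
Proof. by apply: (lim_adjoint hilb _ op_sign_cvg) => k *; exact: op_eval_sa. Qed.

Lemma op_sign_lin : linear op_sign.
Proof. by have [/(bounded_opP _)[]] := op_sign_bnd. Qed.

Lemma op_eval_comm (q : H -> H) p v : linear q ->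
  (forall v, q (h v) = h (q v)) -> q (op_eval p v) = op_eval p (q v).
Proof.
move=> lq qh; elim/poly_ind: p v => [|p c IH] v; first by rewrite !op_eval0 (lin0 lq).
rewrite !op_evalD !op_evalMX !op_evalC -IH -qh addrC.
by rewrite [RHS]addrC; exact: lq.
Qed.

Lemma op_sign_comm (q : H -> H) v : bounded_op q -> (forall v, q (h v) = h (q v)) -> q (op_sign v) = op_sign (q v).
Proof.
move=> [lq cq] qh.
have h2 : q (op_eval (sign_poly k) v) @[k --> \oo] --> q (op_sign v) .
  exact: (continuous_cvg _ (cq _) (@op_sign_cvg v)).
have e : (fun k => q (op_eval (sign_poly k) v)) = fun k => op_eval (sign_poly k) (q v).
  by apply/funext => k; exact: op_eval_comm.
by rewrite e in h2; exact: (cvg_unique _ h2 (@op_sign_cvg (q v))).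
Qed.

(** The recursion [s |-> 3/2 s - 1/2 s^3] passes to the strong limit, which is thus a fixed point.
    So the sign is a partial symmetry, whose square projects on its range. *)
Lemma op_sign_cube v : op_sign (op_sign (op_sign v)) = op_sign v.
Proof.
have lS k := vna_linear hN (op_eval_mem (sign_poly k)).
have c2 := cvg_comp_contraction lS sign_poly_le1 op_sign_cvg (@op_sign_cvg v).
have c3 := cvg_comp_contraction lS sign_poly_le1 op_sign_cvg c2.
have sh1 : op_eval (sign_poly k.+1) v @[k --> \oo] --> op_sign v.
  by have := @op_sign_cvg v; rewrite -(cvg_shiftS (fun k => op_eval (sign_poly k) v)).
have E : (fun k => op_eval (sign_poly k.+1) v) =
    fun k => (1 + 2^-1)%:C *: op_eval (sign_poly k) v - (2^-1)%:C *: op_eval (sign_poly k) (op_eval (sign_poly k) (op_eval (sign_poly k) v)).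
  apply/funext => k; rewrite -!op_evalM -!op_evalZ -op_evalN -op_evalD /=; congr op_eval.
  by rewrite -!mul_polyC polyCD polyC1; ring.
rewrite E in sh1.
have h2 : (1 + 2^-1)%:C *: op_eval (sign_poly k) v - (2^-1)%:C *: op_eval (sign_poly k) (op_eval (sign_poly k) (op_eval (sign_poly k) v))
    @[k --> \oo] --> (1 + 2^-1)%:C *: op_sign v - (2^-1)%:C *: op_sign (op_sign (op_sign v)).
  by apply: cvgB; [exact: cvgZr (@op_sign_cvg v)|exact: cvgZr c3].
have {}h2 : op_sign v = (1 + 2^-1)%:C *: op_sign v - (2^-1)%:C *: op_sign (op_sign (op_sign v)).
  exact: (cvg_unique _ sh1 h2).
apply: (rip_inj hilb) => w; have := congr1 (fun z => rp z w) h2.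
rewrite /= ripDl ripNl !ripZl; lra.
Qed.

(** [h] is the iterate of rank 0, and its product with any later iterate dominates the square of
    [h]. *)
Lemma op_sign_mul_ge0 v : 0 <= rp (h (op_sign v)) v.
Proof.
have h2 := @cvg_rip _ _ _ hilb _ _ (h v) (@op_sign_cvg v).
rewrite sh -(cvg_lim _ h2)//; apply: limr_ge; first exact: cvgP h2.
near=> k; have := sign_poly_mono v (leq0n k); rewrite /= op_evalX (ripC ip (op_eval (sign_poly k) v)).
by apply: le_trans; exact: rip_ge0.
Unshelve. all: by end_near. Qed.

(** The sign kills [f], while the norms of the iterates at [f] increase from that of [h f] towards
    0. *)
Lemma op_sign_ker v : h (v - op_sign (op_sign v)) = 0.
Proof.
set f := v - _; apply: rnorm_eq0; apply/eqP; rewrite eq_le rnorm_ge0 andbT.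
have f0 : op_sign f = 0 by rewrite /f (linB _ _ op_sign_lin) op_sign_cube subrr.
rewrite leNgt; apply/negP => hf.
have /cvg_rnormP/(_ _ hf)[k _ /(_ k (leqnn k))] := @op_sign_cvg f.
rewrite f0 sub0r rnormN ltNge; apply/negP; rewrite negbK.
by have := sign_poly_incr f (leq0n k); rewrite /= op_evalX.
Qed.

End Spectral.

Lemma spectral_projection (R : realType) (H : completeNormedModType R[i])
    (ip : {dot H for @Num.conj R[i]}) (N : set (H -> H)) (h : H -> H) :
  hilbert_norm ip -> von_neumann_algebra ip N -> N h ->
  (forall u v, rip ip (h u) v = rip ip u (h v)) ->
  exists e, [/\ N e, forall v, e (e v) = e v,
    forall u v, rip ip (e u) v = rip ip u (e v),
    forall v, rip ip (h (e v)) (e v) <= 0 /\ 0 <= rip ip (h (v - e v)) (v - e v) &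
    forall q : H -> H, bounded_op q -> (forall v, q (h v) = h (q v)) ->
      forall v, q (e v) = e (q v)].
Proof.
move=> hilb hN Nh sh.
(* The iteration needs a contraction; a positive factor changes neither the signs of the forms nor
   the operators commuting with [h]. *)
wlog h1 : h Nh sh / forall v, rnorm (h v) <= rnorm v.
  move=> W; have /bounded_opP[_ [K [K0 hK]]] := vna_bounded hN Nh.
  pose r := (K + 1)^-1; have r0 : 0 < r by rewrite invr_gt0 ltr_wpDl.
  have [|u v|v|e [Ne ee es eh ec]] := W (r%:C *: h).
  - exact: (vnaZ hN).
  - by rewrite !fctE ripZl ripZr sh.
  - rewrite !fctE rnormZ gtr0_norm// mulrC ler_pdivrMr ?ltr_wpDl//.
    by apply: (le_trans (hK v)); rewrite mulrC ler_wpM2l ?rnorm_ge0// lerDl.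
  exists e; split=> // [v|q bq qh].
    have [] := eh v; rewrite !fctE !ripZl pmulr_rle0// pmulr_rge0//.
  apply: ec => // v; have [lq _] := bq; rewrite !fctE.
  by have := lq r%:C (h v) 0; rewrite (lin0 lq) !addr0 qh.
pose g := op_sign h; have Ng : N g := op_sign_mem hilb hN Nh sh h1.
have lg := vna_linear hN Ng.
have gD u v : g (u + v) = g u + g v := linD u v lg.
have gN v : g (- v) = - g v := linN v lg.
have gZ r v : g (r%:C *: v) = r%:C *: g v := linZ r%:C v lg.
have g3 v : g (g (g v)) = g v := op_sign_cube hilb hN Nh sh h1 v.
have gs u v : rip ip (g u) v = rip ip u (g v) := op_sign_sa hilb hN Nh sh h1 u v.
have hg v : 0 <= rip ip (h (g v)) v := op_sign_mul_ge0 hilb hN Nh sh h1 v.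
have hk v : h (v - g (g v)) = 0 := op_sign_ker hilb hN Nh sh h1 v.
have lh := vna_linear hN Nh.
have hD u v : h (u + v) = h u + h v := linD u v lh.
have hN' v : h (- v) = - h v := linN v lh.
have ext := @rip_inj _ _ _ hilb.
pose k : R[i] := (2^-1 : R)%:C.
(* [g] is 1, 0 and -1 on the positive, null and negative parts of [h], so [P] projects on the first
   and [e] on the other two. *)
pose P v := k *: (g (g v) + g v).
pose e v := v - P v.
have gP v : g (P v) = P v by rewrite /P gZ gD g3 addrC.
have ge v : g (e v) = k *: (g v - g (g v)).
  by apply: ext => w; rewrite /e gD gN gP /P ripDl ripNl !ripZl !ripDl ripNl; lra.
have eE : e = idfun - k *: ((g \o g) + g).
  by apply/funext => v.
exists e; split.
- rewrite eE; apply: (vnaB hN); first exact: (vna_id hN).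
  apply: (vnaZ hN); apply: (vnaD hN) => //; exact: (vna_comp hN).
- move=> v; apply: ext => w.
  rewrite {1}/e /P !ge gZ gD gN g3 ripDl ripNl !ripZl !ripDl !ripZl !ripDl !ripNl; lra.
- move=> u v; rewrite /e /P !ripDl !ripDr !ripNl !ripNr !ripZl !ripZr !ripDl !ripDr !gs; lra.
- move=> v; split; last first.
    by have -> : v - e v = P v; [rewrite /e opprB addrC subrK|rewrite -{1}gP].
  (* Null and negative parts of [e v]: [h] kills [a], and on [b], where [g] is -1, the form of [h]
     has the sign opposite to that in [op_sign_mul_ge0]. *)
  pose a := v - g (g v); pose b := k *: (g (g v) - g v).
  have -> : e v = a + b.
    by apply: ext => w; rewrite /e /P /a /b !ripDl !ripNl !ripZl !ripDl !ripNl; lra.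
  have gb : g b = - b.
    by apply: ext => w; rewrite /b gZ gD gN g3 ripNl !ripZl !ripDl !ripNl; lra.
  have -> : rip ip (h (a + b)) (a + b) = - rip ip (h (g b)) b.
    by rewrite hD hk add0r ripDr sh hk rip0r add0r gb hN' ripNl opprK.
  by rewrite oppr_le0.
- move=> q bq qh v; have qg w : q (g w) = g (q w) := @op_sign_comm _ _ _ hilb _ _ hN Nh sh h1 q w bq qh.
  have [lq _] := bq.
  have qD x y : q (x + y) = q x + q y := linD x y lq.
  have qZ z x : q (z *: x) = z *: q x := linZ z x lq.
  by rewrite /e /P -scaleN1r qD qZ qZ qD !qg scaleN1r.
Qed.

(** * Cuculescu's projections *)

Section Cuculescu.
Context (R : realType) (H : completeNormedModType R[i]).
Variable ip : {dot H for @Num.conj R[i]}.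
Hypothesis hilb : hilbert_norm ip.
Variable M : set (H -> H).
Hypothesis hM : von_neumann_algebra ip M.
Variable tau : (H -> H) -> R[i].
Hypothesis ht : faithful_normal_tracial_state ip M tau.
Implicit Types (u v w : H) (a b q r : H -> H).
Local Notation rp := (rip ip).
Local Notation ad := (adj ip).
Local Notation rtr := (re_trace tau).

Definition proj q := (forall v, q (q v) = q v) /\ (forall u v, rp (q u) v = rp u (q v)).

Lemma projP q : linear q -> proj q -> projection ip q.
Proof.
move=> lq [qq qs]; split; first by apply/funext => v /=.
exact: is_adjointP.
Qed.

Lemma proj_rip q v : proj q -> rp (q v) v = rp (q v) (q v).
Proof. by move=> [qq qs]; rewrite -qs qq. Qed.

Lemma projection_proj q : projection ip q -> proj q.
Proof.
move=> [qq qs]; split=> [v|u v]; last exact: adjoint_rip.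
exact: (congr1 (fun f => f v) qq).
Qed.

Lemma proj_compl q v : proj q -> rp (v - q v) (v - q v) = rp v v - rp (q v) (q v).
Proof.
move=> pq; have := proj_rip v pq.
by rewrite !ripDl !ripDr !ripNl !ripNr opprK (ripC ip v (q v)) => ->; lra.
Qed.

Lemma proj_compl_pos q : M q -> proj q -> pos_op ip (idfun - q).
Proof.
move=> Mq pq; apply: (pos_op_sa hilb hM).
- exact: (vnaB hM (vna_id hM)).
- apply: (adj_eq hilb hM); first exact: (vnaB hM (vna_id hM)).
  by move=> u v; rewrite !fctE/= ripDl ripDr ripNl ripNr pq.2.
- move=> v; rewrite !fctE/= ripDl ripNl (proj_rip v pq) -(proj_compl v pq).
  exact: rip_ge0.
Qed.

Lemma proj_adj q : M q -> proj q -> ad q = q.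
Proof. by move=> Mq [_ qs]; exact: (adj_eq hilb hM). Qed.

Lemma proj_trace_ge0 q z : M q -> proj q -> M z -> 0 <= rtr (q \o (ad z \o z)).
Proof.
move=> Mq pq Mz; have Mz' := adj_mem hilb hM Mz; have Mqz := vna_comp hM Mq Mz'.
have -> : rtr (q \o (ad z \o z)) = rtr (ad (q \o ad z) \o (q \o ad z)).
  rewrite (adj_comp hilb hM Mq Mz') (adjK hilb hM Mz) (proj_adj Mq pq).
  have -> : (z \o q) \o (q \o ad z) = z \o (q \o ad z).
    by apply/funext => v; rewrite /= pq.1.
  by rewrite [RHS](re_traceC ht Mz Mqz).
apply: (re_trace_ge0 ht); last exact: (pos_op_adjM hilb hM).
by apply: (vna_comp hM) => //; exact: (adj_mem hilb hM).
Qed.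

(** [q'] is the part of [q] on which the compression [q Z q] is at most 1. The discarded part [r]
    satisfies [r Z r >= r], and the trace of this is the final Markov inequality. *)
Lemma cuculescu_step (N : set (H -> H)) q Z : von_neumann_algebra ip N -> N `<=` M ->
  N q -> proj q -> N Z -> ad Z = Z ->
  exists q', [/\ N q', proj q', forall v, q (q' v) = q' v /\ q' (q v) = q' v,
    forall v, rp (Z (q' v)) (q' v) <= rp (q' v) (q' v) &
    rtr (q - q') <= rtr ((q - q') \o Z)].
Proof.
move=> hN NM Nq pq NZ sZ; have [qq qs] := pq.
have lq := vna_linear hN Nq; have lZ := vna_linear hN NZ.
have Zs u v : rp (Z u) v = rp u (Z v) by rewrite (rip_adj hilb hM) ?sZ//; exact: NM.
(* This operator commutes with [q], so its spectral projection [e] does too and [e \o q] is a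
   projection. *)
pose h := (q \o Z \o q) - idfun.
have Nh : N h.
  apply: (vnaB hN); last exact: (vna_id hN).
  by apply: (vna_comp hN) => //; exact: (vna_comp hN).
have sh u v : rp (h u) v = rp u (h v).
  by rewrite /h !fctE /= ripDl ripDr ripNl ripNr qs Zs qs.
have qB u v : q (u - v) = q u - q v := linB u v lq.
have qh v : q (h v) = h (q v) by rewrite /h !fctE/= qB !qq.
have [e [Ne ee es eh ec]] := spectral_projection hilb hN Nh sh.
have {}ec := ec q (vna_bounded hN Nq) qh.
have le := vna_linear hN Ne.
pose q' := e \o q.
have hE w : q w = w -> rp (h w) w = rp (Z w) w - rp w w.
  by move=> qw; rewrite /h !fctE/= ripDl ripNl qw qs qw.
have pq' : proj q'.
  by split=> [v|u v]; rewrite /q'/= ?ec ?qq ?ee// es qs -ec.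
have Nq' : N q' by exact: (vna_comp hN).
exists q'; split=> //.
- by move=> v; rewrite /q'/= ec !qq.
- move=> v; have [+ _] := eh (q v); rewrite hE -/(q' v) ?subr_le0//.
  by rewrite ec qq.
have Mr : M (q - q') by apply: NM; exact: (vnaB hN).
have qr v : q (q v - q' v) = q v - q' v by rewrite qB qq /q'/= ec qq.
have rr v : (q - q') ((q - q') v) = (q - q') v.
  have eB u w : e (u - w) = e u - e w := linB u w le.
  by rewrite !fctE qr /q'/= qB eB qq ec qq ee subrr subr0.
have rs u v : rp ((q - q') u) v = rp u ((q - q') v).
  by rewrite !fctE ripDl ripDr ripNl ripNr qs pq'.2.
have MZ := NM _ NZ.
have MrZ := vna_comp hM Mr MZ.
have MrZr : M ((q - q') \o Z \o (q - q')) by exact: (vna_comp hM).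
have -> : rtr ((q - q') \o Z) = rtr ((q - q') \o Z \o (q - q')).
  rewrite (re_traceC ht MrZ Mr); congr rtr; apply/funext => v /=.
  by rewrite rr.
rewrite -subr_ge0 -(re_traceB hM ht MrZr Mr).
apply: (re_trace_ge0 ht); first exact: (vnaB hM).
have pos v : 0 <= rp (((q - q') \o Z \o (q - q')) v - (q - q') v) v.
  have e1 : rp (((q - q') \o Z \o (q - q')) v) v = rp (Z ((q - q') v)) ((q - q') v) := rs _ _.
  have e2 : rp ((q - q') v) v = rp ((q - q') v) ((q - q') v) by rewrite -rs rr.
  rewrite ripDl ripNl e1 e2 -hE; last exact: qr.
  by have [_] := eh (q v); rewrite !fctE /q'/= .
apply: (pos_op_sa hilb hM) => //; first exact: (vnaB hM).
apply: (adj_eq hilb hM); first exact: (vnaB hM).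
move=> u v; rewrite [X in rp X v](_ : _ = ((q - q') \o Z \o (q - q')) u - (q - q') u)//.
rewrite [X in rp u X](_ : _ = ((q - q') \o Z \o (q - q')) v - (q - q') v)//.
by rewrite ripDl ripDr ripNl ripNr /= rs Zs rs [rp ((q - q') u) v]rs.
Qed.

(** The strong limit [p] is the infimum of the [Q n], so [idfun - p] is the supremum of the
    [idfun - Q n], and normality of the state carries the bound [K] over. *)
Lemma projection_limit (Q : nat -> H -> H) (K : R) :
  (forall n, M (Q n)) -> (forall n, proj (Q n)) ->
  (forall n v, Q n (Q n.+1 v) = Q n.+1 v) ->
  (forall n, rtr (idfun - Q n) <= K) ->
  exists p, [/\ M p, projection ip p, forall n v, Q n (p v) = p v &
    rtr (idfun - p) <= K].
Proof.
move=> MQ pQ QS trQ.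
have Qle k l v : (k <= l)%N -> Q k (Q l v) = Q l v.
  elim: l v => [|l IH] v; first by rewrite leqn0 => /eqP ->; exact: (pQ 0%N).1.
  rewrite leq_eqVlt => /predU1P[->|]; first exact: (pQ l.+1).1.
  by rewrite ltnS => kl; rewrite -QS (IH _ kl) QS.
have key k l v : (k <= l)%N -> rp (Q k v) (Q l v) = rp (Q l v) (Q l v).
  by move=> kl; rewrite (pQ k).2 Qle// -[in LHS](Qle l l)// -(pQ l).2.
have Qc v : cvgn (fun n => Q n v).
  apply: (@nondecreasing_gap_cvg _ _ _ (fun n => - rp (Q n v) (Q n v)) 0).
    by move=> n; rewrite oppr_le0 (rip_ge0 hilb).
  move=> k l kl; rewrite (rnorm_sq hilb) ripDl !ripDr !ripNl !ripNr.
  by rewrite (ripC ip (Q l v) (Q k v)) key//; lra.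
pose p v : H := limn (fun n => Q n v).
have Qp v : Q n v @[n --> \oo] --> p v by exact: Qc.
have lQ n := vna_linear hM (MQ n).
have Q1 n v : rnorm (Q n v) <= 1 * rnorm v.
  rewrite mul1r; have := le_trans (ler_norm _) (rip_le hilb (Q n v) v).
  rewrite (proj_rip _ (pQ n)) -(rnorm_sq hilb).
  case: (eqVneq (rnorm (Q n v)) 0) => [->|a0]; first by rewrite rnorm_ge0.
  by rewrite expr2 ler_pM2l// lt_def a0 rnorm_ge0.
have [bp hp] := lim_bounded lQ Q1 ler01 Qp.
have Mp : M p by exact: (vna_slim hM MQ bp Qp).
have ps : forall u v, rp (p u) v = rp u (p v).
  by apply: (lim_adjoint hilb _ Qp) => n; exact: (pQ n).2.
have Qnp n v : Q n (p v) = p v.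
  have c1 : Q n (Q m v) @[m --> \oo] --> Q n (p v).
    have [_ cQ] := vna_bounded hM (MQ n).
    exact: (continuous_cvg _ (cQ _) (Qp v)).
  have c2 : Q n (Q m v) @[m --> \oo] --> p v.
    apply: cvg_trans (Qp v); apply: near_eq_cvg; near=> m.
    by rewrite Qle//; near: m; exact: nbhs_infty_ge.
  exact: (cvg_unique _ c1 c2).
have pp v : p (p v) = p v.
  have := Qp (p v); have -> : (fun n => Q n (p v)) = fun=> p v by apply/funext => n; exact: Qnp.
  by move=> c1; exact: (cvg_unique _ c1 (cvg_cst _)).
have prp : proj p by split.
have pQp q : M q -> proj q -> M (idfun - q) /\ pos_op ip (idfun - q).
  by move=> Mq qp; split; [exact: (vnaB hM (vna_id hM))|exact: proj_compl_pos].
exists p; split=> //; first by apply: projP => //; exact: (vna_linear hM).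
pose A := [set a | exists n, a = idfun - Q n].
have le_opP a b : M a -> M b -> ad a = a -> ad b = b ->
    (forall v, rp (a v) v <= rp (b v) v) -> le_op ip a b.
  move=> Ma Mb sa sb ab; apply: (pos_op_sa hilb hM).
  - exact: (vnaB hM).
  - by rewrite (adjD hilb hM Mb (vnaN hM Ma)) (adjN hilb hM Ma) sa sb.
  - by move=> v; rewrite !fctE ripDl ripNl subr_ge0.
have saq q : M q -> proj q -> ad (idfun - q) = idfun - q.
  by move=> Mq qp; have [M1 P1] := pQp q Mq qp; exact: (pos_op_adj hilb hM).
have pQle n v : rp (p v) v <= rp (Q n v) v.
  have := rip_ge0 hilb (Q n v - p v).
  have e : rp (Q n v) (p v) = rp (p v) v by rewrite (pQ n).2 Qnp (ripC ip).
  rewrite !ripDl !ripDr !ripNl !ripNr opprK (ripC ip (p v) (Q n v)) e.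
  by rewrite -(proj_rip _ prp) -(proj_rip _ (pQ n)); lra.
have Qmono k l v : (k <= l)%N -> rp (Q l v) v <= rp (Q k v) v.
  move=> kl; have := rip_ge0 hilb (Q k v - Q l v).
  rewrite !ripDl !ripDr !ripNl !ripNr opprK (ripC ip (Q l v) (Q k v)) key//.
  by rewrite -!(proj_rip _ (pQ _)); lra.
have M1 q : M q -> M (idfun - q) by move=> Mq; apply: (vnaB hM) => //; exact: (vna_id hM).
have le1 q r : M q -> M r -> proj q -> proj r -> (forall v, rp (r v) v <= rp (q v) v) ->
    le_op ip (idfun - q) (idfun - r).
  move=> Mq Mr q_ r_ h; apply: le_opP; [exact: M1|exact: M1|exact: saq|exact: saq|].
  by move=> v; rewrite !fctE/= !ripDl !ripNl lerD2l lerN2.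
have nrm := state_normal ht.
have [|||_ _ lub] := nrm A (idfun - p).
- by move=> _ [n ->]; apply: pQp.
- split; first by exists (idfun - Q 0%N), 0%N.
  move=> _ _ [k ->] [l ->]; exists (idfun - Q (maxn k l)); split; first by exists (maxn k l).
    by apply: le1 => // v; apply: Qmono; exact: leq_maxl.
  by apply: le1 => // v; apply: Qmono; exact: leq_maxr.
- split; first exact: M1.
    by move=> _ [n ->]; exact: le1.
  move=> r Mr hr.
  have Q0p := hr _ (ex_intro _ 0%N erefl).
  (* A competing upper bound is any element of [M]; it is self-adjoint because it differs from
     [idfun - Q 0] by a positive operator. *)
  have sr : ad r = r.
    have Mr1 := vnaB hM Mr (M1 _ (MQ 0%N)).
    have := pos_op_adj hilb hM Mr1 Q0p.
    rewrite (adjD hilb hM Mr (vnaN hM (M1 _ (MQ 0%N)))) (adjN hilb hM (M1 _ (MQ 0%N))) saq//.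
    exact: addIr.
  apply: le_opP => //; [exact: M1|exact: saq|move=> v].
  rewrite !fctE/= ripDl ripNl.
  have c1 := @cvg_rip _ _ _ hilb _ _ v (Qp v).
  rewrite lerBlDr -lerBlDl -(cvg_lim _ c1)//; apply: limr_ge; first exact: cvgP c1.
  near=> n; have := hr _ (ex_intro _ n erefl) v; rewrite lecE => /andP[_].
  rewrite -/(rp _ _) !fctE/= !ripDl !ripNl ripDl ripNl opprD opprK; lra.
have tauE q : M q -> proj q -> tau (idfun - q) = (rtr (idfun - q))%:C.
  by move=> Mq qp; have [m pos] := pQp q Mq qp; exact: (tau_pos_real ht).
have := lub K%:C I; rewrite tauE// lecR; apply=> _ [_ [n ->] <-].
by rewrite tauE// lecR.
Unshelve. all: by end_near. Qed.

Variables (Mn : nat -> set (H -> H)) (E : nat -> (H -> H) -> (H -> H)).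
Hypothesis hF : filtration ip M Mn.
Hypothesis hE : forall n, normal_cond_exp ip M (Mn n) tau (E n).

(* Cuculescu's construction for several positive operators [b k = |z k|^2] at
   once: at time [n] only the martingale generated by [b (kk n)] is tested, so a
   single decreasing sequence of projections serves all of them. *)
Lemma cuculescu (z : nat -> H -> H) (act : nat -> bool) (kk : nat -> nat) (eps : R) :
  let b k := ad (z k) \o z k in
  (forall k, M (z k)) -> (forall K, \sum_(k < K) rtr (b k) <= eps) ->
  exists p, [/\ M p, projection ip p, rtr (idfun - p) <= eps &
    forall n v, act n -> rp (E n (b (kk n)) (p v)) (p v) <= rp (p v) (p v)].
Proof.
move=> b Mz sumb.
have hMn n := filtration_vna hF n.
have MnM n := @filtration_sub _ _ _ _ _ hF n.
have Mb k : M (b k) by apply: (vna_comp hM) => //; exact: (adj_mem hilb hM).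
pose Z n := if act n then E n (b (kk n)) else 0.
have NZ n : Mn n (Z n) /\ ad (Z n) = Z n.
  rewrite /Z; case: ifP => _; last first.
    split; first exact: (vna0 (hMn n)).
    by apply: (adj_eq hilb hM); [exact: (vna0 hM)|move=> u v; rewrite rip0l rip0r].
  by have [] := cond_sq_pos hilb hM hF hE n (Mz (kk n)).
pose good n q q' := [/\ Mn n q', proj q', forall v, q (q' v) = q' v /\ q' (q v) = q' v,
    forall v, rp (Z n (q' v)) (q' v) <= rp (q' v) (q' v) &
    rtr (q - q') <= rtr ((q - q') \o Z n)].
have step (nq : nat * (H -> H)) : exists q', Mn nq.1 nq.2 -> proj nq.2 -> good nq.1 nq.2 q'.
  case: (pselect (Mn nq.1 nq.2 /\ proj nq.2)) => [[h1 h2]|h]; last first.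
    by exists idfun => h1 h2; case: h.
  have [NZn sZn] := NZ nq.1.
  have [q' hq'] := cuculescu_step (hMn nq.1) (@MnM nq.1) h1 h2 NZn sZn.
  by exists q'.
have [f hf] := choice step.
pose Q := fix Q n := if n is n'.+1 then f (n', Q n') else idfun.
have QP n : Mn n (Q n) /\ proj (Q n).
  elim: n => [|n [h1 h2]]; first by split; [exact: (vna_id (hMn 0%N))|].
  by have [? ? _ _ _] := hf (n, Q n) h1 h2; split=> //; exact: (filtration_incr hF).
have Qgood n : good n (Q n) (Q n.+1) by have [h1 h2] := QP n; exact: (hf (n, Q n) h1 h2).
have MQ n : M (Q n) by apply: (MnM n); exact: (QP n).1.
have Mi := vna_id hM.
have trQ T : rtr (idfun - Q T) <= eps.
  (* Only the finitely many indices tested before time [T] enter. *)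
  pose K := (\max_(n < T) kk n).+1.
  have kK n : (n < T)%N -> (kk n < K)%N.
    by move=> nT; rewrite ltnS (leq_bigmax (Ordinal nT)).
  (* Potential argument: in one step the first term grows by [rtr r], and the sum decreases by at
     least as much. *)
  suff: forall n, (n <= T)%N ->
      rtr (idfun - Q n) + \sum_(k < K) rtr (Q n \o b k) <= \sum_(k < K) rtr (b k).
    move=> /(_ T (leqnn T)) h; apply: le_trans (sumb K); apply: le_trans h.
    rewrite lerDl sumr_ge0// => k _; exact: (proj_trace_ge0 (MQ T) (QP T).2).
  elim=> [_|n IH nT].
    by rewrite /= subrr /re_trace (tau0 hM ht)/= add0r.
  have [Nq' pq' qq' _ trq] := Qgood n.
  set q := Q n in qq' trq IH *; set q' := Q n.+1 in Nq' pq' qq' trq *.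
  pose r := q - q'.
  have [Mq Mq'] : M q /\ M q' by split; exact: MQ.
  have Mr : M r by exact: (vnaB hM).
  have Nr : Mn n r by apply: (vnaB (hMn n)) => //; exact: (QP n).1.
  have pq : proj q := (QP n).2.
  have pr : proj r.
    split=> [v|u v]; last by rewrite /r !fctE ripDl ripDr ripNl ripNr pq.2 pq'.2.
    rewrite /r !fctE (linB _ _ (vna_linear hM Mq)) (linB _ _ (vna_linear hM Mq')).
    by rewrite pq.1 pq'.1 (qq' v).1 (qq' v).2 subrr subr0.
  have e1 : rtr (idfun - q') = rtr (idfun - q) + rtr r.
    by rewrite !(re_traceB hM ht)//; ring.
  have e2 k : rtr (q' \o b k) = rtr (q \o b k) - rtr (r \o b k).
    have -> : r \o b k = (q \o b k) - (q' \o b k) by apply/funext => v.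
    have Mqb := vna_comp hM Mq (Mb k); have Mqb' := vna_comp hM Mq' (Mb k).
    by rewrite (re_traceB hM ht Mqb Mqb'); ring.
  have rle : rtr r <= \sum_(k < K) rtr (r \o b k).
    apply: (le_trans trq); rewrite /Z; case: ifP => an; last first.
      have -> : (r \o (0 : H -> H)) = 0.
        by apply/funext => v; rewrite /= (lin0 (vna_linear hM Mr)).
      rewrite /re_trace (tau0 hM ht)/=; apply: sumr_ge0 => k _; exact: proj_trace_ge0.
    have kn := kK n nT.
    rewrite (re_trace_cond_exp hM hF hE Nr (Mb _)) (bigD1 (Ordinal kn))//= lerDl.
    by apply: sumr_ge0 => k _; exact: proj_trace_ge0.
  have e3 : \sum_(k < K) rtr (q' \o b k) =
      \sum_(k < K) rtr (q \o b k) - \sum_(k < K) rtr (r \o b k).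
    by rewrite -sumrB; apply: eq_bigr => k _; exact: e2.
  have := IH (ltnW nT); rewrite e1 e3; lra.
have QS n v : Q n (Q n.+1 v) = Q n.+1 v by have [_ _ /(_ v)[]] := Qgood n.
have [p [Mp pp Qp trp]] := projection_limit MQ (fun n => (QP n).2) QS trQ.
exists p; split=> // n v an.
have [_ _ _ h _] := Qgood n; have := h (p v).
by rewrite Qp /Z an.
Qed.

End Cuculescu.

(** * Operator inequalities used inside one block *)

Section Inequalities.
Context (R : realType) (H : completeNormedModType R[i]).
Variable ip : {dot H for @Num.conj R[i]}.
Hypothesis hilb : hilbert_norm ip.
Variable M : set (H -> H).
Hypothesis hM : von_neumann_algebra ip M.
Variable tau : (H -> H) -> R[i].
Hypothesis ht : faithful_normal_tracial_state ip M tau.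
Implicit Types (u v w : H) (a b q r : H -> H).
Local Notation rp := (rip ip).
Local Notation ad := (adj ip).
Local Notation rtr := (re_trace tau).

Lemma opnorm_pos_le a b : M a -> M b -> ad a = a ->
  (forall v, 0 <= rp (a v) v) -> (forall v, rp (a v) v <= rp (b v) v) ->
  opnorm a <= opnorm b.
Proof.
move=> Ma Mb sa pa ab; have la := vna_linear hM Ma.
have [K0 _] := opnorm_bnd (vna_bounded hM Mb).
have as_ u v : rp (a u) v = rp u (a v) by rewrite (rip_adj hilb hM _ _ Ma) sa.
have key e : 0 < e -> opnorm a <= opnorm b + e.
  move=> e0; set K := opnorm b + e; have K0' : 0 < K by rewrite ltr_wpDl.
  have aK v : rp (a v) v <= K * rp v v.
    apply: (le_trans (ab v)); apply: le_trans (rip_opnorm hilb hM _ Mb) _.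
    by rewrite ler_wpM2r ?(rip_ge0 hilb)// lerDl ltW.
  apply: opnorm_le => [|v]; first exact: ltW.
  rewrite (rnorm_leM hilb) ?(ltW K0')//.
  have h1 := aK (a v).
  (* Expanding the form of [a] at [K v - a v], and using [a <= K] at [a v], yields [a^2 <= K a];
     this avoids the square root of [a]. *)
  have h2 := pa (K%:C *: v - a v).
  have := aK v.
  move: h2; rewrite (linB _ _ la) (linZ _ _ la) !ripDl !ripDr !ripNl !ripNr.
  rewrite !ripZl !ripZr (as_ (a v) v) => h2 h3.
  have h4 : K * rp (a v) (a v) <= K * (K * rp (a v) v).
    by nra.
  rewrite ler_pM2l// in h4; apply: (le_trans h4).
  by rewrite expr2 -mulrA ler_wpM2l ?(ltW K0').
by rewrite leNgt; apply/negP => h; have := key ((opnorm a - opnorm b) / 2); lra.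
Qed.

Lemma iter_sa a n u v : (forall u v, rp (a u) v = rp u (a v)) ->
  rp (iter n a u) v = rp u (iter n a v).
Proof. by move=> sa; elim: n u v => [//|n IH] u v; rewrite iterSr IH sa -iterS. Qed.

Lemma abs_sa x u w : M x -> rp ((ad x \o x) u) w = rp u ((ad x \o x) w).
Proof.
move=> Mx; rewrite /= -(rip_adjr hilb hM _ _ Mx) (ripC ip u).
by rewrite -(rip_adjr hilb hM _ _ Mx) (ripC ip).
Qed.

Lemma abs_pow_ge0 x n v : M x -> 0 <= rp (iter n (ad x \o x) v) v.
Proof.
move=> Mx; set a := ad x \o x.
have sa u w : rp (a u) w = rp u (a w) := abs_sa u w Mx.
rewrite -(odd_double_half n) -addnn; case: (odd n).
  by rewrite addnCA iterD iter_sa// iterS /a /= -(rip_adjr hilb hM _ _ Mx) (rip_ge0 hilb).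
by rewrite add0n iterD iter_sa// (rip_ge0 hilb).
Qed.

(** A convex sequence that rises at its first step rises forever. *)
Lemma convex_le (nu : nat -> R) j : (forall i, 0 <= nu i) ->
  (forall i, 2 * nu i.+1 <= nu i + nu i.+2) -> (0 < j)%N -> nu 1 <= nu 0 + nu j.
Proof.
move=> pos conv j0; case: (leP (nu 1) (nu 0)) => [h|h].
  by rewrite (le_trans h)// lerDl.
have inc i : nu i <= nu i.+1.
  by elim: i => [|i IH]; [exact: ltW|have := conv i; lra].
suff : nu 1 <= nu j by have := pos 0%N; lra.
by case: j j0 => // j _; elim: j => [//|j IH]; apply: le_trans IH _.
Qed.

(** Operator form of [s <= 1 + s ^ j] for [s = a / c]. The sequence [nu] is convex because its
    second difference is the form of [(a / c) ^ i] at [v - a v / c]. *)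
Lemma abs_pow_le x (c : R) j v : M x -> 0 < c -> (0 < j)%N ->
  rp ((ad x \o x) v) v <= c * rp v v + c / c ^+ j * rp (iter j (ad x \o x) v) v.
Proof.
move=> Mx c0 j0; set a := ad x \o x.
have la : linear a by apply: (vna_linear hM); apply: (vna_comp hM) => //; exact: adj_mem.
have sa u w : rp (a u) w = rp u (a w) := abs_sa u w Mx.
pose nu i := c^-1 ^+ i * rp (iter i a v) v.
have h : nu 1 <= nu 0 + nu j.
  apply: convex_le => // i.
    by rewrite mulr_ge0 ?exprn_ge0 ?invr_ge0 ?(ltW c0)//; exact: abs_pow_ge0.
  pose u := v - (c^-1)%:C *: a v.
  have li : linear (iter i a).
    apply: (vna_linear hM); apply/(vna_iter hM)/(vna_comp hM) => //; exact: adj_mem.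
  have : 0 <= c^-1 ^+ i * rp (iter i a u) u.
    by rewrite mulr_ge0 ?exprn_ge0 ?invr_ge0 ?(ltW c0)//; exact: abs_pow_ge0.
  rewrite /u (linB _ _ li) (linZ _ _ li) !ripDl !ripDr !ripNl !ripNr !ripZl !ripZr.
  have e1 : rp (iter i a (a v)) v = rp (iter i.+1 a v) v by rewrite iterSr.
  have e2 : rp (iter i a v) (a v) = rp (iter i.+1 a v) v by rewrite -sa.
  have e3 : rp (iter i a (a v)) (a v) = rp (iter i.+2 a v) v by rewrite -iterSr -sa.
  rewrite e1 e2 e3 /nu [c^-1 ^+ i.+2]exprS [c^-1 ^+ i.+1]exprS.
  by set A := c^-1; set X := A ^+ i; nra.
move: h; rewrite /nu expr0 mul1r expr1 /= exprVn => h.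
have : c * (c^-1 * rp (a v) v) <= c * (rp v v + (c ^+ j)^-1 * rp (iter j a v) v).
  by rewrite ler_pM2l.
by rewrite mulrA mulfV ?gt_eqF// mul1r mulrDr mulrA.
Qed.

Variables (Mn : nat -> set (H -> H)) (E : nat -> (H -> H) -> (H -> H)).
Hypothesis hF : filtration ip M Mn.
Hypothesis hE : forall n, normal_cond_exp ip M (Mn n) tau (E n).
Let hMn n : von_neumann_algebra ip (Mn n) := filtration_vna hF n.
Let MnM n a : Mn n a -> M a := @filtration_sub _ _ _ _ _ hF n a.

(** Testing against the adjoint of the difference [z] shows that [ad z \o z] has trace 0, and the
    state is faithful. *)
Lemma cond_exp_uniq n a b : M a -> Mn n b ->
  (forall c, Mn n c -> rtr (c \o a) = rtr (c \o b)) -> E n a = b.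
Proof.
move=> Ma Nb h; pose z := E n a - b.
have NE := cond_exp_mem (hE n) Ma.
have Nz : Mn n z by exact: (vnaB (hMn n)).
have Nz' := adj_mem hilb (hMn n) Nz.
have [Mz' ME Mb] := And3 (MnM Nz') (MnM NE) (MnM Nb).
have e : rtr (ad z \o z) = 0.
  have -> : ad z \o z = (ad z \o E n a) - (ad z \o b).
    by apply/funext => v; rewrite /= !fctE (linB _ _ (vna_linear hM Mz')).
  rewrite (re_traceB hM ht (vna_comp hM Mz' ME) (vna_comp hM Mz' Mb)).
  by rewrite (re_trace_cond_exp hM hF hE Nz' Ma) h// subrr.
have Mz := MnM Nz; have Mzz := vna_comp hM Mz' Mz.
have pz := pos_op_adjM hilb hM Mz.
have z0 : ad z \o z = 0.
  by apply: (state_faithful ht) => //; rewrite (tau_pos_real ht)// e.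
apply/funext => v; apply/eqP; rewrite -subr_eq0; apply/eqP/(rip_eq0 hilb).
have := congr1 (fun f => rp (f v) v) z0.
by rewrite /= -(rip_adjr hilb hM _ _ Mz) rip0l.
Qed.

Variable x : nat -> H -> H.
Hypothesis hx : martingale Mn E x.

Lemma mart_incr_trace n m c : (n <= m)%N -> Mn n c -> rtr (c \o x m) = rtr (c \o x n).
Proof.
elim: m => [|m IH]; first by rewrite leqn0 => /eqP ->.
rewrite leq_eqVlt => /predU1P[->//|]; rewrite ltnS => nm Nc.
rewrite -(IH nm Nc).
have Nmc : Mn m c.
  have mono i : (n <= i)%N -> Mn i c.
    elim: i => [|i IHi]; first by rewrite leqn0 => /eqP <-.
    by rewrite leq_eqVlt => /predU1P[<-//|]; rewrite ltnS => /IHi; exact: (filtration_incr hF).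
  exact: mono.
have Mx := MnM (mart_mem hx m.+1).
by rewrite -(re_trace_cond_exp hM hF hE Nmc Mx) (proj2 (hx m)).
Qed.

(** Expand [E n (|x m - x n|^2) >= 0]: by the bimodule property both cross terms become [|x n|^2].
    The values of [E n] at [x m] and at its adjoint come from [cond_exp_uniq]. *)
Lemma mart_abs_le n m w : (n <= m)%N ->
  rp (x n w) (x n w) <= rp (E n (ad (x m) \o x m) w) w.
Proof.
move=> nm.
have [Nn Mm] := (mart_mem hx n, MnM (mart_mem hx m)); have Mx := MnM Nn.
have E1 : E n (x m) = x n.
  by apply: cond_exp_uniq => // c Nc; exact: mart_incr_trace.
have Mm' := adj_mem hilb hM Mm; have Mx' := adj_mem hilb hM Mx.
have Nn' := adj_mem hilb (hMn n) Nn.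
have E2 : E n (ad (x m)) = ad (x n).
  apply: cond_exp_uniq => // c Nc; have Mc := MnM Nc.
  have Mc' := adj_mem hilb hM Mc.
  rewrite (re_traceC ht Mc Mm') (re_traceC ht Mc Mx').
  rewrite -(re_trace_adj hilb hM ht (vna_comp hM Mm' Mc)) -(re_trace_adj hilb hM ht (vna_comp hM Mx' Mc)).
  rewrite (adj_comp hilb hM Mm' Mc) (adj_comp hilb hM Mx' Mc) (adjK hilb hM Mm) (adjK hilb hM Mx).
  by apply: mart_incr_trace => //; exact: adj_mem.
pose y := x m - x n; have My : M y by exact: (vnaB hM).
have := cond_exp_pos (hE n) (vna_comp hM (adj_mem hilb hM My) My) (pos_op_adjM hilb hM My) w.
have lin (c : R[i]) a b := @cond_exp_linear _ _ _ _ _ _ _ (hE n) c a b.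
have Ma := vna_comp hM Mm' Mm; have Mmx := vna_comp hM Mm' Mx.
have Mxm := vna_comp hM Mx' Mm; have Mxx := vna_comp hM Mx' Mx.
have -> : ad y \o y = (-1) *: (ad (x m) \o x n) + ((-1) *: (ad (x n) \o x m) +
    (1 *: (ad (x m) \o x m) + (ad (x n) \o x n))).
  apply/funext => v; apply: (rip_inj hilb) => u.
  rewrite /y (adjD hilb hM Mm (vnaN hM Mx)) (adjN hilb hM Mx) /= !fctE !scaleN1r scale1r /=.
  rewrite (linB _ _ (vna_linear hM Mm')) (linB _ _ (vna_linear hM Mx')).
  rewrite !ripDl !ripNl !ripDl !ripNl; lra.
have M1 := vnaD hM (vnaZ hM 1 Ma) Mxx; have M2 := vnaD hM (vnaZ hM (-1) Mxm) M1.
rewrite !lin//.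
have -> : E n (ad (x m) \o x n) = ad (x n) \o x n.
  have := cond_exp_bimodule (hE n) (vna_id (hMn n)) Mm' Nn.
  by rewrite E2.
have -> : E n (ad (x n) \o x m) = ad (x n) \o x n.
  by rewrite (cond_exp_l hF hE Nn' Mm) E1.
have -> : E n (ad (x n) \o x n) = ad (x n) \o x n.
  by apply: (cond_exp_id (hE n)); exact: (vna_comp (hMn n)).
rewrite lecE => /andP[_]; rewrite -/(rip _ _ _) !fctE !scaleN1r scale1r.
rewrite !ripDl !ripNl /= -(rip_adjr hilb hM _ _ Mx); lra.
Qed.

End Inequalities.

(** * Estimates for the iterated logarithm *)

Section IteratedLog.
Variable R : realType.
Implicit Types (a b t e s : R).

Lemma LL_ge1 t : 1 <= LL t.
Proof. by rewrite /LL; case: ifP => // _; rewrite le_max lexx. Qed.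

Lemma LL_gt0 t : 0 < LL t.
Proof. exact: lt_le_trans ltr01 (LL_ge1 t). Qed.

Lemma ln_le_pred t : 0 < t -> ln t <= t - 1.
Proof. by move=> t0; have := expR_ge1Dx (ln t); rewrite lnK ?posrE//; lra. Qed.

Lemma lnln_le_LL t : 1 < t -> ln (ln t) <= LL t.
Proof. by move=> t1; rewrite /LL t1 le_max lexx orbT. Qed.

Lemma LL_cases t : LL t = 1 \/ [/\ 1 < t, 1 < ln t & LL t = ln (ln t)].
Proof.
rewrite /LL; case: ifP => [t1|_]; last by left.
case: (leP (ln (ln t)) 1) => [_|h]; first by left.
right; split=> //; rewrite ltNge; apply/negP => l1.
have : ln (ln t) <= 0 by exact: ln_le0.
by lra.
Qed.

Lemma LL_mono a b : a <= b -> LL a <= LL b.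
Proof.
move=> ab; case: (LL_cases a) => [->|[a1 la1 ->]]; first exact: LL_ge1.
have b1 := lt_le_trans a1 ab.
apply: le_trans (lnln_le_LL b1).
have a0 : 0 < a by lra. have b0 : 0 < b by lra.
have lab : ln a <= ln b by rewrite ler_ln ?posrE.
by rewrite ler_ln ?posrE//; lra.
Qed.

(** Carries the bound on a difference from its own [s2] to the larger scale [T] of a block. All
    comparisons rest on [ln y <= y - 1]. *)
Lemma LL_ratio a b : 0 <= a -> a <= b -> a * LL b <= b * LL a.
Proof.
move=> a0 ab; case: (LL_cases b) => [->|[b1 lb1 lbE]].
  by rewrite mulr1 (le_trans ab)// ler_peMr ?LL_ge1// (le_trans a0).
case: (leP (ln a) 1) => la.
  have la1 : a <= expR 1.
    case: (ltP 0 a) => a0'; last by rewrite (le_trans a0') ?expR_ge0.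
    by rewrite -[a]lnK ?posrE// ler_expR.
  have h1 : LL b <= ln b - 1 by rewrite lbE; apply: ln_le_pred; lra.
  have h2 : ln b - 1 <= b / expR 1 - 1.
    have b0 : 0 < b by lra.
    have := ln_le_pred (divr_gt0 b0 (expR_gt0 1)).
    by rewrite ln_div ?posrE ?expR_gt0// expRK.
  have b0 : 0 <= b by lra.
  have h3 : a * LL b <= expR 1 * (b / expR 1).
    by apply: ler_pM => //; [exact: ltW (LL_gt0 b)|lra].
  rewrite mulrCA mulfV ?mulr1 ?gt_eqF ?expR_gt0// in h3.
  by apply: (le_trans h3); rewrite ler_peMr// LL_ge1.
have a1 : 1 < a.
  by rewrite ltNge; apply/negP => a1; have := ln_le0 a1; lra.
have q0 : 0 < b / a by rewrite divr_gt0; lra.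
have h1 : ln (ln b) <= ln (ln a) + (b / a - 1).
  have -> : ln b = ln a * (1 + ln (b / a) / ln a).
    by rewrite ln_div ?posrE; [field; rewrite gt_eqF//; lra|lra|lra].
  have r0 : 0 <= ln (b / a) / ln a.
    by rewrite divr_ge0 ?ln_ge0 ?ler_pdivlMr; lra.
  rewrite lnM ?posrE; [|lra|lra]; rewrite lerD2l.
  have := @ln_le_pred (1 + ln (b / a) / ln a); rewrite ltr_wpDr// => /(_ isT) h2.
  apply: (le_trans h2); rewrite addrC addKr.
  apply: le_trans (ln_le_pred q0).
  by rewrite ler_pdivrMr ?ler_peMr ?ln_ge0 ?ler_pdivlMr; lra.
have h2 := lnln_le_LL a1; have h3 := LL_ge1 a.
have h4 : a * LL b <= a * (LL a + (b / a - 1)).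
  by rewrite ler_wpM2l// lbE; lra.
apply: (le_trans h4).
have -> : a * (LL a + (b / a - 1)) = a * LL a + (b - a) by field; rewrite gt_eqF//; lra.
by nra.
Qed.

Lemma LL_le_sqrt t : 1 <= t -> LL t <= 3 * Num.sqrt t.
Proof.
move=> t1; have r1 : 1 <= Num.sqrt t by rewrite -sqrtr1 ler_wsqrtr.
case: (LL_cases t) => [->|[_ l1 ->]]; first lra.
have h1 : ln (ln t) <= ln t - 1 by apply: ln_le_pred; lra.
have h2 : ln t <= 2 * (Num.sqrt t - 1).
  rewrite -{1}(@sqr_sqrtr _ t); last lra.
  rewrite lnXn; last lra.
  rewrite -[leLHS]mulr_natl.
  by rewrite ler_pM2l//; apply: ln_le_pred; lra.
lra.
Qed.

Lemma ln_gt0_geom (eta : R) : 0 < eta -> 0 < ln (1 + eta).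
Proof. by move=> h; apply: ln_gt0; lra. Qed.

Lemma ln_geom (eta : R) k : 0 < eta -> ln ((1 + eta) ^+ k) = k%:R * ln (1 + eta).
Proof. by move=> h; rewrite lnXn ?mulr_natl//; lra. Qed.

Lemma geom_gt1 (eta : R) k : 0 < eta -> (0 < k)%N -> 1 < (1 + eta) ^+ k.
Proof. by move=> h k0; rewrite exprn_egt1 ?gt_eqF// -?lt0n//; lra. Qed.

(** From [k] to [k.+1] the logarithm grows by the factor [1 + 1 / k], so its logarithm grows by at
    most [eta], and [LL] is at least 1. *)
Lemma LL_geom (eta : R) k : 0 < eta -> (0 < k)%N -> eta^-1 <= k%:R ->
  LL ((1 + eta) ^+ k.+1) <= (1 + eta) * LL ((1 + eta) ^+ k).
Proof.
move=> h k0 hk; have k0' : (0 : R) < k%:R by rewrite ltr0n.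
have t0 := ln_gt0_geom h.
have LL1 := LL_ge1 ((1 + eta) ^+ k).
case: (LL_cases ((1 + eta) ^+ k.+1)) => [->|[_ _ ->]]; first nra.
have h1 := lnln_le_LL (geom_gt1 h k0).
rewrite !ln_geom// in h1 *.
have e : k.+1%:R * ln (1 + eta) = (k%:R * ln (1 + eta)) * (1 + k%:R^-1).
  by rewrite -natr1; field; rewrite gt_eqF.
have k1 : k%:R^-1 <= eta by rewrite -[eta]invrK lef_pV2 ?posrE ?invr_gt0.
have k2 : 0 < k%:R^-1 :> R by rewrite invr_gt0.
rewrite e lnM ?posrE; [|exact: mulr_gt0|lra].
have p0 : 0 < 1 + k%:R^-1 :> R by lra.
have := ln_le_pred p0; nra.
Qed.

(** Stirling up to a factor of order [sqrt n]; the induction step is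
    [(m / (m + 1)) ^ (m + 1) <= 1 / e]. *)
Lemma fact_le n : (0 < n)%N ->
  n`!%:R <= n%:R * n%:R ^+ n * expR (1 - n%:R) :> R.
Proof.
case: n => // n _; elim: n => [|n IH].
  by rewrite !mul1r subrr expR0.
rewrite factS natrM.
apply: (le_trans (ler_wpM2l (ler0n _ _) IH)).
set m := n.+1 in IH *; have m0 : (0 : R) < m%:R by rewrite ltr0n.
have M0 : (0 : R) < m.+1%:R by rewrite ltr0n.
have key : (m%:R / m.+1%:R) ^+ m.+1 <= expR (- 1) :> R.
  have -> : (- 1 : R) = m.+1%:R * (- m.+1%:R^-1).
    by rewrite mulrN mulfV// gt_eqF.
  rewrite expRM_natl lerXn2r ?nnegrE ?expR_ge0 ?divr_ge0//.
  apply: le_trans (expR_ge1Dx _).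
  by rewrite ler_pdivrMr// mulrDl mulNr mulVf ?gt_eqF// mul1r -natr1 addrK.
have -> : expR (1 - m.+1%:R) = expR (1 - m%:R) * expR (- 1) :> R.
  by rewrite -expRD -natr1; congr expR; ring.
rewrite [leRHS](_ : _ = m.+1%:R * expR (1 - m%:R) * (m.+1%:R ^+ m.+1 * expR (-1))); last by ring.
rewrite [leLHS](_ : _ = m.+1%:R * expR (1 - m%:R) * (m%:R ^+ m.+1)); last by rewrite exprS; ring.
rewrite ler_wpM2l ?mulr_ge0 ?expR_ge0//.
by rewrite mulrC -ler_pdivrMr ?exprn_gt0// -expr_div_n.
Qed.

(** By [fact_le] the numerator is at most [2 * j * e * (2 * j) ^ (2 * j) * expR (- j)], and the
    power of [2 * j] cancels against the denominator. Of the gain [(1 + eta) ^ (- j)], one half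
    absorbs the factor [2 * j] and the other improves the exponent beyond 1. *)
Lemma moment_term_le (eta L : R) j : 0 < eta -> 1 <= L -> L <= j%:R -> j%:R <= L + 2 ->
  (2 * j)`!%:R * expR j%:R / (4 * j%:R * (1 + eta) * L) ^+ j <=
  4 * expR 7 / ln (1 + eta) * expR (- (1 + ln (1 + eta) / 2) * L).
Proof.
move=> h L1 Lj jL; set th := ln (1 + eta); have th0 : 0 < th := ln_gt0_geom h.
have j0 : (0 : R) < j%:R by lra.
have jn : (0 < 2 * j)%N by rewrite muln_gt0/= -(ltr0n R).
have D0 : 0 < (4 * j%:R * (1 + eta) * L) ^+ j by rewrite exprn_gt0// !mulr_gt0//; lra.
rewrite ler_pdivrMr//.
apply: (le_trans (ler_wpM2r (expR_ge0 _) (fact_le jn))).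
have e1 : (4 * j%:R * (1 + eta) * L) ^+ j =
    (2 * j)%:R ^+ (2 * j) * (L / j%:R) ^+ j * expR (th * j%:R).
  rewrite expRM_natr lnK ?posrE; last lra.
  by rewrite natrM exprM -!exprMn; congr (_ ^+ j); field; rewrite gt_eqF.
have e2 : expR (1 - (2 * j)%:R) * expR j%:R = expR 1 * expR (- j%:R) :> R.
  by rewrite -!expRD natrM; congr expR; ring.
have pw : 0 <= (2 * j)%:R ^+ (2 * j) :> R by rewrite exprn_ge0.
rewrite e1; set P := (2 * j)%:R ^+ (2 * j) in pw *; set Q := (L / j%:R) ^+ j.
rewrite [leLHS](_ : _ = P * (2 * j%:R * expR 1 * expR (- j%:R))); last first.
  by rewrite -[_ * expR j%:R]mulrA e2 natrM; ring.
rewrite [leRHS](_ : _ = P * (4 * expR 7 / th * expR (- (1 + th / 2) * L) * Q *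
  expR (th * j%:R))); last by ring.
apply: ler_wpM2l => //.
(* [j / L <= 1 + 2 / L] and [j <= 3 * L], so [(j / L) ^ j <= expR (2 * j / L) <= expR 6]. The 7 of
   the statement is this 6 plus 1 from Stirling. *)
have q6 : expR (- 6) <= Q.
  rewrite /Q.
  rewrite -[leRHS]invrK -exprVn invf_div expRN.
  rewrite lef_pV2 ?posrE ?expR_gt0 ?exprn_gt0 ?divr_gt0//; last lra.
  apply: (@le_trans _ _ (expR (2 / L) ^+ j)).
    have L0 : 0 <= L by lra.
    rewrite lerXn2r ?nnegrE ?expR_ge0 ?divr_ge0//.
    apply: le_trans (expR_ge1Dx _); rewrite ler_pdivrMr; last lra.
    by rewrite mulrDl mulfVK ?gt_eqF//; lra.
  rewrite -expRM_natr ler_expR mulrAC ler_pdivrMr; lra.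
have p1 : th * j%:R / 2 <= expR (th * j%:R / 2).
  by apply: le_trans (expR_ge1Dx _); rewrite lerDr.
have jle : 2 * j%:R <= 4 / th * expR (th * j%:R / 2).
  by rewrite mulrAC ler_pdivlMr//; lra.
have Lle : expR (- (1 + th / 2) * j%:R) <= expR (- (1 + th / 2) * L).
  by rewrite ler_expR !mulNr lerN2 ler_wpM2l//; lra.
apply: (@le_trans _ _ (4 / th * expR (th * j%:R / 2) * expR 1 * expR (- j%:R))).
  by rewrite !ler_wpM2r ?expR_ge0.
have -> : 4 / th * expR (th * j%:R / 2) * expR 1 * expR (- j%:R) =
   4 * expR 7 / th * expR (- (1 + th / 2) * j%:R) * expR (- 6) * expR (th * j%:R).
  have -> : 4 * expR 7 / th = 4 / th * expR 7 by rewrite mulrAC.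
  rewrite -!mulrA -!expRD; congr (_ * (_ * expR _)); by field.
rewrite ler_wpM2r ?expR_ge0//.
have c0 : 0 <= 4 * expR 7 / th by rewrite divr_ge0 ?(ltW th0)// mulr_ge0// expR_ge0.
apply: ler_pM => //; first by rewrite mulr_ge0 ?expR_ge0.
exact: ler_wpM2l.
Qed.

(** Telescoping against [G k = k ^ (- s)], the discrete form of integrating [k ^ (- 1 - s)]. *)
Lemma zeta_tail s e : 0 < s -> 0 < e -> exists k0, (0 < k0)%N /\
  forall k1, (k0 <= k1)%N -> forall K,
    \sum_(i < K) expR (- (1 + s) * ln (k1 + i).+1%:R) <= e.
Proof.
move=> s0 e0; pose G (k : nat) : R := expR (- s * ln k%:R).
have tele k : (0 < k)%N -> s * expR (- (1 + s) * ln k.+1%:R) <= G k - G k.+1.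
  move=> k0; have k0' : (0 : R) < k%:R by rewrite ltr0n.
  have K0 : (0 : R) < k.+1%:R by rewrite ltr0n.
  have e1 : expR (- (1 + s) * ln k.+1%:R) = G k.+1 / k.+1%:R.
    rewrite /G -[X in _ / X]lnK ?posrE// -expRN -expRD; congr expR; ring.
  have e2 : G k = G k.+1 * expR (s * (ln k.+1%:R - ln k%:R)).
    rewrite /G -expRD; congr expR; ring.
  have h1 : k.+1%:R^-1 <= ln k.+1%:R - ln k%:R :> R.
    have := @ln_le_pred (k%:R / k.+1%:R); rewrite divr_gt0// => /(_ isT).
    rewrite ln_div ?posrE// => h1.
    have : k%:R / k.+1%:R - 1 = - k.+1%:R^-1 :> R.
      by apply: (mulIf (lt0r_neq0 K0)); rewrite mulrBl mulNr mulVf ?divfK ?gt_eqF// -natr1; ring.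
    by move=> ee; move: h1; rewrite ee; set X := _^-1; lra.
  have h2 : 1 + s / k.+1%:R <= expR (s * (ln k.+1%:R - ln k%:R)).
    by apply: le_trans (expR_ge1Dx _); rewrite lerD2l ler_wpM2l// ltW.
  have G0 : 0 <= G k.+1 by exact: expR_ge0.
  rewrite e1 e2 mulrCA; have := ler_wpM2l G0 h2; rewrite mulrDr mulr1.
  set Y := G k.+1 * (s / _); set X := G k.+1 * expR _; lra.
have sum_le k1 K : (0 < k1)%N ->
    s * \sum_(i < K) expR (- (1 + s) * ln (k1 + i).+1%:R) <= G k1 - G (k1 + K)%N.
  move=> k10; elim: K => [|K IH]; first by rewrite big_ord0 mulr0 addn0 subrr.
  rewrite big_ord_recr/= mulrDr; have := tele (k1 + K)%N; rewrite addn_gt0 k10 => /(_ isT).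
  rewrite addnS; lra.
pose k0 := (Num.truncn (expR (- ln (s * e) / s))).+1.
exists k0; split=> // k1 k01 K.
have k10 : (0 < k1)%N by exact: leq_trans k01.
have G1 : G k1 <= s * e.
  rewrite /G -[leRHS]lnK ?posrE ?mulr_gt0// ler_expR mulNr lerNl.
  rewrite -ler_pdivrMl// mulrC -ler_expR lnK ?posrE ?ltr0n//.
  apply: ltW; apply: (lt_le_trans (truncnS_gt _)); by rewrite ler_nat.
rewrite -(ler_pM2l s0); apply: le_trans (sum_le _ _ k10) (le_trans _ G1).
by rewrite gerBl expR_ge0.
Qed.

End IteratedLog.

(** * Geometric blocks and limits superior *)

Section Blocks.
Variable R : realType.
Implicit Types (B eta : R).

Lemma limn_esup_le_near (u : nat -> \bar R) (l : \bar R) :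
  (\forall n \near \oo, (u n <= l)%E) -> (limn_esup u <= l)%E.
Proof.
move=> [N _ h]; rewrite limn_esup_lim; apply: lime_le; first exact: is_cvg_esups.
exists N => // n /= Nn; apply: ge_ereal_sup => _ [m /= nm <-].
by apply: h; exact: leq_trans nm.
Qed.

Lemma bernoulli eta k : 0 < eta -> 1 + k%:R * eta <= (1 + eta) ^+ k.
Proof.
move=> h; elim: k => [|k IH]; first by rewrite mul0r addr0 expr0.
rewrite exprS -natr1; have k0 : (0 : R) <= k%:R by []. nra.
Qed.

Lemma geom_large eta B : 0 < eta -> exists k1, forall k, (k1 <= k)%N -> B <= (1 + eta) ^+ k.
Proof.
move=> h; exists (Num.truncn (B / eta)).+1 => k hk.
apply: le_trans (bernoulli k h).
have : B / eta <= k%:R.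
  by apply: ltW; apply: (lt_le_trans (truncnS_gt _)); rewrite ler_nat.
rewrite ler_pdivrMr//; lra.
Qed.

Lemma geom_block eta t K : 0 < eta -> (1 + eta) ^+ K < t ->
  exists i, (1 + eta) ^+ (K + i) < t <= (1 + eta) ^+ (K + i).+1.
Proof.
move=> h Kt; have [k1 hk1] := geom_large t h.
have ex : exists m, t <= (1 + eta) ^+ (K + m) by exists k1; apply: hk1; exact: leq_addl.
case: (ex_minnP ex) => [[|i] ti mini].
  by move: ti; rewrite addn0 leNgt Kt.
exists i; rewrite -addnS ti andbT ltNge; apply/negP => /mini.
by rewrite ltnn.
Qed.

End Blocks.

(** * Upper bound in the law of the iterated logarithm *)

Section LIL.
Context (R : realType) (H : completeNormedModType R[i]).
Variable ip : {dot H for @Num.conj R[i]}.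
Hypothesis hilb : hilbert_norm ip.
Variable M : set (H -> H).
Hypothesis hM : von_neumann_algebra ip M.
Variable tau : (H -> H) -> R[i].
Hypothesis ht : faithful_normal_tracial_state ip M tau.
Variables (Mn : nat -> set (H -> H)) (E : nat -> (H -> H) -> (H -> H)).
Hypothesis hF : filtration ip M Mn.
Hypothesis hE : forall n, normal_cond_exp ip M (Mn n) tau (E n).
Variable x : nat -> H -> H.
Hypothesis hx : martingale Mn E x.
Hypothesis x0 : x 0%N = 0.

Local Notation rp := (rip ip).
Local Notation ad := (adj ip).
Local Notation rtr := (re_trace tau).
Local Notation sq := (s2 ip E x).

Let Mx n : M (x n) := @filtration_sub _ _ _ _ _ hF n _ (mart_mem hx n).

(** The brackets are sums of positive operators, and the norm is monotone on these. *)
Lemma s2_mono n m : (n <= m)%N -> sq n <= sq m.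
Proof.
elim: m => [|m IH]; first by rewrite leqn0 => /eqP ->.
rewrite leq_eqVlt => /predU1P[->//|]; rewrite ltnS => /IH /le_trans; apply.
have key (F : nat -> H -> H) : (forall i, M (F i)) -> (forall i, pos_op ip (F i)) ->
    opnorm (\sum_(i < m) F i) <= opnorm (\sum_(i < m.+1) F i).
  move=> MF pF.
  have pF' i v : 0 <= rp (F i v) v by have := pF i v; rewrite lecE => /andP[_].
  have MS k : M (\sum_(i < k) F i) by apply: (vna_sum hM).
  have saS k : ad (\sum_(i < k) F i) = \sum_(i < k) F i.
    elim: k => [|k IHk]; rewrite ?big_ord0.
      by apply: (adj_eq hilb hM); [exact: (vna0 hM)|move=> u v; rewrite rip0l rip0r].
    rewrite big_ord_recr/= (adjD hilb hM (MS k) (MF k)) IHk.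
    by rewrite (pos_op_adj hilb hM (MF k) (pF k)).
  apply: (opnorm_pos_le hilb hM) => // v.
    by rewrite rip_sum sumr_ge0.
  by rewrite !rip_sum big_ord_recr/= lerDl.
have bp i := bracket_pos hilb hM hF hE hx i.
have kr : opnorm _ <= opnorm _ := key (fun i => E i (ad (mdiff x i.+1) \o mdiff x i.+1))
  (fun i => let: And3 h _ _ := bp i in h) (fun i => let: And3 _ h _ := bp i in h).
have kl : opnorm _ <= opnorm _ := key (fun i => E i (mdiff x i.+1 \o ad (mdiff x i.+1)))
  (fun i => let: And3 _ _ (conj h _) := bp i in h) (fun i => let: And3 _ _ (conj _ h) := bp i in h).
by rewrite !s2E ge_max !le_max kr kl orbT.
Qed.

Lemma s2_0 : sq 0 = 0.
Proof.
rewrite s2E !big_ord0 maxxx; apply/le_anti/andP; split.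
  by apply: opnorm_le => // v; rewrite mul0r rnorm0.
by have [] := opnorm_bnd (vna_bounded hM (vna0 hM)).
Qed.

Lemma s2_ge0 n : 0 <= sq n.
Proof. by rewrite -s2_0 s2_mono. Qed.

(** Normalized so that its square modulus is [|x m|^(4 l) / (eta * thr ^ (2 l))]. The moment order
    [j = 2 * l] is even so that this is a square modulus without extracting a root. *)
Definition block_op m l (thr eta : R) : H -> H :=
  (Num.sqrt (eta * thr ^+ (2 * l))^-1)%:C *: iter l (ad (x m) \o x m).

(** Apply [E n] to [|x m|^2 <= thr + thr ^ (1 - 2 l) |x m|^(4 l)]; the tested inequality makes the
    last term at most [eta * thr]. *)
Lemma block_bound n m (thr eta : R) l w : (n <= m)%N -> 0 < thr -> 0 < eta -> (0 < l)%N ->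
  rp (E n (ad (block_op m l thr eta) \o block_op m l thr eta) w) w <= rp w w ->
  rp (x n w) (x n w) <= (1 + eta) * thr * rp w w.
Proof.
move=> nm thr0 eta0 l0; rewrite /block_op.
set c := (eta * thr ^+ (2 * l))^-1; set a := ad (x m) \o x m.
set z := _ *: _ => zw; have c0 : 0 < c by rewrite invr_gt0 mulr_gt0// exprn_gt0.
have Ma : M a by apply: (vna_comp hM) => //; exact: adj_mem.
have Ml := vna_iter hM l Ma.
have Mz : M z by exact: (vnaZ hM).
have Mz' := adj_mem hilb hM Mz; have Mzz := vna_comp hM Mz' Mz.
have saz u v : rp (iter l a u) v = rp u (iter l a v).
  by apply: iter_sa => u' v'; exact: (abs_sa hilb hM u' v' (Mx m)).
have zzE v : rp ((ad z \o z) v) v = c * rp (iter (2 * l) a v) v.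
  rewrite /= -(rip_adjr hilb hM _ _ Mz) /z !fctE ripZl ripZr saz mulrA -expr2.
  by rewrite sqr_sqrtr ?(ltW c0)// -iterD addnn -mul2n (ripC ip).
have Mi := vna_id hM.
pose b := (-1) *: a + ((eta * thr)%:C *: (ad z \o z) + thr%:C *: idfun).
have M2 : M (thr%:C *: idfun) by exact: (vnaZ hM).
have M1 : M ((eta * thr)%:C *: (ad z \o z) + thr%:C *: idfun).
  by apply: (vnaD hM) => //; exact: (vnaZ hM).
have Mb : M b by apply: (vnaD hM) => //; exact: (vnaZ hM).
have sb : ad b = b.
  apply: (adj_eq hilb hM) => // u v.
  have szz u' v' : rp ((ad z \o z) u') v' = rp u' ((ad z \o z) v') := abs_sa hilb hM u' v' Mz.
  have saa u' v' : rp (a u') v' = rp u' (a v') := abs_sa hilb hM u' v' (Mx m).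
  rewrite /b !fctE !scaleN1r !ripDl !ripDr !ripNl !ripNr !ripZl !ripZr saa.
  by congr (_ + (_ * _ + _)); exact: szz.
have pb : pos_op ip b.
  apply: (pos_op_sa hilb hM) => // v.
  rewrite /b !fctE scaleN1r !ripDl ripNl !ripZl [rp (_ (z v)) v]zzE.
  have l20 : (0 < 2 * l)%N by rewrite muln_gt0.
  have := abs_pow_le hilb hM v (Mx m) thr0 l20; rewrite -/a.
  have -> : thr / thr ^+ (2 * l) = eta * thr * c.
    by rewrite /c invfM; field; rewrite expf_eq0 !gt_eqF ?andbF.
  rewrite -[_ * c * _]mulrA; lra.
have := cond_exp_pos (hE n) Mb pb w; rewrite /b.
rewrite !(cond_exp_linear (hE n))//.
have -> : E n (thr%:C *: idfun) = thr%:C *: idfun.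
  apply: (cond_exp_id (hE n)); apply: (vnaZ (filtration_vna hF n)).
  exact: (vna_id (filtration_vna hF n)).
rewrite lecE => /andP[_]; rewrite -/(rip _ _ _) !fctE scaleN1r !ripDl ripNl !ripZl.
have := mart_abs_le hilb hM ht hF hE hx w nm.
have : eta * thr * rp (E n (ad z \o z) w) w <= eta * thr * rp w w.
  by rewrite ler_wpM2l// ltW// mulr_gt0.
rewrite -/a /=; lra.
Qed.

(** The condition on [T] bounds the exponential factor by [expR j] with [j = 2 * l], the value at
    which it balances best against [lam ^ (- 2 j)]. *)
Lemma block_trace m l (lam D T thr eta : R) : 0 < lam -> D <= 1 ->
  (forall i, (i < m)%N -> lam * opnorm (mdiff x i.+1) <= D) ->
  sq m <= T -> (2 - D)^-1 * lam ^+ 2 * T <= (2 * l)%:R -> 0 < thr -> 0 < eta ->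
  rtr (ad (block_op m l thr eta) \o block_op m l thr eta) <=
  eta^-1 * ((2 * (2 * l))`!%:R * expR (2 * l)%:R /
    (lam ^+ 2 * thr) ^+ (2 * l)).
Proof.
move=> lam0 D1 hd sT hT thr0 eta0; rewrite /block_op; set c := (eta * thr ^+ (2 * l))^-1.
set a := ad (x m) \o x m; set z := _ *: _; have c0 : 0 < c by rewrite invr_gt0 mulr_gt0// exprn_gt0.
have Ma : M a by apply: (vna_comp hM) => //; exact: adj_mem.
have Ml := vna_iter hM l Ma; have Mz : M z by exact: (vnaZ hM).
have saz u v : rp (iter l a u) v = rp u (iter l a v).
  by apply: iter_sa => u' v'; exact: (abs_sa hilb hM u' v' (Mx m)).
have adz : ad z = z.
  by apply: (adj_eq hilb hM) => // u v; rewrite /z !fctE ripZl ripZr saz.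
have -> : ad z \o z = c%:C *: iter (2 * l) a.
  apply/funext => v; rewrite adz /z /= !fctE (linZ _ _ (vna_linear hM Ml)) scalerA.
  by rewrite -rmorphM/= -expr2 sqr_sqrtr ?(ltW c0)// -iterD addnn mul2n.
rewrite (re_traceZ hM ht); last exact: (vna_iter hM).
have mm := mart_moment hilb hM ht hF hE hx x0 (2 * l) (ltW lam0) D1 hd.
have expo : expR ((2 - D)^-1 * lam ^+ 2 * sq m) <= expR (2 * l)%:R.
  rewrite ler_expR; apply: le_trans hT; rewrite ler_wpM2l// mulr_ge0 ?sqr_ge0// invr_ge0; lra.
have {}mm := le_trans mm (ler_wpM2l (ler0n R _) expo).
rewrite exprM -ler_pdivlMl ?exprn_gt0// in mm.
have := ler_wpM2l (ltW c0) mm; rewrite -/a => /le_trans; apply.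
rewrite /c [in leRHS]exprMn !invfM le_eqVlt; apply/orP; left; apply/eqP.
move: (thr ^+ _)^-1 ((lam ^+ 2) ^+ _)^-1 => P Q; ring.
Qed.

Section Main.
Variable alpha : nat -> R.
Hypothesis s2_oo : sq n @[n --> \oo] --> +oo.
Hypothesis alpha_gt0 : forall n, (1 <= n)%N -> 0 < alpha n.
Hypothesis alpha0 : alpha n @[n --> \oo] --> (0 : R).
Hypothesis d_small : forall n, (1 <= n)%N ->
  opnorm (mdiff x n) <= alpha n * s_ ip E x n / u_ ip E x n.

Lemma s2_large (B : R) : exists n0, forall n, (n0 <= n)%N -> B <= sq n.
Proof.
have /cvgryPge/(_ B)[n0 _ h] := s2_oo.
by exists n0 => n nn; exact: h.
Qed.

Lemma last_before (T : R) : 0 <= T -> exists N, sq N <= T /\ forall n, sq n <= T -> (n <= N)%N.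
Proof.
move=> T0; have [n0 rnorm0] := s2_large (T + 1).
have bd n : sq n <= T -> (n <= n0)%N.
  move=> h; rewrite leqNgt; apply/negP => /ltnW/rnorm0; lra.
have ex : exists n, sq n <= T by exists 0%N; rewrite s2_0.
by case: (ex_maxnP ex bd) => N h1 h2; exists N.
Qed.

Lemma s_u_sq n : (s_ ip E x n * u_ ip E x n) ^+ 2 = sq n * LL (sq n).
Proof. by rewrite exprMn /s_ /u_ !sqr_sqrtr ?s2_ge0// ltW// LL_gt0. Qed.

(** Late differences are small by [alpha] and [LL_ratio]. The finitely many early ones are fixed
    while [lam] tends to 0, since [LL T <= 3 * sqrt T]. *)
Lemma mdiff_small (eta D : R) : 0 < eta -> 0 < D -> exists k1, forall k, (k1 <= k)%N ->
  let T := (1 + eta) ^+ k in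
  forall N lam, sq N <= T -> 0 <= lam -> lam ^+ 2 * T <= 6 * LL T ->
  forall i, (i < N)%N -> lam * opnorm (mdiff x i.+1) <= D.
Proof.
move=> eta0 D0.
(* Late differences end up with the bound [6 * (D / 3) ^ 2 <= D ^ 2], the 6 being that of the
   hypothesis on [lam]. *)
have D3 : 0 < D / 3 by rewrite divr_gt0.
have /cvgrPdist_lt/(_ _ D3)[n0 _ rnorm0] := alpha0.
pose A := \sum_(i < n0) opnorm (mdiff x i.+1).
have op0 i : 0 <= opnorm (mdiff x i.+1).
  have Md : M (mdiff x i.+1) := @filtration_sub _ _ _ _ _ hF i.+1 _ (mdiff_mem hF hx i).
  by have [] := opnorm_bnd (vna_bounded hM Md).
have A0 : 0 <= A by apply: sumr_ge0.
(* With such a [T], [18 A^2 / sqrt T <= D^2], where 18 is 6 times the 3 of [LL_le_sqrt]. *)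
have [k1 hk1] := geom_large ((18 * A ^+ 2 / D ^+ 2) ^+ 2) eta0.
exists k1 => k kk T N lam sN lam0 hlam i iN.
have T1 : 1 <= T by rewrite exprn_ege1//; lra.
have T0 : 0 < T by lra.
rewrite -(@ler_pXn2r _ 2) ?nnegrE ?mulr_ge0 ?(ltW D0)// exprMn.
case: (ltnP i n0) => i0.
  have iA : opnorm (mdiff x i.+1) <= A.
    rewrite /A (bigD1 (Ordinal i0))//= lerDl; exact: sumr_ge0.
  have sqT0 : 0 < Num.sqrt T by rewrite sqrtr_gt0.
  have lam18 : lam ^+ 2 * Num.sqrt T <= 18.
    have h1 := LL_le_sqrt T1.
    have h2 : lam ^+ 2 * Num.sqrt T * Num.sqrt T <= 18 * Num.sqrt T.
      by rewrite -mulrA -expr2 sqr_sqrtr ?(ltW T0)//; lra.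
    by rewrite ler_pM2r// in h2.
  have hT : 18 * A ^+ 2 / D ^+ 2 <= Num.sqrt T.
    rewrite -(@ler_pXn2r _ 2) ?nnegrE ?sqrtr_ge0//; last first.
      by rewrite divr_ge0 ?sqr_ge0// mulr_ge0// sqr_ge0.
    by rewrite [leRHS]sqr_sqrtr ?(ltW T0)//; exact: hk1.
  rewrite ler_pdivrMr ?exprn_gt0// in hT.
  have iA2 : opnorm (mdiff x i.+1) ^+ 2 <= A ^+ 2 by rewrite lerXn2r ?nnegrE.
  rewrite -(ler_pM2r sqT0).
  apply: (@le_trans _ _ (18 * A ^+ 2)); last by rewrite [leRHS]mulrC.
  rewrite mulrAC; apply: ler_pM => //; rewrite ?mulr_ge0 ?sqr_ge0 ?sqrtr_ge0//.
have ai : `|alpha i.+1| < D / 3.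
  have := rnorm0 i.+1; rewrite /= sub0r normrN; apply; exact: leqW.
have al0 := alpha_gt0 (ltn0Sn i); rewrite gtr0_norm// in ai.
have si : sq i.+1 <= T by apply: le_trans sN; exact: s2_mono.
have ratio := LL_ratio (s2_ge0 i.+1) si.
have LLi := LL_gt0 (sq i.+1).
have d2 : opnorm (mdiff x i.+1) ^+ 2 <= alpha i.+1 ^+ 2 * sq i.+1 / LL (sq i.+1).
  apply: (@le_trans _ _ ((alpha i.+1 * s_ ip E x i.+1 / u_ ip E x i.+1) ^+ 2)).
    rewrite lerXn2r ?nnegrE// ?d_small//.
    by rewrite divr_ge0 ?mulr_ge0 ?sqrtr_ge0// ltW.
  by rewrite !exprMn exprVn /s_ /u_ !sqr_sqrtr ?s2_ge0// ltW.
have LT0 := LL_gt0 T.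
have : lam ^+ 2 * opnorm (mdiff x i.+1) ^+ 2 <= 6 * alpha i.+1 ^+ 2.
  apply: (le_trans (ler_wpM2l (sqr_ge0 lam) d2)).
  rewrite mulrA ler_pdivrMr// -(ler_pM2r T0).
  have e1 : lam ^+ 2 * T * (alpha i.+1 ^+ 2 * sq i.+1) <= 6 * LL T * (alpha i.+1 ^+ 2 * sq i.+1).
    by rewrite ler_wpM2r// mulr_ge0 ?sqr_ge0 ?s2_ge0.
  have e2 : 6 * alpha i.+1 ^+ 2 * (sq i.+1 * LL T) <= 6 * alpha i.+1 ^+ 2 * (T * LL (sq i.+1)).
    by rewrite ler_wpM2l// mulr_ge0// sqr_ge0.
  nra.
move=> /le_trans; apply; nra.
Qed.

Lemma lil_limsup : limsup_au_le ip M tau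
  (fun n => ((s_ ip E x n * u_ ip E x n)^-1)%:C *: x n) (Num.sqrt 2).
Proof.
move=> eps delta eps0 delta0.
(* Five factors [1 + eta] accumulate: one from [block_bound], two in [thr], two from comparing
   [T k.+1] and [L k.+1] with their values at [sq n]. For [eta <= 1] their product is at most
   [1 + 31 * eta], where [31 = 2 ^ 5 - 1]. *)
pose eta := Num.min 1 (delta / 31).
have eta0 : 0 < eta by rewrite lt_min ltr01 divr_gt0.
have eta1 : eta <= 1 by rewrite ge_min lexx.
have etad : 31 * eta <= delta by rewrite mulrC -ler_pdivlMr// ge_min lexx orbT.
pose T k := (1 + eta) ^+ k; pose L k := LL (T k).
have T1 k : 1 <= T k by rewrite exprn_ege1//; lra.
have T0 k : 0 < T k by apply: lt_le_trans (T1 k).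
have L1 k : 1 <= L k by exact: LL_ge1.
have L0 k : 0 < L k by exact: LL_gt0.
(* [2 * l k], about [ln ln (T k)], nearly optimizes the moment bound. *)
pose l k := (Num.truncn (L k / 2)).+1.
have /all_and2[jL jU] k : L k <= (2 * l k)%:R /\ (2 * l k)%:R <= L k + 2.
  have Lk2 : 0 <= L k / 2 by rewrite divr_ge0// ltW.
  have /andP[h1 h2] := truncn_itv Lk2.
  have -> : (2 * l k)%:R = 2 * ((Num.truncn (L k / 2))%:R + 1) :> R by rewrite natrM natr1.
  by rewrite -[X in _ < X]natr1 in h2; split; lra.
have j0 k : (0 : R) < (2 * l k)%:R by rewrite ltr0n muln_gt0.
(* Solves [(2 - D)^-1 = (1 + eta) / 2]. *)
pose D := 2 * eta / (1 + eta).
have eta1' : 0 < 1 + eta by lra.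
have D0 : 0 < D by rewrite divr_gt0// mulr_gt0.
have D1 : D <= 1 by rewrite ler_pdivrMr//; lra.
have DE : (2 - D)^-1 = (1 + eta) / 2.
  by rewrite -[RHS]invrK invf_div /D; congr _^-1; field; rewrite gt_eqF.
(* Makes [(2 - D)^-1 * lam k ^+ 2 * T k] equal to the moment order [2 * l k]. *)
pose lam k := Num.sqrt (2 * (2 * l k)%:R / ((1 + eta) * T k)).
have lam_arg k : 0 < 2 * (2 * l k)%:R / ((1 + eta) * T k).
  by rewrite divr_gt0// mulr_gt0.
have lam0 k : 0 < lam k by rewrite sqrtr_gt0.
have lam2 k : lam k ^+ 2 * T k = 2 * (2 * l k)%:R / (1 + eta).
  rewrite sqr_sqrtr ?(ltW (lam_arg k))//; move: (T0 k) => ?; field.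
  by rewrite !gt_eqF.
(* Above the critical [2 * T k * L k] by two factors: one cancels the [1 + eta] in [lam k], the
   other is the gain exploited in [moment_term_le]. *)
pose thr k := 2 * (1 + eta) ^+ 2 * T k * L k.
have thr0 k : 0 < thr k by rewrite !mulr_gt0// exprn_gt0.
have [k1 hk1] := mdiff_small eta0 D0.
have [N hN] := choice (fun k => last_before (ltW (T0 k))).
pose z k := block_op (N k) (l k) (thr k) eta.
pose th := ln (1 + eta); have th0 : 0 < th := ln_gt0_geom eta0.
pose s := th / 2; have s0 : 0 < s by rewrite divr_gt0.
(* As [ln (T k) = k * th], the exponent [L k] is at least [ln k + ln th]; the constant part goes
   into [C]. *)
pose C := eta^-1 * (4 * expR 7 / th) * expR (- (1 + s) * ln th).
have C0 : 0 < C by rewrite !mulr_gt0 ?invr_gt0 ?expR_gt0.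
have tr_le k : (k1 <= k.+1)%N ->
    rtr (ad (z k.+1) \o z k.+1) <= C * expR (- (1 + s) * ln k.+1%:R).
  move=> kk1; have [sN _] := hN k.+1.
  have lam6 : lam k.+1 ^+ 2 * T k.+1 <= 6 * L k.+1.
    rewrite lam2 ler_pdivrMr//; have := jU k.+1; have := L1 k.+1; nra.
  have hd := hk1 _ kk1 _ _ sN (ltW (lam0 _)) lam6.
  have hT : (2 - D)^-1 * lam k.+1 ^+ 2 * T k.+1 <= (2 * l k.+1)%:R.
    by rewrite -mulrA lam2 DE le_eqVlt; apply/orP; left; apply/eqP; field; rewrite gt_eqF.
  apply: (le_trans (block_trace (lam0 _) D1 hd sN hT (thr0 _) eta0)).
  have -> : lam k.+1 ^+ 2 * thr k.+1 = 4 * (2 * l k.+1)%:R * (1 + eta) * L k.+1.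
    have -> : lam k.+1 ^+ 2 * thr k.+1 =
      lam k.+1 ^+ 2 * T k.+1 * (2 * (1 + eta) ^+ 2 * L k.+1) by rewrite /thr; ring.
    by rewrite lam2; field; rewrite gt_eqF.
  have := moment_term_le eta0 (L1 k.+1) (jL k.+1) (jU k.+1).
  rewrite -/th -/s => /(ler_wpM2l (ltW (_ : 0 < eta^-1))); rewrite invr_gt0 => /(_ eta0).
  move=> /le_trans; apply; rewrite mulrA /C -[leRHS]mulrA.
  rewrite ler_wpM2l//; first by rewrite !mulr_ge0 ?invr_ge0 ?expR_ge0// ltW.
  rewrite -expRD ler_expR -mulrDr !mulNr lerN2 ler_wpM2l//; first lra.
  rewrite addrC -lnM ?posrE ?ltr0n// -ln_geom//.
  by apply: lnln_le_LL; exact: geom_gt1.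
have e20 : 0 < eps / 2 / C by rewrite !divr_gt0.
have [k0 [_ hk0]] := zeta_tail s0 e20.
(* From [k0] on the tail of the series is small, from [k1] on the differences are small, and beyond
   [1 / eta] consecutive values of [L] are comparable. *)
pose K0 := maxn k0 (maxn k1 (Num.truncn eta^-1).+1).
have K00 : (k0 <= K0)%N by exact: leq_maxl.
have K01 : (k1 <= K0)%N by rewrite !leq_max leqnn orbT.
have K02 : (Num.truncn eta^-1 < K0)%N by rewrite !leq_max leqnn !orbT.
(* Times that precede these blocks are switched off in [cuculescu] and have no effect on the limit
   superior. *)
have block n : exists i, T K0 < sq n -> T (K0 + i)%N < sq n <= T (K0 + i).+1.
  case: (ltP (T K0) (sq n)) => h; last by exists 0%N.
  by have [i hi] := geom_block eta0 h; exists i.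
have [kk hkk] := choice block.
have Mz k : M (z k).
  by apply: (vnaZ hM); apply/(vna_iter hM)/(vna_comp hM) => //; exact: adj_mem.
have sumz K : \sum_(i < K) rtr (ad (z (K0 + i).+1) \o z (K0 + i).+1) <= eps / 2.
  apply: (@le_trans _ _ (\sum_(i < K) C * expR (- (1 + s) * ln (K0 + i).+1%:R))).
    apply: ler_sum => i _; apply: tr_le.
    by rewrite (leq_trans K01)// ltnW// ltnS leq_addr.
  by rewrite -mulr_sumr mulrC -ler_pdivlMr// hk0.
have [p [Mp pp trp hp]] := cuculescu hilb hM ht hF hE (fun n => T K0 < sq n) kk
  (fun i => Mz (K0 + i).+1) sumz.
exists p; split=> //.
  have Mi := vnaB hM (vna_id hM) Mp.
  have pip := proj_compl_pos hilb hM Mp (projection_proj pp).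
  by rewrite (tau_pos_real ht)// ltcR; apply: (le_lt_trans trp); lra.
apply: limn_esup_le_near.
have [n0 rnorm0] := s2_large (T K0 + 1).
exists n0 => // n /= nn; have act : T K0 < sq n by have := rnorm0 n nn; lra.
rewrite lee_fin; set su := s_ ip E x n * u_ ip E x n.
have sq0 : 0 < sq n by apply: lt_trans act; exact: T0.
have LL0 := LL_gt0 (sq n).
have su0 : 0 < su by rewrite mulr_gt0 ?sqrtr_gt0.
have K2 : 0 <= Num.sqrt 2 + delta by rewrite addr_ge0 ?sqrtr_ge0// ltW.
apply: opnorm_le => // v.
rewrite /= fctE rnormZ gtr0_norm ?invr_gt0// -ler_pdivlMl ?invr_gt0// invrK mulrA.
rewrite (rnorm_leM hilb); last by rewrite mulr_ge0// ltW.
set k := (K0 + kk n)%N; have /andP[Tk1 Tk2] := hkk n act.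
have nN : (n <= N k.+1)%N by have [_ h] := hN k.+1; exact: h.
have := block_bound nN (thr0 k.+1) eta0 (ltn0Sn _) (hp n v act).
move=> /le_trans; apply.
have pv : rp (p v) (p v) <= rp v v.
  by rewrite -subr_ge0 -(proj_compl _ (projection_proj pp)) (rip_ge0 hilb).
have r0 : 0 <= (1 + eta) * thr k.+1 by rewrite mulr_ge0// ltW.
apply: (le_trans (ler_wpM2l r0 pv)); rewrite ler_wpM2r ?(rip_ge0 hilb)//.
rewrite exprMn s_u_sq.
have LLk : L k.+1 <= (1 + eta) * LL (sq n).
  apply: (@le_trans _ _ ((1 + eta) * L k)); last first.
    by rewrite ler_wpM2l ?(ltW eta1')// LL_mono// ltW.
  apply: LL_geom => //; first by rewrite (leq_trans _ (leq_addr _ _))// (leq_trans _ K02).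
  apply: ltW; apply: (lt_le_trans (truncnS_gt _)); rewrite ler_nat.
  exact: leq_trans K02 (leq_addr _ _).
have Tk : T k.+1 <= (1 + eta) * sq n.
  by rewrite /T exprS ler_wpM2l ?(ltW eta1')// ltW.
have prod : T k.+1 * L k.+1 <= (1 + eta) ^+ 2 * (sq n * LL (sq n)).
  rewrite [leRHS](_ : _ = (1 + eta) * sq n * ((1 + eta) * LL (sq n))); last by ring.
  by apply: ler_pM => //; exact: ltW.
apply: (@le_trans _ _ (2 * (1 + eta) ^+ 5 * (sq n * LL (sq n)))).
  rewrite [leLHS](_ : _ = 2 * (1 + eta) ^+ 3 * (T k.+1 * L k.+1)); last by rewrite /thr; ring.
  rewrite [leRHS](_ : _ = 2 * (1 + eta) ^+ 3 * ((1 + eta) ^+ 2 * (sq n * LL (sq n)))); last by ring.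
  by rewrite ler_wpM2l// mulr_ge0// exprn_ge0// ltW.
rewrite mulrC ler_wpM2l ?mulr_ge0 ?(ltW sq0) ?(ltW LL0)//.
have pow5 : (1 + eta) ^+ 5 <= 1 + 31 * eta.
  have -> : (1 + eta) ^+ 5 =
    1 + 5 * eta + 10 * eta ^+ 2 + 10 * eta ^+ 3 + 5 * eta ^+ 4 + eta ^+ 5 by ring.
  have pw m : eta ^+ m.+1 <= eta.
    by rewrite exprS ler_piMr ?(ltW eta0)// exprn_ile1// ltW.
  have := pw 1%N; have := pw 2%N; have := pw 3%N; have := pw 4%N; lra.
have r2 : 1 <= Num.sqrt 2 :> R by rewrite -[leLHS]sqrtr1 ler_wsqrtr// ler1n.
have r22 : Num.sqrt 2 ^+ 2 = 2 :> R by rewrite sqr_sqrtr.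
(* [2 * (1 + 31 * eta) <= 2 + 2 * delta], which is below [(sqrt 2 + delta) ^ 2] because
   [sqrt 2 >= 1]. *)
rewrite sqrrD r22; nra.
Qed.

End Main.

End LIL.

Theorem theorem1p2 (R : realType) (H : completeNormedModType R[i])
    (ip : {dot H for @Num.conj R[i]})
    (M : set (H -> H)) (tau : (H -> H) -> R[i])
    (Mn : nat -> set (H -> H)) (E : nat -> (H -> H) -> (H -> H))
    (x : nat -> H -> H) (alpha : nat -> R) :
  hilbert_norm ip -> @separable_space R H ->
  von_neumann_algebra ip M ->
  faithful_normal_tracial_state ip M tau ->
  filtration ip M Mn ->
  (forall n, normal_cond_exp ip M (Mn n) tau (E n)) ->
  martingale Mn E x -> x 0%N = 0 ->
  s2 ip E x n @[n --> \oo] --> +oo ->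
  (forall n, (1 <= n)%N -> 0 < alpha n) ->
  alpha n @[n --> \oo] --> (0 : R) ->
  (forall n, (1 <= n)%N ->
    opnorm (mdiff x n) <= alpha n * s_ ip E x n / u_ ip E x n) ->
  limsup_au_le ip M tau
    (fun n => ((s_ ip E x n * u_ ip E x n)^-1)%:C *: x n) (Num.sqrt 2).
Proof.
move=> hilb _ hM ht hF hE hx x0 s2_oo alpha_gt0 alpha0 d_small.
exact: (lil_limsup hilb hM ht hF hE hx x0 s2_oo alpha_gt0 alpha0 d_small).
Qed.
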